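(* Let $M=\Gamma\backslash G$ be a $2n$-dimensional nilmanifold endowed with an invariant complex structure $J$, and let $\mathfrak g$ be the Lie algebra of $G$. If $(\mathfrak g,J)$ satisfies the $(n-1,n)$-th weak $\partial\bar\partial$-lemma and $H^{n-2,n}(M,J)\cong H^{n-2,n}(\mathfrak g,J)$, then $(M,J)$ satisfies the $(n-1,n)$-th weak $\partial\bar\partial$-lemma.
   Context: A nilmanifold is a compact quotient $\Gamma\backslash G$ of a simply-connected nilpotent Lie group $G$ by a lattice $\Gamma$ of maximal rank; an invariant complex structure on it is one induced by a left-invariant complex structure on $G$, i.e. by a complex structure $J$ on $\mathfrak g$. $\bigwedge^{p,q}(\mathfrak g^* )$ denotes the space of $(p,q)$-elements of $\bigwedge^*\mathfrak g^*_{\mathbb C}$ with respect to $J$, with differentials $\partial,\bar\partial$ induced by the Chevalley-Eilenberg differential $d=\partial+\bar\partial$; $\mathcal A^{p,q}(M)$ is the space of smooth $(p,q)$-forms on $(M,J)$. $H^{p,q}(M,J)$ is the Dolbeault cohomology of $(M,J)$, and $H^{p,q}(\mathfrak g,J)$ is the cohomology of the complex $(\bigwedge^{*,*}(\mathfrak g^* ),\bar\partial)$. The isomorphism in the statement is the one induced by the natural inclusion $(\bigwedge^{*,*}(\mathfrak g^* ),\bar\partial)\hookrightarrow(\mathcal A^{*,*}(M),\bar\partial)$. A compact complex $n$-dimensional manifold satisfies the $(n-1,n)$-th weak $\partial\bar\partial$-lemma if for each real form $\varphi$ of type $(n-1,n-1)$ such that $\bar\partial\varphi$ is $\partial$-exact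 (i.e. $\bar\partial\varphi=\partial\eta$ for some $(n-2,n)$-form $\eta$) there exists an $(n-2,n-1)$-form $\psi$ with $\bar\partial\varphi=i\,\partial\bar\partial\psi$. The pair $(\mathfrak g,J)$ satisfies the $(n-1,n)$-th weak $\partial\bar\partial$-lemma if for each real $\varphi\in\bigwedge^{n-1,n-1}(\mathfrak g^* )$ with $\bar\partial\varphi=\partial\eta$ for some $\eta\in\bigwedge^{n-2,n}(\mathfrak g^* )$, there is $\psi\in\bigwedge^{n-2,n-1}(\mathfrak g^* )$ with $\bar\partial\varphi=i\,\partial\bar\partial\psi$. *)

(* Defs.v *)
From HB Require Import structures.
From mathcomp Require Import all_boot all_order all_algebra.
From mathcomp Require Import generic_quotient complex.
From mathcomp Require Import all_classical all_reals all_analysis.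

Set Implicit Arguments.
Unset Strict Implicit.
Unset Printing Implicit Defensive.

Import Order.TTheory GRing.Theory Num.Theory numFieldNormedType.Exports.

Local Open Scope classical_set_scope.
Local Open Scope ring_scope.

#[short(type="groupTopologicalType")]
HB.structure Definition GroupTopological := {G of Group G & Topological G}.

Section Smooth.
Context {R : realType} {m : nat} {W : normedModType R}.

Fixpoint Ck (k : nat) (O : set 'rV[R]_m) (f : 'rV[R]_m -> W) : Prop :=
  match k with
  | 0 => forall y, O y -> {for y, continuous f}
  | k'.+1 => (forall y, O y -> differentiable f y) /\
             (forall v, Ck k' O (fun y => 'D_v f y))
  end.

Definition smooth_on (O : set 'rV[R]_m) (f : 'rV[R]_m -> W) : Prop :=
  forall k, Ck k O f.

End Smooth.

(* [coord] is only relevant on [dom], and [param] on the image of [dom]. *)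
Record chart (R : realType) (N : nat) (T : Type) := Chart {
  dom : set T;
  coord : T -> 'rV[R]_N;
  param : 'rV[R]_N -> T
}.

Definition chart_image (R : realType) (N : nat) (T : Type)
  (c : chart R N T) : set 'rV[R]_N := coord c @` dom c.

(* An atlas is given as a choice, for every point, of a chart around that
   point.  This loses no generality, and it allows the tangent space at [x] to
   be taken to be the space R^N of coordinates in the chart [A x]. *)
Definition atlas (R : realType) (N : nat) (T : Type) := T -> chart R N T.

Record is_chart (R : realType) (N : nat) (T : topologicalType)
    (c : chart R N T) : Prop := IsChart {
  open_dom : open (dom c);
  open_image : open (chart_image c);
  coord_continuous : forall x, dom c x -> {for x, continuous (coord c)};
  param_continuous :
    forall y, chart_image c y -> {for y, continuous (param c)};
  coordK : forall x, dom c x -> param c (coord c x) = x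
}.

Record is_manifold (R : realType) (N : nat) (T : topologicalType)
    (A : atlas R N T) : Prop := IsManifold {
  manifold_hausdorff : hausdorff_space T;
  manifold_second_countable : @second_countable T;
  manifold_chart : forall x, is_chart (A x);
  manifold_cover : forall x, dom (A x) x;
  manifold_transition : forall x x',
    smooth_on (coord (A x) @` (dom (A x) `&` dom (A x')))
      (coord (A x') \o param (A x))
}.

Definition smooth_map (R : realType) (N N' : nat) (T T' : topologicalType)
    (A : atlas R N T) (A' : atlas R N' T') (f : T -> T') : Prop :=
  continuous f /\
  forall x x',
    smooth_on (coord (A x) @` (dom (A x) `&` f @^-1` dom (A' x')))
      (coord (A' x') \o f \o param (A x)).

Definition prod_atlas (R : realType) (N N' : nat) (T T' : Type)
    (A : atlas R N T) (A' : atlas R N' T') : atlas R (N + N') (T * T') :=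
  fun x => Chart
    (dom (A x.1) `*` dom (A' x.2))
    (fun z => row_mx (coord (A x.1) z.1) (coord (A' x.2) z.2))
    (fun w => (param (A x.1) (lsubmx w), param (A' x.2) (rsubmx w))).

(* Matrix, acting on row vectors from the right, of the tangent map at [x],
   in the charts chosen by the atlases at [x] and at [f x]. *)
Definition tangent (R : realType) (N N' : nat) (T T' : Type)
    (A : atlas R N T) (A' : atlas R N' T') (f : T -> T') (x : T) :
    'M[R]_(N, N') :=
  jacobian (coord (A' (f x)) \o f \o param (A x)) (coord (A x) x).

Record lieGroup (R : realType) (N : nat) := LieGroup {
  lie_sort :> groupTopologicalType;
  lie_atlas : atlas R N lie_sort;
  lie_manifold : is_manifold lie_atlas;
  lie_mul_smooth : smooth_map (prod_atlas lie_atlas lie_atlas) lie_atlas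
                     (fun z : lie_sort * lie_sort => (z.1 * z.2)%g);
  lie_inv_smooth : smooth_map lie_atlas lie_atlas
                     (fun x : lie_sort => (x^-1)%g)
}.

Arguments lie_atlas {R N} l _.

Definition is_subgroup (G : groupType) (H : set G) : Prop :=
  [/\ H 1%g, (forall x y, H x -> H y -> H (x * y)%g)
    & (forall x, H x -> H (x^-1)%g)].

Definition generated (G : groupType) (S : set G) : set G :=
  \bigcap_(H in [set H | is_subgroup H /\ S `<=` H]) H.

Fixpoint lower_central (G : groupType) (k : nat) : set G :=
  match k with
  | 0 => setT
  | k'.+1 => generated
      [set z | exists x y, lower_central k' x /\ z = [~ x, y]%g]
  end.

Definition nilpotent_group (G : groupType) : Prop :=
  exists k, @lower_central G k = [set 1%g].

(* Path-connectedness is part of the definition. *)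
Definition simply_connected (R : realType) (T : topologicalType) : Prop :=
  let I := `[0%R : R, 1%R]%classic in
  (forall x y : T, exists f : R -> T,
     [/\ {within I, continuous f}, f 0 = x & f 1 = y]) /\
  (forall f : R -> T, {within I, continuous f} -> f 0 = f 1 ->
     exists H : R * R -> T, {within I `*` I, continuous H} /\
       forall t, I t -> [/\ H (0, t) = f t, H (1, t) = f 0,
                            H (t, 0) = f 0 & H (t, 1) = f 0]).

Record subgroup (G : groupType) := Subgroup {
  subgroup_set :> set G;
  subgroupP : is_subgroup subgroup_set
}.

Section Quotient.
Context (G : groupTopologicalType) (Gamma : subgroup G).

Definition orbit_rel (x y : G) : bool :=
  `[< exists2 g, subgroup_set Gamma g & y = (g * x)%g >].

Lemma orbit_rel_equiv : equiv_class_of orbit_rel.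
Proof.
have [G1 GM GV] := subgroupP Gamma.
have sym x y : orbit_rel x y -> orbit_rel y x.
  move=> /asboolP[g Gg ->]; apply/asboolP; exists (g^-1)%g; first exact: GV.
  by rewrite mulgA mulVg mul1g.
split.
- by move=> x; apply/asboolP; exists 1%g => //; rewrite mul1g.
- by move=> x y; apply/idP/idP; exact: sym.
- move=> y x z /asboolP[g Gg ->] /asboolP[h Gh ->]; apply/asboolP.
  by exists (h * g)%g; [exact: GM | rewrite mulgA].
Qed.

Canonical orbit_equiv := EquivRelPack orbit_rel_equiv.

Definition left_quotient : topologicalType :=
  quotient_topology {eq_quot orbit_rel}%qT.

Definition is_lattice : Prop :=
  (exists2 U : set G, nbhs (1%g : G) U & U `&` Gamma `<=` [set 1%g]) /\
  compact [set: left_quotient].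

End Quotient.

Section Forms.
Context {R : realType} {N : nat}.
Local Notation C := R[i].
Local Notation VC := 'rV[C]_N.
Local Notation ii := ('i%C : C).

Definition cmx (n m : nat) (M : 'M[R]_(n, m)) : 'M[C]_(n, m) :=
  map_mx (fun a : R => a%:C%C) M.
Definition reV (Z : VC) : 'rV[R]_N := map_mx (@complex.Re R) Z.
Definition imV (Z : VC) : 'rV[R]_N := map_mx (@complex.Im R) Z.
Definition conjV (Z : VC) : VC := map_mx (@conjc R) Z.

(* A cochain takes lists of vectors as arguments: its value on lists of
   length k is its component of degree k. *)
Definition alternating_form (a : seq VC -> C) : Prop :=
  (forall s t (c : C) (u v : VC),
     a (s ++ (c *: u + v) :: t) = c * a (s ++ u :: t) + a (s ++ v :: t)) /\
  (forall r s t (u : VC), a (r ++ u :: s ++ u :: t) = 0).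

Definition real_form (a : seq VC -> C) : Prop :=
  forall s, a (map conjV s) = (a s)^*%C.

Definition omit (T : Type) (i : nat) (s : seq T) : seq T :=
  take i s ++ drop i.+1 s.

Section Type_.
Context (J : 'M[R]_N).

Definition vec10 (Z : VC) : bool := Z *m cmx J == ii *: Z.
Definition vec01 (Z : VC) : bool := Z *m cmx J == - ii *: Z.
Definition proj10 (Z : VC) : VC := 2%:R^-1 *: (Z - ii *: (Z *m cmx J)).
Definition proj01 (Z : VC) : VC := 2%:R^-1 *: (Z + ii *: (Z *m cmx J)).

(* The bidegrees are integers, so that e.g. forms of type (-1, 1) are 0. *)
Definition has_type (p q : int) (a : seq VC -> C) : Prop :=
  (forall s, (size s)%:Z != p + q -> a s = 0) /\
  (forall s, all [pred Z | vec10 Z || vec01 Z] s ->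
     (count vec10 s)%:Z != p -> a s = 0).

(* The component of type (p, q): for a of degree k = p + q it is
   a (Z_1, ..., Z_k) with each Z_i expanded as Z_i^{1,0} + Z_i^{0,1}, where one
   only keeps the terms having p arguments of type (1, 0). *)
Definition type_part (p q : int) (a : seq VC -> C) (s : seq VC) : C :=
  if (size s)%:Z == p + q then
    \sum_(b : (size s).-tuple bool | (count id b)%:Z == p)
      a [seq (if z.1 then proj10 z.2 else proj01 z.2) | z <- zip b s]
  else 0.

End Type_.

End Forms.

(* Z / B as a set of cosets. *)
Definition cohomology (V : zmodType) (Z B : set V) : set (set V) :=
  [set [set w | Z w /\ B (w - z)] | z in Z].

(* The coset of B in Z containing the image under [i] of the class [c]. *)
Definition induced (V W : zmodType) (Z B : set W) (i : V -> W)
    (c : set V) : set W :=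
  [set w | Z w /\ exists2 a, c a & B (w - i a)].

Section Nilmanifold.
Context {R : realType} {N : nat} (G : lieGroup R N).
Local Notation C := R[i].
Local Notation VR := 'rV[R]_N.
Local Notation VC := 'rV[C]_N.
Local Notation ii := ('i%C : C).
Local Notation A := (lie_atlas G).

Definition ltrans (g x : G) : G := (g * x)%g.

(* The Lie algebra is the tangent space at 1, i.e. R^N through the chart at 1,
   with the bracket of left-invariant vector fields. *)
Definition base_point : VR := coord (A 1%g) 1%g.

Definition left_invariant_field (v : VR) (y : VR) : VR :=
  v *m jacobian (coord (A 1%g) \o ltrans (param (A 1%g) y) \o param (A 1%g))
         base_point.

Definition field_bracket (X Y : VR -> VR) (y : VR) : VR :=
  'D_(X y) Y y - 'D_(Y y) X y.

Definition lie_bracket (u v : VR) : VR :=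
  field_bracket (left_invariant_field u) (left_invariant_field v) base_point.

Definition lie_bracketC (Z W : VC) : VC :=
  cmx (lie_bracket (reV Z) (reV W)) - cmx (lie_bracket (imV Z) (imV W))
  + ii *: (cmx (lie_bracket (reV Z) (imV W)) +
           cmx (lie_bracket (imV Z) (reV W))).

Definition complex_structure (J : 'M[R]_N) : Prop :=
  J *m J = - 1%:M /\
  forall u v, lie_bracket (u *m J) (v *m J) - lie_bracket (u *m J) v *m J
              - lie_bracket u (v *m J) *m J - lie_bracket u v = 0.

Definition ce_d (a : seq VC -> C) (s : seq VC) : C :=
  \sum_(i < size s) \sum_(j < size s | (i < j)%N)
    (-1) ^+ (i + j) * a (lie_bracketC s`_i s`_j :: omit i (omit j s)).

(* Forms on G assign to each point a form on the tangent space at this point;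
   forms on Gamma\G are the Gamma-invariant forms on G. *)
Local Notation cochain_field := (G -> seq VC -> C).

(* [w] in the coordinates of the chart [A x]: at [param (A x) y] it takes tangent
   vectors in the chart chosen at that point, whence the transition matrix. *)
Definition local_form (w : cochain_field) (x : G) (s : seq VC) (y : VR) : C :=
  w (param (A x) y)
    [seq Z *m cmx (jacobian (coord (A (param (A x) y)) \o param (A x)) y)
    | Z <- s].

Definition smooth_form (w : cochain_field) : Prop :=
  forall x s,
    smooth_on (chart_image (A x)) (@complex.Re R \o local_form w x s) /\
    smooth_on (chart_image (A x)) (@complex.Im R \o local_form w x s).

Definition pullback (f : G -> G) (w : cochain_field) : cochain_field :=
  fun x s => w (f x) [seq Z *m cmx (tangent A A f x) | Z <- s].

Definition derive_real (f : VR -> C) (v y : VR) : C :=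
  Complex ('D_v (@complex.Re R \o f) y) ('D_v (@complex.Im R \o f) y).

Definition derive_complex (f : VR -> C) (Z : VC) (y : VR) : C :=
  derive_real f (reV Z) y + ii * derive_real f (imV Z) y.

(* The exterior derivative at [x], computed in the chart [A x]. *)
Definition ext_d (w : cochain_field) : cochain_field := fun x s =>
  \sum_(i < size s)
    (-1) ^+ i * derive_complex (local_form w x (omit i s)) s`_i
                               (coord (A x) x).

Section Complex_.
Context (Gamma : subgroup G) (J : 'M[R]_N).

(* Row vectors are moved from T_x G to T_1 G, then to T_x G by left
   translations, so that the resulting structure is left-invariant. *)
Definition J_at (x : G) : 'M[R]_N :=
  tangent A A (ltrans (x^-1)%g) x *m J *m tangent A A (ltrans x) 1%g.

Definition alg_forms (p q : int) : set (seq VC -> C) :=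
  [set a | alternating_form a /\ has_type J p q a].

Definition alg_del (p q : int) (a : seq VC -> C) : seq VC -> C :=
  type_part J (p + 1) q (ce_d a).
Definition alg_dbar (p q : int) (a : seq VC -> C) : seq VC -> C :=
  type_part J p (q + 1) (ce_d a).

Definition forms (p q : int) : set cochain_field :=
  [set w | [/\ smooth_form w,
     (forall g, subgroup_set Gamma g -> pullback (ltrans g) w = w)
   & (forall x, alternating_form (w x) /\ has_type (J_at x) p q (w x))]].

Definition del (p q : int) (w : cochain_field) : cochain_field :=
  fun x => type_part (J_at x) (p + 1) q (ext_d w x).
Definition dbar (p q : int) (w : cochain_field) : cochain_field :=
  fun x => type_part (J_at x) p (q + 1) (ext_d w x).

Definition invariant_form (a : seq VC -> C) : cochain_field :=
  fun x s => a [seq Z *m cmx (tangent A A (ltrans (x^-1)%g) x) | Z <- s].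

Definition alg_cocycles (p q : int) : set (seq VC -> C) :=
  [set a | alg_forms p q a /\ alg_dbar p q a = 0].
Definition alg_coboundaries (p q : int) : set (seq VC -> C) :=
  alg_dbar p (q - 1) @` alg_forms p (q - 1).
Definition alg_dolbeault (p q : int) : set (set (seq VC -> C)) :=
  cohomology (alg_cocycles p q) (alg_coboundaries p q).

Definition cocycles (p q : int) : set cochain_field :=
  [set w | forms p q w /\ dbar p q w = 0].
Definition coboundaries (p q : int) : set cochain_field :=
  dbar p (q - 1) @` forms p (q - 1).
Definition dolbeault (p q : int) : set (set cochain_field) :=
  cohomology (cocycles p q) (coboundaries p q).

(* Bijectivity suffices: the induced map is always linear. *)
Definition inclusion_induces_iso (p q : int) : Prop :=
  set_bij (alg_dolbeault p q) (dolbeault p q)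
    (induced (cocycles p q) (coboundaries p q) invariant_form).

Definition alg_weak_ddbar (n : int) : Prop :=
  forall a, alg_forms (n - 1) (n - 1) a -> real_form a ->
  (exists2 e, alg_forms (n - 2) n e &
     alg_dbar (n - 1) (n - 1) a = alg_del (n - 2) n e) ->
  exists2 b, alg_forms (n - 2) (n - 1) b &
    forall s, alg_dbar (n - 1) (n - 1) a s =
              ii * alg_del (n - 2) n (alg_dbar (n - 2) (n - 1) b) s.

Definition weak_ddbar (n : int) : Prop :=
  forall w, forms (n - 1) (n - 1) w -> (forall x, real_form (w x)) ->
  (exists2 e, forms (n - 2) n e &
     dbar (n - 1) (n - 1) w = del (n - 2) n e) ->
  exists2 b, forms (n - 2) (n - 1) b &
    forall x s, dbar (n - 1) (n - 1) w x s =
                ii * del (n - 2) n (dbar (n - 2) (n - 1) b) x s.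

End Complex_.
End Nilmanifold.

(* Main.v *)
Require Import Defs.
From HB Require Import structures.
From mathcomp Require Import all_boot all_order all_algebra.
From mathcomp Require Import generic_quotient complex.
From mathcomp Require Import all_classical all_reals all_analysis.
From mathcomp Require Import ring lra zify.
(* Imported again, so that [coord] denotes the coordinate map of a chart. *)
Import Defs.

(** Let phi be a real form of type (n - 1, n - 1) on the nilmanifold with
    dbar phi = del eta. For reasons of degree eta is dbar-closed ([dbar_top]), so by
    the isomorphism in cohomology eta = a + dbar psi with a invariant. It remains to
    write del a as del dbar of something. To that end all forms are averaged over
    the nilmanifold, which gives dbar (A phi) = del (A eta) = del a + del dbar (A psi)
    between invariant forms, where A phi is real: the weak lemma on the Lie algebra
    applies to A phi and provides b with del a = i del dbar b - del dbar (A psi).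
    Then dbar phi = del a + del dbar psi has the required form.

    The work is in the averaging operator A and in its commutation with del and
    dbar. In the frame of left-invariant vector fields, the formula of Cartan
    ([ext_d_frame]) writes the coefficients of the exterior derivative of a form as
    derivatives of its coefficients along left-invariant fields, plus the
    Chevalley-Eilenberg differential applied to the coefficients. Its proof uses that
    brackets of left-invariant fields can be computed in any chart
    ([bracket_frame]), which rests on the symmetry of second derivatives
    ([schwarz]). Averaging the coefficients by a linear functional I with I(1) = 1
    therefore commutes with the differentials as soon as I vanishes on derivatives
    along left-invariant fields, and it preserves types since the complex structure
    is constant in the frame.

    Such an I is given by a mean on the bounded functions on the discrete group G that
    is invariant under right translations ([nilpotent_invariant_mean]); no measure is
    involved. It exists because nilpotent groups are amenable: by induction along
    the lower central series one finds finite averages that are almost invariant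
    under any finitely many translations ([almost_invariant_step]), and one passes to
    the limit along an ultrafilter. The mean of a derivative vanishes
    ([mean_lie_derive]) because, by compactness of the quotient, the derivative is
    a uniform limit of difference quotients t^-1 (f (x s) - f x)
    ([uniform_difference_quotient]), each of which has mean zero. *)

Set Implicit Arguments.
Unset Strict Implicit.
Unset Printing Implicit Defensive.

Import Order.TTheory GRing.Theory Num.Theory numFieldNormedType.Exports.

Local Open Scope classical_set_scope.
Local Open Scope ring_scope.

(** * Amenability of nilpotent groups *)

Section LowerCentral.
Context (G : groupType).
Implicit Types (x y : G) (S : set G).

Lemma sub_generated S : S `<=` generated S.
Proof. by move=> x Sx H [_]; apply. Qed.

Lemma generated_min S (H : set G) :
  is_subgroup H -> S `<=` H -> generated S `<=` H.
Proof. by move=> gH SH x; apply. Qed.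

Lemma generated_subgroup S : is_subgroup (generated S).
Proof.
split=> [H [[]]//|x y Sx Sy H HS|x Sx H HS].
  by case: (HS) => -[_ HM _] _; apply: HM; [exact: Sx|exact: Sy].
by case: (HS) => -[_ _ HV] _; apply: HV; exact: Sx.
Qed.

Lemma lower_central_subgroup k : is_subgroup (@lower_central G k).
Proof. by case: k => [|k] //=; exact: generated_subgroup. Qed.

Lemma lower_central_comm k x y :
  lower_central k x -> lower_central k.+1 [~ x, y]%g.
Proof. by move=> Lx; apply: sub_generated; exists x, y. Qed.

Lemma lower_centralS k : @lower_central G k.+1 `<=` lower_central k.
Proof.
elim: k => [|k IH] //.
apply: generated_min; first exact: generated_subgroup.
by move=> _ [x [y [Lx ->]]]; apply: lower_central_comm; exact: IH.
Qed.

End LowerCentral.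

Lemma sumr_const_seq (V : nmodType) (I : Type) (r : seq I) (c : V) :
  \sum_(i <- r) c = c *+ size r.
Proof. by rewrite big_const_seq count_predT iter_addr_0. Qed.

Section Averages.
Context {R : realType} (G : groupType).
Implicit Types (x s g : G) (l S T : seq G) (F : G -> R) (e : R).

Definition average l F : R := (size l)%:R^-1 * \sum_(g <- l) F g.

Lemma averageD l F F' :
  average l (fun x => F x + F' x) = average l F + average l F'.
Proof. by rewrite /average big_split mulrDr. Qed.

Lemma averageZ l c F : average l (fun x => c * F x) = c * average l F.
Proof. by rewrite /average -mulr_sumr mulrCA. Qed.

Lemma average_norm l F e : 0 <= e ->
  (forall g, `|F g| <= e) -> `|average l F| <= e.
Proof.
move=> e0 Fe; rewrite /average normrM normfV normr_nat.
have [->|l0] := eqVneq (size l) 0%N; first by rewrite invr0 mul0r.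
rewrite ler_pdivrMl ?ltr0n ?lt0n//.
apply: le_trans (ler_norm_sum _ _ _) _.
apply: le_trans (ler_sum _ (fun g _ => Fe g)) _.
by rewrite sumr_const_seq mulr_natl.
Qed.

Lemma average_cst l c : l != [::] -> average l (fun=> c) = c.
Proof.
move=> l0; rewrite /average sumr_const_seq -[c *+ _]mulr_natl mulKf//.
by rewrite pnatr_eq0 size_eq0.
Qed.

Lemma average_allpairs l S F :
  average [seq g * h | g <- l, h <- S]%g F =
  average l (fun g => average S (fun h => F (g * h)%g)).
Proof.
rewrite /average size_allpairs big_allpairs_dep/= natrM invfM -mulrA.
by rewrite -mulr_sumr.
Qed.

(** The condition of Reiter for amenability, with finitely supported means given
    by lists; the bound is uniform over all functions bounded by 1, which is what
    allows one list to be chosen before the functions are known. *)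
Definition almost_invariant l S e : Prop :=
  forall F, (forall x, `|F x| <= 1) -> {in S, forall s,
    `|average l (fun x => F (x * s)%g) - average l F| <= e}.

(** Averaging over the powers of [s] makes a mean almost invariant under [s];
    for the other translations it only costs commutators, which lie one step
    further in the lower central series. *)
Lemma almost_invariant_step k S :
  (forall T e, {in T, forall t, lower_central k.+1 t} -> 0 < e ->
     exists2 l, l != [::] & almost_invariant l T e) ->
  forall T e, {in S, forall s, lower_central k s} ->
    {in T, forall t, lower_central k.+1 t} -> 0 < e ->
    exists2 l, l != [::] & almost_invariant l (S ++ T) e.
Proof.
move=> H0; elim: S => [|s S IH] T e LS LT e0; first exact: H0.
have [LkI LkM LkV] := lower_central_subgroup G k.
have [n ne] : exists n, 2 * n.+1%:R^-1 <= e.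
  exists (Num.truncn (2 / e)); rewrite ler_pdivrMr// mulrC -ler_pdivrMr//.
  by apply: ltW; exact: truncnS_gt.
pose P := [seq (s ^+ i)%g | i <- iota 0 n.+1].
(* Moving [t] across a power [p] of [s] creates the commutator [~ t, p^-1]; the
   inductive list is asked to absorb all of these finitely many elements. *)
pose T' := T ++ [seq [~ t, p^-1]%g | t <- S ++ T, p <- P].
have LST t : t \in S ++ T -> lower_central k t.
  rewrite mem_cat => /orP[tS|tT]; first by apply: LS; rewrite inE tS orbT.
  by apply: lower_centralS; exact: LT.
have LT' : {in T', forall t, lower_central k.+1 t}.
  move=> t; rewrite mem_cat => /orP[/LT//|/allpairsP[[u p]/= [uST pP ->]]].
  by apply: lower_central_comm; exact: LST.
have [||l l0 lI] := IH T' (e / 2) _ LT'.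
  by move=> u uS; apply: LS; rewrite inE uS orbT.
  by rewrite divr_gt0.
exists [seq g * h | g <- l, h <- P]%g.
  by rewrite -size_eq0 size_allpairs muln_eq0 size_eq0 (negbTE l0) size_map
    size_iota.
move=> F F1 t; rewrite cat_cons inE => tsST; rewrite !average_allpairs.
have [->|ts] := eqVneq t s.
  (* For [s] itself the average over powers telescopes. *)
  set d := _ - _.
  have -> : d = average l (fun g => n.+1%:R^-1 * (F (g * s ^+ n.+1)%g - F g)).
    rewrite /d -[X in _ - X]mul1r -mulNr -averageZ -averageD.
    congr average; apply/funext => g.
    rewrite /average size_map size_iota mulN1r -mulrBr; congr (_ * _).
    rewrite !big_map -sumrB -[iota 0 n.+1]/(index_iota 0 n.+1).
    under eq_bigr do rewrite -mulgA -expgSr.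
    by rewrite telescope_sumr// expg0 mulg1.
  apply: le_trans ne; apply: average_norm => [|g].
    by rewrite mulr_ge0// invr_ge0.
  rewrite normrM ger0_norm ?invr_ge0// mulrC ler_wpM2r ?invr_ge0//.
  apply: le_trans (ler_normB _ _) _.
  by rewrite -[2](_ : 1 + 1 = _) ?lerD//; lra.
have {tsST ts} tST : t \in S ++ T by move: tsST; rewrite (negPf ts).
have P0 : P != [::] by [].
have swap (F1' F2 : G -> G -> R) : average l (fun g => average P (fun h => F1' g h)) -
    average l (fun g => average P (fun h => F2 g h)) =
    average P (fun h => average l (fun g => F1' g h) - average l (fun g => F2 g h)).
  rewrite -[X in _ - X]mul1r -mulNr -averageZ -averageD.
  under [in RHS]eq_fun do rewrite -[X in _ - X]mul1r -mulNr -averageZ -averageD.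
  rewrite /average; under eq_bigr do rewrite mulN1r -mulrBr -sumrB.
  under [in RHS]eq_bigr do rewrite mulr_sumr.
  under eq_bigr do rewrite mulr_sumr.
  rewrite exchange_big !mulr_sumr; apply: eq_bigr => p _.
  rewrite !mulr_sumr; apply: eq_bigr => g _; ring.
rewrite swap /average.
rewrite normrM normfV normr_nat ler_pdivrMl ?ltr0n//.
apply: le_trans (ler_norm_sum _ _ _) _.
rewrite mulr_natl -(sumr_const_seq P e) big_seq [leRHS]big_seq.
apply: ler_sum => p pP; rewrite -/(average _ _) -/(average _ _).
pose c := [~ t, p^-1]%g; pose F' x := F (x * p)%g.
have cT' : c \in T' by rewrite mem_cat; apply/orP; right; exact: allpairs_f.
have F'1 x : `|F' x| <= 1 by exact: F1.
have tT' : t \in S ++ T' by rewrite catA mem_cat tST.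
have := lI (fun x => F' (x * c)%g) (fun x => F'1 _) t tT'.
have := lI F' F'1 c; rewrite mem_cat cT' orbT => /(_ isT).
have -> : (fun x => F (x * p * t)%g) = (fun x => F' (x * t * c)%g).
  apply/funext => x; rewrite /F' /c commgEl; congr F.
  by rewrite conjgE invgK !mulgA !mulgVK mulgK.
rewrite -/F'; set a := average _ _; set b := average _ _; set d := average _ _.
move=> H1 H2; have -> : d - b = (d - a) + (a - b) by ring.
by apply: le_trans (ler_normD _ _) _; rewrite [e]splitr lerD.
Qed.

Lemma nilpotent_almost_invariant : nilpotent_group G ->
  forall S e, 0 < e -> exists2 l, l != [::] & almost_invariant l S e.
Proof.
move=> [k Lk].
suff H j : (j <= k)%N -> forall S e, {in S, forall s, lower_central (k - j) s} ->
    0 < e -> exists2 l, l != [::] & almost_invariant l S e.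
  by move=> S e; apply: (H k) => // s _; rewrite subnn.
elim: j => [_|j IH jk] S e LS e0.
  exists [:: 1%g] => // F F1 s /LS; rewrite subn0 Lk => ->.
  by under eq_fun do rewrite mulg1; rewrite subrr normr0 ltW.
rewrite -[S]cats0; apply: (@almost_invariant_step (k - j.+1)) => //.
by rewrite subnSK//; apply: IH; exact: ltnW.
Qed.

End Averages.

Definition bounded_fct (R : realType) (T : Type) (F : T -> R) : Prop :=
  exists M, forall x, `|F x| <= M.

Section BoundedFunctions.
Context {R : realType} (T : Type).
Implicit Types F : T -> R.

Lemma bounded_fctD F F' : bounded_fct F -> bounded_fct F' ->
  bounded_fct (fun x => F x + F' x).
Proof.
move=> [M FM] [M' FM']; exists (M + M') => x.
by apply: le_trans (ler_normD _ _) _; exact: lerD.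
Qed.

Lemma bounded_fctZ c F : bounded_fct F -> bounded_fct (fun x => c * F x).
Proof.
by move=> [M FM]; exists (`|c| * M) => x; rewrite normrM ler_wpM2l.
Qed.

Lemma bounded_fct_cst (c : R) : bounded_fct (fun _ : T => c).
Proof. by exists `|c|. Qed.

End BoundedFunctions.

Lemma ultra_bounded_cvg (R : realType) (T : Type) (U : set_system T)
    (f : T -> R) :
  UltraFilter U -> bounded_fct f -> cvg (f x @[x --> U]).
Proof.
move=> UU [M fM].
have cK : compact `[(- M)%R, M%R]%classic by exact: segment_compact.
have [|p [_ pc]] := cK (f @ U) _ _.
  by apply: (@filterE _ U) => x /=; rewrite in_itv/= -ler_norml.
apply/cvg_ex; exists p => N Np.
have [//|NU] := in_ultra_setVsetC (f @^-1` N) UU.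
have NU' : (f @ U) (~` N) by [].
by have [q [/= nNq]] := pc _ _ NU' Np.
Qed.

Section InvariantMean.
Context {R : realType} (G : groupType).
Implicit Types (F : G -> R).

Record invariant_mean := InvariantMean {
  mean :> (G -> R) -> R;
  mean_cst : forall c, mean (fun=> c) = c;
  meanD : forall F F', bounded_fct F -> bounded_fct F' ->
    mean (fun x => F x + F' x) = mean F + mean F';
  meanZ : forall c F, bounded_fct F -> mean (fun x => c * F x) = c * mean F;
  mean_norm : forall F e, 0 <= e -> (forall x, `|F x| <= e) -> `|mean F| <= e;
  mean_translate : forall F s, bounded_fct F ->
    mean (fun x => F (x * s)%g) = mean F
}.

(** The lists that are almost invariant for more and more translations and smaller
    and smaller errors generate a filter; the limit of the averages along a finer
    ultrafilter exists for every bounded function and is exactly invariant. *)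
Lemma nilpotent_invariant_mean : nilpotent_group G -> inhabited invariant_mean.
Proof.
move=> nilG.
pose B (p : seq G * R) := [set l | l != [::] /\ almost_invariant l p.1 p.2].
pose D := [set p : seq G * R | 0 < p.2].
have BF : ProperFilter (filter_from D B).
  apply: filter_from_proper => [|[S e] /= e0]; last first.
    by have [l l0 lI] := nilpotent_almost_invariant nilG S e0; exists l.
  apply: filter_from_filter; first by exists ([::], 1); exact: ltr01.
  move=> [S e] [S' e'] /= e0 e'0; exists (S ++ S', Num.min e e') => /=.
    by rewrite /D/= lt_min e0.
  move=> l [/= l0 lI]; split; split=> //= F F1 s sS.
    by apply: le_trans (lI F F1 s _) _; rewrite ?mem_cat ?sS// ge_min lexx.
  by apply: le_trans (lI F F1 s _) _; rewrite ?mem_cat ?sS ?orbT// ge_min lexx orbT.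
have [U [UU BU]] := ultraFilterLemma BF.
have avg_bdd F : bounded_fct F -> bounded_fct (fun l => average l F).
  move=> [M FM]; exists M => l; apply: average_norm => //=.
  by apply: le_trans (FM 1%g).
have avg_cvg F : bounded_fct F -> cvg (average l F @[l --> U]).
  by move=> Fb; apply: ultra_bounded_cvg; exact: avg_bdd.
have Un0 : \forall l \near U, l != [::].
  by apply: BU; exists ([::], 1) => [|l []] //; exact: ltr01.
constructor; exists (fun F => lim (average l F @[l --> U])).
- move=> c; apply/cvg_lim => //; apply: cvg_near_cst.
  by apply: filterS Un0 => l l0; rewrite average_cst.
- move=> F F' bF bF'; under eq_fun do rewrite averageD.
  by apply: limD; exact: avg_cvg.
- move=> c F bF; under eq_fun do rewrite averageZ.
  by apply/cvg_lim => //; apply: cvgM; [exact: cvg_cst|exact: avg_cvg].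
- move=> F e e0 Fe; have bF : bounded_fct F by exists e.
  have nF : `|average l F| @[l --> U] --> `|lim (average l F @[l --> U])|.
    by apply: cvg_norm; exact: avg_cvg.
  rewrite -(cvg_lim _ nF)//; apply: limr_le; first by apply/cvg_ex; eexists; exact: nF.
  by apply: nearW => l; exact: average_norm.
- move=> F s [M FM].
  have bF : bounded_fct F by exists M.
  have bFs : bounded_fct (fun x => F (x * s)%g) by exists M.
  apply/eqP; rewrite -subr_eq0 -limB; [|exact: avg_cvg..]; apply/eqP.
  apply/cvg_lim => //; apply/cvgrPdist_le => e e0.
  pose c := `|M| + 1; have c0 : 0 < c by rewrite ltr_pwDr.
  have : U (B ([:: s], e / c)) by apply: BU; exists ([:: s], e / c); rewrite /D/= ?divr_gt0.
  apply: filterS => l [_ /= lI]; rewrite sub0r normrN.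
  have sc F' : average l F' = c * average l (fun x => c^-1 * F' x).
    by rewrite -averageZ; congr average; apply/funext => x; rewrite mulVKf ?gt_eqF.
  rewrite -[X in `|X|]/(average l (fun x => F (x * s)%g) - average l F).
  rewrite sc [X in _ - X]sc -mulrBr normrM gtr0_norm//.
  rewrite -ler_pdivlMl// mulrC; apply: lI; last by rewrite inE.
  move=> x; rewrite normrM gtr0_norm ?invr_gt0// ler_pdivrMl// mulr1.
  by rewrite (le_trans (FM x))// (le_trans (ler_norm _))// lerDl.
Qed.

End InvariantMean.

(** * Calculus of smooth functions *)

Section DifferentialLocality.
Context {R : realType} {V W : normedModType R}.
Implicit Types (f g : V -> W) (y v : V).

Let near_eq_diff_expansion f g y : (\near y, f y = g y) -> differentiable f y ->
  g \o shift y = cst (g y) + 'd f y +o_ 0 id.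
Proof.
move=> fg df; apply/eqaddoP => e e0.
have /eqaddoP/(_ e e0) H := diff_locally df.
have fg0 : \forall h \near 0, f (h + y) = g (h + y).
  by move: fg; rewrite (near_shift 0) subr0.
apply: filterS2 H fg0 => h; rewrite /= !fctE/= => + <-.
by rewrite (nbhs_singleton fg).
Qed.

Lemma near_eq_diff f g y : (\near y, f y = g y) -> differentiable f y ->
  'd g y = 'd f y :> (V -> W).
Proof.
move=> fg df; apply: diff_unique; first exact: diff_continuous.
exact: near_eq_diff_expansion.
Qed.

Lemma near_eq_differentiable f g y : (\near y, f y = g y) ->
  differentiable f y -> differentiable g y.
Proof.
move=> fg df; apply/diff_locallyP; rewrite (near_eq_diff fg df).
by split; [exact: diff_continuous|exact: near_eq_diff_expansion].
Qed.

Lemma derive_linD f y u v : differentiable f y ->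
  'D_(u + v) f y = 'D_u f y + 'D_v f y.
Proof. by move=> df; rewrite !deriveE// linearD. Qed.

Lemma derive_linZ f y c v : differentiable f y ->
  'D_(c *: v) f y = c *: 'D_v f y.
Proof. by move=> df; rewrite !deriveE// linearZ. Qed.

End DifferentialLocality.

Section SmoothFunctions.
Context {R : realType} {m : nat}.
Local Notation V := 'rV[R]_m.
Implicit Types (O : set V) (y v : V).

Lemma near_open_eq T O (f g : V -> T) y : open O -> O y ->
  (forall z, O z -> f z = g z) -> \near y, f y = g y.
Proof.
by move=> oO Oy fg; apply: filterS (open_nbhs_nbhs (conj oO Oy)) => z /fg.
Qed.

Section General.
Context {W : normedModType R}.
Implicit Types f g : V -> W.

(** Openness of [O] is what makes derivatives at points of [O] depend only on the
    values on [O]. *)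
Lemma Ck_eq k O f g : open O -> (forall y, O y -> f y = g y) ->
  Ck k O f -> Ck k O g.
Proof.
move=> oO; elim: k f g => [|k IH] f g fg /=.
  move=> cf y Oy; have := cf y Oy; rewrite /prop_for /continuous_at -fg//.
  by apply: cvg_trans; apply: (near_eq_cvg (F := nbhs y)); near=> z; rewrite fg//;
    near: z; exact: open_nbhs_nbhs.
move=> [df cf]; split=> [y Oy|v].
  by apply: near_eq_differentiable (df y Oy); exact: near_open_eq fg.
apply: IH (cf v) => y Oy.
by apply: near_eq_derive; exact: near_open_eq fg.
Unshelve. all: by end_near. Qed.

Lemma CkS k O f : Ck k.+1 O f -> Ck k O f.
Proof.
elim: k f => [|k IH] f [df cf].
  by move=> y Oy; apply: differentiable_continuous; exact: df.
by split=> // v; apply: IH; exact: cf.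
Qed.

Lemma smooth_eq O f g : open O -> (forall y, O y -> f y = g y) ->
  smooth_on O f -> smooth_on O g.
Proof. by move=> oO fg sf k; apply: Ck_eq fg (sf k). Qed.

Lemma smooth_derive O f v : smooth_on O f -> smooth_on O ('D_v f).
Proof. by move=> sf k; have [_] := sf k.+1; apply. Qed.

Lemma smooth_differentiable O f y : smooth_on O f -> O y -> differentiable f y.
Proof. by move=> sf; have [df _] := sf 1%N; apply: df. Qed.

Lemma smooth_continuous O f y : smooth_on O f -> O y -> {for y, continuous f}.
Proof. by move=> sf; exact: (sf 0). Qed.

Lemma smooth_sub O O' f : O `<=` O' -> smooth_on O' f -> smooth_on O f.
Proof.
move=> OO' sf k; have := sf k; elim: k f {sf} => [|k IH] f /=.
  by move=> cf y /OO'; exact: cf.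
by move=> [df cf]; split=> [y /OO'/df//|v]; exact: IH.
Qed.

Lemma smooth_cst O (c : W) : smooth_on O (fun=> c).
Proof.
move=> k; elim: k c => [|k IH] c /=; first by move=> y _; exact: cst_continuous.
split=> [y _|v]; first exact: differentiable_cst.
have -> : (fun y : V => 'D_v (fun=> c) y) = fun=> 0.
  by apply/funext => y; exact: derive_cst.
exact: IH.
Qed.

Lemma CkD k O f g : open O ->
  Ck k O f -> Ck k O g -> Ck k O (fun y => f y + g y).
Proof.
move=> oO; elim: k f g => [|k IH] f g /=.
  by move=> cf cg y Oy; exact: cvgD (cf y Oy) (cg y Oy).
move=> [df cf] [dg cg]; split=> [y Oy|v].
  by apply: differentiableD; [exact: df|exact: dg].
apply: Ck_eq (IH _ _ (cf v) (cg v)) => // y Oy.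
by rewrite deriveD//; apply: diff_derivable; [exact: df|exact: dg].
Qed.

Lemma smoothD O f g : open O ->
  smooth_on O f -> smooth_on O g -> smooth_on O (fun y => f y + g y).
Proof. by move=> oO sf sg k; apply: CkD. Qed.

End General.

Lemma smooth_coord O n (f : V -> 'rV[R]_n) j : open O ->
  smooth_on O f -> smooth_on O (fun y => f y 0 j).
Proof.
move=> oO sf k; have := sf k; elim: k f {sf} => [|k IH] f /=.
  move=> cf y Oy; apply: (@continuous_comp _ _ _ f (fun M : 'rV[R]_n => M 0 j)).
    exact: cf.
  exact: differentiable_continuous (differentiable_coord _ _ _).
move=> [df cf]; split=> [y Oy|v].
  apply: (@differentiable_comp _ _ _ _ f (fun M : 'rV[R]_n => M 0 j)).
    exact: df.
  exact: differentiable_coord.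
apply: Ck_eq (IH _ (cf v)) => // y Oy.
by rewrite derive_mx ?mxE//; apply: diff_derivable; exact: df.
Qed.

Implicit Types f g : V -> R.

(** At each order the product rule needs [f] and [g] themselves one order lower,
    which is why [CkS] enters the induction. *)
Lemma CkM k O f g : open O ->
  Ck k O f -> Ck k O g -> Ck k O (fun y => f y * g y).
Proof.
move=> oO; elim: k f g => [|k IH] f g.
  by move=> cf cg y Oy; exact: cvgM (cf y Oy) (cg y Oy).
move=> Hf Hg; have [[df cf] [dg cg]] := (Hf, Hg); split=> [y Oy|v].
  by apply: differentiableM; [exact: df|exact: dg].
suff H : Ck k O (fun y => f y * 'D_v g y + 'D_v f y * g y).
  apply: Ck_eq H => // y Oy; rewrite (@deriveM _ _ f g).
  - by rewrite [_ * g y]mulrC.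
  - by apply: diff_derivable; exact: df.
  - by apply: diff_derivable; exact: dg.
by apply: CkD => //; apply: IH; try exact: CkS; [exact: cg|exact: cf].
Qed.

Lemma smoothM O f g : open O ->
  smooth_on O f -> smooth_on O g -> smooth_on O (fun y => f y * g y).
Proof. by move=> oO sf sg k; apply: CkM. Qed.

Lemma smoothV O f : open O -> (forall y, O y -> f y != 0) ->
  smooth_on O f -> smooth_on O (fun y => (f y)^-1).
Proof.
move=> oO f0 sf k; have := sf k; elim: k {sf} => [|k IH] /=.
  by move=> cf y Oy; exact: cvgV (f0 y Oy) (cf y Oy).
move=> Hf; have [df cf] := Hf; split=> [y Oy|v].
  by apply: differentiableV; [exact: df|exact: f0].
have Hk : Ck k O (fun y => (f y)^-1) by apply: IH; exact: CkS.
suff H : Ck k O (fun y => -1 * ((f y)^-1 * ((f y)^-1 * 'D_v f y))).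
  apply: Ck_eq H => // y Oy; rewrite (@deriveV _ _ f).
  - by rewrite -[RHS]/(- (f y) ^- 2 * 'D_v f y) expr2 invfM; ring.
  - exact: f0.
  - by apply: diff_derivable; exact: df.
apply: CkM => //; first exact: smooth_cst.
by apply: CkM => //; apply: CkM => //; exact: cf.
Qed.

Lemma smooth_sum O I (r : seq I) (P : pred I) (F : I -> V -> R) : open O ->
  (forall i, smooth_on O (F i)) -> smooth_on O (fun y => \sum_(i <- r | P i) F i y).
Proof.
move=> oO sF; elim: r => [|i r IH].
  by under eq_fun do rewrite big_nil; exact: smooth_cst.
under eq_fun do rewrite big_cons; case: (P i) => //.
exact: smoothD.
Qed.

Lemma smooth_prod O I (r : seq I) (P : pred I) (F : I -> V -> R) : open O ->
  (forall i, smooth_on O (F i)) -> smooth_on O (fun y => \prod_(i <- r | P i) F i y).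
Proof.
move=> oO sF; elim: r => [|i r IH].
  by under eq_fun do rewrite big_nil; exact: smooth_cst.
under eq_fun do rewrite big_cons; case: (P i) => //.
exact: smoothM.
Qed.

Lemma smooth_det O n (M : V -> 'M[R]_n) : open O ->
  (forall i j, smooth_on O (fun y => M y i j)) -> smooth_on O (fun y => \det (M y)).
Proof.
move=> oO sM; rewrite /determinant; apply: smooth_sum => // s.
apply: smoothM => //; first exact: smooth_cst.
exact: smooth_prod.
Qed.

(** Smoothness of the inverse comes from the formula of Cramer. *)
Lemma smooth_invmx O n (M : V -> 'M[R]_n) : open O ->
  (forall y, O y -> M y \in unitmx) ->
  (forall i j, smooth_on O (fun y => M y i j)) ->
  forall i j, smooth_on O (fun y => invmx (M y) i j).
Proof.
move=> oO uM sM i j.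
have s : smooth_on O (fun y => (\det (M y))^-1 * cofactor (M y) j i).
  apply: smoothM => //.
    apply: smoothV => //; last exact: smooth_det.
    by move=> y /uM; rewrite unitmxE unitfE.
  apply: smoothM => //; first exact: smooth_cst.
  apply: smooth_det => // a b; under eq_fun do rewrite !mxE; exact: sM.
apply: smooth_eq s => // y Oy.
by rewrite /invmx uM// !mxE.
Qed.

End SmoothFunctions.

(** * Left translations in charts *)

Section Jacobian.
Context {R : realType}.

Lemma mulmx_row_inj m n (M M' : 'M[R]_(m, n)) :
  (forall v : 'rV[R]_m, v *m M = v *m M') -> M = M'.
Proof. by move=> MM'; apply/row_matrixP => i; rewrite !rowE. Qed.

Lemma derive_comp m n (W : normedModType R) (f : 'rV[R]_m -> 'rV[R]_n)
    (g : 'rV[R]_n -> W) y v :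
  differentiable f y -> differentiable g (f y) ->
  'D_v (g \o f) y = 'D_('D_v f y) g (f y).
Proof.
move=> df dg; rewrite !deriveE//; last exact: differentiable_comp.
by rewrite diff_comp.
Qed.

Lemma near_eq_jacobian m n (f g : 'rV[R]_m -> 'rV[R]_n) y :
  (\near y, f y = g y) -> differentiable f y -> jacobian g y = jacobian f y.
Proof.
move=> fg df; apply: mulmx_row_inj => v.
have dg := near_eq_differentiable fg df.
have E : 'D_v g y = 'D_v f y by exact/esym/near_eq_derive.
exact: etrans (esym (deriveEjacobian v dg)) (etrans E (deriveEjacobian v df)).
Qed.

Lemma jacobian_comp m n k (f : 'rV[R]_m -> 'rV[R]_n) (g : 'rV[R]_n -> 'rV[R]_k) y :
  differentiable f y -> differentiable g (f y) ->
  jacobian (g \o f) y = jacobian f y *m jacobian g (f y).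
Proof.
move=> df dg; apply: mulmx_row_inj => v.
have dgf := differentiable_comp df dg.
apply: etrans (esym (deriveEjacobian v dgf)) _; rewrite derive_comp// mulmxA.
apply: etrans (deriveEjacobian _ dg) _; congr (_ *m _).
exact: deriveEjacobian.
Qed.

Lemma jacobian_id n (y : 'rV[R]_n) : jacobian id y = 1%:M.
Proof.
apply: mulmx_row_inj => v.
have di : differentiable (@id 'rV[R]_n) y by exact: ex_diff.
by rewrite mulmx1 -(deriveEjacobian v di) derive_id.
Qed.

Lemma continuous_row_mx m n (c : 'rV[R]_m) :
  continuous (fun y : 'rV[R]_n => row_mx c y).
Proof.
move=> u B /nbhs_ballP[e /= e0 eB].
apply/nbhs_ballP; exists e => //= v [_ uv]; apply: eB; split => // i j.
case: (split_ordP j) => k ->.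
  by rewrite !row_mxEl; exact: ballxx.
by rewrite !row_mxEr; exact: uv.
Qed.

Lemma differentiable_row_mx m n (c : 'rV[R]_m) (y : 'rV[R]_n) :
  differentiable (row_mx c) y.
Proof.
pose f (z : 'rV[R]_n) : 'rV[R]_(m + n) := row_mx 0 z.
have fl : linear f by move=> k u v; rewrite /f scale_row_mx add_row_mx scaler0 addr0.
pose fL := GRing.isLinear.Build _ _ _ _ _ fl.
pose F : {linear 'rV[R]_n -> 'rV[R]_(m + n)} := HB.pack f fL.
have -> : row_mx c = (cst (row_mx c 0) + F) :> ('rV[R]_n -> _).
  by apply/funext => z; rewrite !fctE /= /f add_row_mx addr0 add0r.
apply: differentiableD; first exact: differentiable_cst.
by apply: linear_differentiable; exact: continuous_row_mx.
Qed.

Lemma continuous_row_mxl m n (c : 'rV[R]_n) :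
  continuous (fun y : 'rV[R]_m => row_mx y c).
Proof.
move=> u B /nbhs_ballP[e /= e0 eB].
apply/nbhs_ballP; exists e => //= v [_ uv]; apply: eB; split => // i j.
case: (split_ordP j) => k ->.
  by rewrite !row_mxEl; exact: uv.
by rewrite !row_mxEr; exact: ballxx.
Qed.

Lemma differentiable_row_mxl m n (c : 'rV[R]_n) (y : 'rV[R]_m) :
  differentiable (row_mx^~ c) y.
Proof.
pose f (z : 'rV[R]_m) : 'rV[R]_(m + n) := row_mx z 0.
have fl : linear f by move=> k u v; rewrite /f scale_row_mx add_row_mx scaler0 addr0.
pose fL := GRing.isLinear.Build _ _ _ _ _ fl.
pose F : {linear 'rV[R]_m -> 'rV[R]_(m + n)} := HB.pack f fL.
have -> : row_mx^~ c = (cst (row_mx 0 c) + F) :> ('rV[R]_m -> _).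
  by apply/funext => z; rewrite !fctE /= /f add_row_mx addr0 add0r.
apply: differentiableD; first exact: differentiable_cst.
by apply: linear_differentiable; exact: continuous_row_mxl.
Qed.

(** Partial derivatives are obtained from this with [P] the inclusion of a slice
    and [L] its linear part. *)
Lemma derive_comp_affine m n (W : normedModType R) (f : 'rV[R]_n -> W)
    (P L : 'rV[R]_m -> 'rV[R]_n) y v :
  (forall h v y, P (h *: v + y) = h *: L v + P y) ->
  'D_v (f \o P) y = 'D_(L v) f (P y).
Proof.
move=> PL; rewrite /derive; set f1 := fun h : R => _; set f2 := fun h : R => _.
suff -> : f1 = f2 by [].
by apply/funext => h; rewrite /f1 /f2 /= /shift/= PL.
Qed.

Lemma smooth_comp_affine m n (W : normedModType R) (O : set 'rV[R]_n)
    (O' : set 'rV[R]_m) (f : 'rV[R]_n -> W) (P L : 'rV[R]_m -> 'rV[R]_n) :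
  (forall h v y, P (h *: v + y) = h *: L v + P y) ->
  (forall y, differentiable P y) -> (forall y, O' y -> O (P y)) ->
  smooth_on O f -> smooth_on O' (f \o P).
Proof.
move=> PL dP OO' sf k; have := sf k; elim: k f {sf} => [|k IH] f.
  move=> cf y Oy; apply: continuous_comp; first exact: differentiable_continuous.
  by apply: cf; exact: OO'.
move=> [df cf]; split=> [y Oy|v].
  by apply: differentiable_comp => //; apply: df; exact: OO'.
have -> : (fun y => 'D_v (f \o P) y) = 'D_(L v) f \o P.
  by apply/funext => y; exact: derive_comp_affine.
exact: (IH _ (cf (L v))).
Qed.

Lemma row_mx_affine m n (c : 'rV[R]_m) (h : R) (v y : 'rV[R]_n) :
  row_mx c (h *: v + y) = h *: row_mx 0 v + row_mx c y.
Proof. by rewrite scale_row_mx add_row_mx scaler0 add0r. Qed.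

Lemma row_mxl_affine m n (c : 'rV[R]_n) (h : R) (v y : 'rV[R]_m) :
  row_mx (h *: v + y) c = h *: row_mx v 0 + row_mx y c.
Proof. by rewrite scale_row_mx add_row_mx scaler0 add0r. Qed.

End Jacobian.

Section LieGroupCharts.
Context {R : realType} {N : nat} (G : lieGroup R N).
Local Notation A := (lie_atlas G).
Local Notation V := 'rV[R]_N.
Local Notation b0 := (base_point G).
Implicit Types (g h a b c x : G) (y z v : V).

Let mfd := lie_manifold G.
Let chartA a := manifold_chart mfd a.

Lemma chart_image_open a : open (chart_image (A a)).
Proof. exact: open_image (chartA a). Qed.

Lemma param_dom a y : chart_image (A a) y -> dom (A a) (param (A a) y).
Proof. by move=> [x dx <-]; rewrite (coordK (chartA a)). Qed.

Lemma paramK a y : chart_image (A a) y -> coord (A a) (param (A a) y) = y.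
Proof. by move=> [x dx <-]; rewrite (coordK (chartA a)). Qed.

Lemma coord_image a x : dom (A a) x -> chart_image (A a) (coord (A a) x).
Proof. by move=> dx; exists x. Qed.

Lemma chart_coordK a x : dom (A a) x -> param (A a) (coord (A a) x) = x.
Proof. by move=> dx; rewrite (coordK (chartA a)). Qed.

Lemma dom_self x : dom (A x) x. Proof. exact: manifold_cover mfd x. Qed.

Lemma image_self x : chart_image (A x) (coord (A x) x).
Proof. exact/coord_image/dom_self. Qed.

Lemma base_image : chart_image (A 1%g) b0. Proof. exact: image_self. Qed.

Lemma param_base : param (A 1%g) b0 = 1%g.
Proof. exact/chart_coordK/dom_self. Qed.

Lemma near_image a y : chart_image (A a) y -> \near y, chart_image (A a) y.
Proof. by move=> iy; apply: open_nbhs_nbhs; split=> //; exact: chart_image_open. Qed.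

Definition chart_mul a b c (w : 'rV[R]_(N + N)) : V :=
  coord (A c) (param (A a) (lsubmx w) * param (A b) (rsubmx w))%g.

Definition chart_mul_dom a b c : set 'rV[R]_(N + N) :=
  [set w | [/\ chart_image (A a) (lsubmx w), chart_image (A b) (rsubmx w) &
     dom (A c) (param (A a) (lsubmx w) * param (A b) (rsubmx w))%g]].

Lemma chart_mul_dom_open a b c : open (chart_mul_dom a b c).
Proof.
rewrite openE => w [wa wb wc]; rewrite /interior.
have H1 : \forall w' \near w, chart_image (A a) (lsubmx w').
  by apply: continuous_lsubmx; exact: near_image.
have H2 : \forall w' \near w, chart_image (A b) (rsubmx w').
  by apply: continuous_rsubmx; exact: near_image.
have H3 : \forall w' \near w, dom (A c) (param (A a) (lsubmx w') * param (A b) (rsubmx w'))%g.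
  have [cM _] := lie_mul_smooth G.
  pose f (w' : 'rV[R]_(N + N)) : G * G := (param (A a) (lsubmx w'), param (A b) (rsubmx w')).
  have cf : {for w, continuous ((fun z : G * G => z.1 * z.2)%g \o f)}.
    have ca : {for w, continuous (param (A a) \o lsubmx)}.
      apply: continuous_comp; first exact: continuous_lsubmx.
      exact: param_continuous (chartA a) _ wa.
    have cb : {for w, continuous (param (A b) \o rsubmx)}.
      apply: continuous_comp; first exact: continuous_rsubmx.
      exact: param_continuous (chartA b) _ wb.
    apply: continuous_comp; last exact: cM.
    exact: (cvg_pair ca cb).
  apply: cf; apply: open_nbhs_nbhs; split=> //; exact: open_dom (chartA c).
by apply: filterS3 H1 H2 H3.
Qed.

Lemma chart_mul_smooth a b c : smooth_on (chart_mul_dom a b c) (chart_mul a b c).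
Proof.
have [_ /(_ (a, b) c)] := lie_mul_smooth G.
apply: smooth_sub => w [wa wb wc].
exists (param (A a) (lsubmx w), param (A b) (rsubmx w)) => /=.
  by do 2?split=> //=; exact: param_dom.
by rewrite !paramK// hsubmxK.
Qed.

Lemma ltrans_continuous g : continuous (ltrans (G := G) g).
Proof.
move=> x; have [cM _] := lie_mul_smooth G.
pose f (z : G) : G * G := (g, z).
have cf : {for x, continuous ((fun z : G * G => z.1 * z.2)%g \o f)}.
  apply: continuous_comp; last exact: cM.
  exact: (cvg_pair (cvg_cst g) cvg_id).
exact: cf.
Qed.

(** All the tangent maps of the theory are jacobians of these functions: left
    translations read in two charts, and, for [g = 1], changes of charts. *)
Definition chart_ltrans g a c : V -> V :=
  coord (A c) \o ltrans (G := G) g \o param (A a).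

Lemma derive_chart_mul_r a b c y z v :
  'D_(row_mx 0 v) (chart_mul a b c) (row_mx y z) =
  'D_v (chart_ltrans (param (A a) y) b c) z.
Proof.
have -> : chart_ltrans (param (A a) y) b c = chart_mul a b c \o row_mx y.
  by apply/funext => w; rewrite /chart_mul /= row_mxKl row_mxKr.
by apply/esym/derive_comp_affine; exact: row_mx_affine.
Qed.

Definition chart_ltrans_dom g a c : set V :=
  [set y | chart_image (A a) y /\ dom (A c) (g * param (A a) y)%g].

Lemma chart_ltrans_dom_open g a c : open (chart_ltrans_dom g a c).
Proof.
rewrite openE => y [ay cy].
have cl : {for y, continuous (ltrans (G := G) g \o param (A a))}.
  apply: continuous_comp; first exact: param_continuous (chartA a) _ ay.
  exact: ltrans_continuous.
have : \near y, dom (A c) (g * param (A a) y)%g.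
  by apply: cl; apply: open_nbhs_nbhs; split=> //; exact: open_dom (chartA c).
by move=> cy'; exact: filterI (near_image ay) cy'.
Qed.

Lemma chart_ltrans_smooth g a c :
  smooth_on (chart_ltrans_dom g a c) (chart_ltrans g a c).
Proof.
have gg : param (A g) (coord (A g) g) = g by rewrite chart_coordK//; exact: dom_self.
have -> : chart_ltrans g a c = chart_mul g a c \o row_mx (coord (A g) g).
  by apply/funext => z /=; rewrite /chart_mul row_mxKl row_mxKr gg.
apply: (smooth_comp_affine (row_mx_affine _) _ _ (@chart_mul_smooth g a c)) => y.
  exact: differentiable_row_mx.
by move=> [ay cy]; split; rewrite ?row_mxKl ?row_mxKr ?gg//; exact: image_self.
Qed.

Lemma chart_ltrans_differentiable g a c y : chart_image (A a) y ->
  dom (A c) (g * param (A a) y)%g -> differentiable (chart_ltrans g a c) y.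
Proof. by move=> ay cy; apply: smooth_differentiable (@chart_ltrans_smooth g a c) _. Qed.

Definition jac_ltrans g a c y : 'M[R]_N := jacobian (chart_ltrans g a c) y.

(** The chain rule, as a cocycle identity. It yields in particular the change of
    charts of the left-invariant frame and the inverses of all these matrices. *)
Lemma jac_ltransM h g a b c y : chart_image (A a) y ->
  dom (A b) (g * param (A a) y)%g -> dom (A c) (h * (g * param (A a) y))%g ->
  jac_ltrans (h * g)%g a c y =
  jac_ltrans g a b y *m jac_ltrans h b c (coord (A b) (g * param (A a) y)%g).
Proof.
move=> ay by_ cy.
have dg := chart_ltrans_differentiable ay by_.
have dh : differentiable (chart_ltrans h b c) (chart_ltrans g a b y).
  apply: chart_ltrans_differentiable; first exact: coord_image.
  by rewrite chart_coordK.
rewrite /jac_ltrans -(jacobian_comp dg dh).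
apply: near_eq_jacobian; last exact: differentiable_comp.
have : \near y, chart_ltrans_dom g a b y.
  by apply: open_nbhs_nbhs; split=> //; exact: chart_ltrans_dom_open.
apply: filterS => z [_ bz]; rewrite /chart_ltrans /ltrans /= chart_coordK//.
by rewrite mulgA.
Qed.

Lemma jac_ltrans1 a y : chart_image (A a) y -> jac_ltrans 1%g a a y = 1%:M.
Proof.
move=> ay; rewrite -(jacobian_id y); apply: near_eq_jacobian.
  apply: filterS (near_image ay) => z az.
  by rewrite /chart_ltrans /ltrans /= mul1g paramK.
exact: ex_diff.
Qed.

Lemma jac_ltransV g a c y : chart_image (A a) y ->
  dom (A c) (g * param (A a) y)%g ->
  jac_ltrans g a c y *m jac_ltrans (g^-1)%g c a (coord (A c) (g * param (A a) y)%g) = 1%:M.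
Proof.
move=> ay cy.
pose g' : G := (g^-1)%g.
have dy : dom (A a) (g' * (g * param (A a) y))%g.
  by rewrite mulKg; exact: param_dom.
have E : jac_ltrans (g' * g)%g a a y = 1%:M by rewrite mulVg jac_ltrans1.
exact: etrans (esym (jac_ltransM ay cy dy)) E.
Qed.

Lemma jac_ltrans_unit g a c y : chart_image (A a) y ->
  dom (A c) (g * param (A a) y)%g -> jac_ltrans g a c y \in unitmx.
Proof.
move=> ay cy; have := jac_ltransV ay cy.
set M := jac_ltrans g a c y; set M' := jac_ltrans _ c a _.
by move: M M' => M M' /mulmx1_unit[].
Qed.

(** The frame of left-invariant vector fields in the chart at [a]: the value at
    [y] of the field extending [v] is [v *m frame a y]. *)
Definition frame a y : 'M[R]_N := jac_ltrans (param (A a) y) 1%g a b0.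

Lemma left_invariant_fieldE v y : left_invariant_field G v y = v *m frame 1%g y.
Proof. by []. Qed.

Lemma frame_derive a y v : chart_image (A a) y ->
  v *m frame a y = 'D_v (chart_ltrans (param (A a) y) 1%g a) b0.
Proof.
move=> ay; apply/esym/deriveEjacobian/chart_ltrans_differentiable.
  exact: base_image.
by rewrite param_base mulg1; exact: param_dom.
Qed.

(** The frame is a partial derivative of the multiplication, which is smooth. *)
Lemma frame_smooth a i j :
  smooth_on (chart_image (A a)) (fun y => frame a y i j).
Proof.
have oI := chart_image_open (a := a).
have s1 : smooth_on (chart_mul_dom a 1%g a)
    (fun w => 'D_(row_mx 0 (delta_mx 0 i)) (chart_mul a 1%g a) w 0 j).
  by apply: smooth_coord; [exact: chart_mul_dom_open|apply: smooth_derive; exact: chart_mul_smooth].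
have s2 : smooth_on (chart_image (A a))
    (fun y => 'D_(row_mx 0 (delta_mx 0 i)) (chart_mul a 1%g a) (row_mx y b0) 0 j).
  apply: (smooth_comp_affine (row_mxl_affine b0) _ _ s1) => y.
    exact: differentiable_row_mxl.
  move=> ay; split; rewrite ?row_mxKl ?row_mxKr//.
    exact: base_image.
  by rewrite param_base mulg1; exact: param_dom.
apply: smooth_eq s2 => // y ay.
by rewrite derive_chart_mul_r -frame_derive// -rowE mxE.
Qed.

Lemma frame_unit a y : chart_image (A a) y -> frame a y \in unitmx.
Proof.
move=> ay; apply: jac_ltrans_unit; first exact: base_image.
by rewrite param_base mulg1; exact: param_dom.
Qed.

End LieGroupCharts.

(** * Symmetry of second derivatives *)

Section Schwarz.
Context {R : realType} {m : nat}.
Local Notation V := 'rV[R]_m.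
Implicit Types (f : V -> R) (u v y z : V) (a b h : R).

Lemma differentiable_translate (c z : V) : differentiable (+%R c) z.
Proof.
have dP : differentiable (cst c + id : V -> V) z.
  by apply: differentiableD; [exact: differentiable_cst|exact: ex_diff].
exact: dP.
Qed.

Lemma derive_translate f (c u z : V) : 'D_u (f \o +%R c) z = 'D_u f (c + z).
Proof.
by apply: (@derive_comp_affine _ _ _ _ f (+%R c) id) => k w x; rewrite addrCA.
Qed.

Lemma mvt_line f z u h : 0 < h ->
  (forall s, 0 <= s <= h -> differentiable f (s *: u + z)) ->
  exists2 c, 0 < c < h & f (h *: u + z) - f z = h * 'D_u f (c *: u + z).
Proof.
move=> h0 df.
have is_der s : 0 <= s <= h ->
    is_derive s 1 (fun s : R => f (s *: u + z)) ('D_u f (s *: u + z)).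
  move=> /df dfs.
  pose P (r : R) := r *: u + z.
  have E : (fun k : R => k^-1 *: (((f \o P) \o shift s) (k *: (1 : R)) - (f \o P) s)) =
      (fun k : R => k^-1 *: ((f \o shift (P s)) (k *: u) - f (P s))).
    by apply/funext => k; rewrite /P /= /shift/= [k *: 1]mulr1 scalerDl addrA.
  split; last by rewrite /derive E.
  by have := @diff_derivable _ _ _ f _ u dfs; rewrite /derivable -/(P s) -E.
have [||c ch E] := @MVT _ (fun s => f (s *: u + z)) (fun s => 'D_u f (s *: u + z)) 0 h h0.
- by move=> s; rewrite in_itv/= => /andP[s0 sh]; apply: is_der; rewrite !ltW.
- apply: derivable_within_continuous => s; rewrite in_itv/= => sh.
  by case: (is_der s sh).
exists c; first by move: ch; rewrite in_itv.
by move: E; rewrite scale0r add0r subr0 mulrC.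
Qed.

Definition second_difference f u v y h : R :=
  f (h *: u + (h *: v + y)) - f (h *: u + y) - f (h *: v + y) + f y.

Lemma second_differenceC f u v y h :
  second_difference f u v y h = second_difference f v u y h.
Proof. rewrite /second_difference addrCA; ring. Qed.

(** The mean value theorem is applied once in each direction. *)
Lemma second_difference_mvt (O : set V) f u v y h : smooth_on O f -> open O -> 0 < h ->
  (forall a b, 0 <= a <= h -> 0 <= b <= h -> O (a *: u + (b *: v + y))) ->
  exists a b, [/\ 0 < a < h, 0 < b < h &
    second_difference f u v y h = h * (h * 'D_v ('D_u f) (a *: u + (b *: v + y)))].
Proof.
move=> sf oO h0 HO.
have df z : O z -> differentiable f z by exact: smooth_differentiable.
have hh : 0 <= h <= h by rewrite lexx ltW.
have z0 : 0 <= (0 : R) <= h by rewrite lexx ltW.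
pose g z := f ((h *: v) + z) - f z.
have dg s : 0 <= s <= h -> differentiable g (s *: u + y) /\
    'D_u g (s *: u + y) = 'D_u f (h *: v + (s *: u + y)) - 'D_u f (s *: u + y).
  move=> sh.
  have d1 : differentiable f (s *: u + y).
    by have := HO _ _ sh z0; rewrite scale0r add0r => /df.
  have d2 : differentiable f (h *: v + (s *: u + y)).
    by have := HO _ _ sh hh; rewrite addrCA => /df.
  have d3 : differentiable (fun z => f (h *: v + z)) (s *: u + y).
    exact: differentiable_comp (differentiable_translate (h *: v) _) d2.
  split; first exact: differentiableB.
  rewrite (@deriveB _ _ _ (fun z => f (h *: v + z)) f); [|exact: diff_derivable..].
  by rewrite -(derive_translate f (h *: v)).
have [a ah E1] := mvt_line (f := g) (z := y) (u := u) h0 (fun s sh => (dg s sh).1).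
have ah' : 0 <= a <= h by case/andP: ah => *; rewrite !ltW.
have [|b bh E2] := @mvt_line ('D_u f) (a *: u + y) v h h0.
  move=> s sh; rewrite addrCA.
  by apply: smooth_differentiable (smooth_derive u sf) _; exact: HO.
exists a, b; split=> //.
have := (dg a ah').2; rewrite E2 => E3.
rewrite E3 in E1; rewrite [a *: u + _]addrCA -E1 /second_difference /g.
rewrite [h *: u + (h *: v + y)]addrCA; ring.
Qed.

(** Both mixed derivatives are, by continuity, the limit of the same symmetric
    second difference. *)
Lemma schwarz (O : set V) f u v y : open O -> O y -> smooth_on O f ->
  'D_u ('D_v f) y = 'D_v ('D_u f) y.
Proof.
move=> oO Oy sf.
apply/eqP; rewrite -subr_eq0 -normr_le0; apply/ler_addgt0Pl => e e0; rewrite addr0.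
have cont (g : V -> R) : smooth_on O g -> \forall z \near y, `|g y - g z| < e / 2.
  move=> sg; have /cvgrPdist_lt := smooth_continuous sg Oy.
  by apply; rewrite divr_gt0.
have near_ball (D1 D2 : V -> R) : smooth_on O D1 -> smooth_on O D2 ->
    exists2 r, 0 < r & forall z, ball y r z ->
      [/\ O z, `|D1 y - D1 z| < e / 2 & `|D2 y - D2 z| < e / 2].
  move=> /cont c1 /cont c2.
  have cO : \forall z \near y, O z by apply: open_nbhs_nbhs.
  have /nbhs_ballP[r /= r0 rB] : \forall z \near y,
      [/\ O z, `|D1 y - D1 z| < e / 2 & `|D2 y - D2 z| < e / 2].
    by near=> z; split; near: z.
  by exists r.
have [r r0 rB] := near_ball _ _ (smooth_derive u (smooth_derive v sf))
  (smooth_derive v (smooth_derive u sf)).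
(* Small enough for the whole parallelogram spanned by [h u] and [h v] at [y] to
   lie in the ball of radius [r]. *)
pose h := r / 2 / (`|u| + `|v| + 1).
have n0 : 0 < `|u| + `|v| + 1 by rewrite ltr_pwDr// addr_ge0.
have h0 : 0 < h by rewrite !divr_gt0.
have inb a b : 0 <= a <= h -> 0 <= b <= h -> ball y r (a *: u + (b *: v + y)).
  move=> /andP[a0 ah] /andP[b0 bh]; rewrite -ball_normE /ball_/=.
  rewrite addrA opprD addrCA subrr addr0 normrN.
  apply: le_lt_trans (ler_normD _ _) _; rewrite !normrZ !ger0_norm//.
  apply: (@le_lt_trans _ _ (h * (`|u| + `|v| + 1))).
    rewrite !mulrDr mulr1 -addrA lerD ?ler_wpM2r//.
    by apply: (@le_trans _ _ (h * `|v|)); rewrite ?ler_wpM2r// lerDl ltW.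
  by rewrite /h divfK ?gt_eqF// ltr_pdivrMr// ltr_pMr// ltr1n.
have HO a b : 0 <= a <= h -> 0 <= b <= h -> O (a *: u + (b *: v + y)).
  by move=> ah bh; have [] := rB _ (inb a b ah bh).
have HO' a b : 0 <= a <= h -> 0 <= b <= h -> O (a *: v + (b *: u + y)).
  by move=> ah bh; rewrite addrCA; exact: HO.
have [a [b [/andP[a0 ah] /andP[b0 bh] E]]] := second_difference_mvt sf oO h0 HO.
have [a' [b' [/andP[a'0 a'h] /andP[b'0 b'h] E']]] := second_difference_mvt sf oO h0 HO'.
rewrite second_differenceC E in E'.
move/(mulfI (lt0r_neq0 h0))/(mulfI (lt0r_neq0 h0)) : E' => E'.
have close (p p' q q' : R) : `|p - p'| < e / 2 -> `|q - q'| < e / 2 -> p' = q' ->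
    `|p - q| <= e.
  move=> pp qq E0; rewrite (_ : p - q = (p - p') - (q - q')); last by rewrite E0; ring.
  by apply: le_trans (ler_normB _ _) _; rewrite [leRHS]splitr; apply: lerD; exact: ltW.
have ra : 0 <= a <= h by rewrite !ltW.
have rb : 0 <= b <= h by rewrite !ltW.
have ra' : 0 <= a' <= h by rewrite !ltW.
have rb' : 0 <= b' <= h by rewrite !ltW.
have [_ _ H2] := rB _ (inb a b ra rb).
have [_ H1 _] := rB _ (inb b' a' rb' ra').
apply: close H1 H2 _; rewrite E'; congr ('D_u ('D_v f) _).
exact: addrCA.
Unshelve. all: by end_near. Qed.

End Schwarz.

(** * Brackets of left-invariant fields *)

Section DeriveCoordinates.
Context {R : realType}.

Lemma derive_coord_row m n (f : 'rV[R]_m -> 'rV[R]_n) y v j :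
  differentiable f y -> ('D_v f y) 0 j = 'D_v (fun z => f z 0 j) y.
Proof. by move=> df; rewrite derive_mx ?mxE//; exact: diff_derivable. Qed.

Lemma derive_lin_row m (f : 'rV[R]_m -> R) y v : differentiable f y ->
  'D_v f y = \sum_i v 0 i * 'D_(delta_mx 0 i) f y.
Proof.
move=> df; rewrite [in LHS](row_sum_delta v) deriveE// linear_sum.
by apply: eq_bigr => i _; rewrite linearZ /= -deriveE.
Qed.

Lemma derive_sumM m n (F H : 'I_n -> 'rV[R]_m -> R) y v :
  (forall k, differentiable (F k) y) -> (forall k, differentiable (H k) y) ->
  'D_v (fun z => \sum_k F k z * H k z) y =
  \sum_k ('D_v (F k) y * H k y + F k y * 'D_v (H k) y).
Proof.
move=> dF dH.
have -> : (fun z => \sum_k F k z * H k z) = \sum_k (F k * H k).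
  by apply/funext => z; rewrite fct_sumE.
rewrite derive_sum => [|k]; last by apply: diff_derivable; exact: differentiableM.
apply: eq_bigr => k _; rewrite deriveM; [|exact: diff_derivable..].
by rewrite addrC [H k y *: _]mulrC.
Qed.

Lemma sum_delta n (d : 'I_n -> R) i : \sum_k (i == k)%:R * d k = d i.
Proof.
rewrite (bigD1 i)//= big1 => [|k ki]; first by rewrite eqxx mul1r addr0.
by rewrite eq_sym (negPf ki) mul0r.
Qed.

End DeriveCoordinates.

Section Bracket.
Context {R : realType} {N : nat} (G : lieGroup R N).
Local Notation A := (lie_atlas G).
Local Notation V := 'rV[R]_N.
Local Notation b0 := (base_point G).
Implicit Types (g h a b c x : G) (y z v u : V).

Definition dframe a v : 'M[R]_N :=
  \matrix_(i, j) 'D_v (fun y => frame a y i j) (coord (A a) a).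

Lemma dframeE a v i j :
  dframe a v i j = 'D_v (fun y => frame a y i j) (coord (A a) a).
Proof. by rewrite mxE. Qed.

Lemma frame_differentiable a y i j : chart_image (A a) y ->
  differentiable (fun y => frame a y i j) y.
Proof. exact: smooth_differentiable (frame_smooth a i j). Qed.

Lemma frame_base : frame (1%g : G) b0 = 1%:M.
Proof. by rewrite /frame param_base jac_ltrans1//; exact: base_image. Qed.

Lemma derive_mulmx_frame a u v y : chart_image (A a) y ->
  'D_u (fun y => v *m frame a y) y =
  v *m \matrix_(i, j) 'D_u (fun y => frame a y i j) y.
Proof.
move=> ay; apply/rowP => j.
have dF i k : differentiable (fun y => frame a y i k) y by exact: frame_differentiable.
have dj k : differentiable (fun y => (v *m frame a y) 0 k) y.
  have -> : (fun y => (v *m frame a y) 0 k) = \sum_i (fun y => v 0 i * frame a y i k).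
    by apply/funext => z; rewrite mxE fct_sumE.
  by apply: differentiable_sum => i; exact: differentiableZ.
have der : derivable (fun y => v *m frame a y) y u.
  apply/derivable_mxP => i k; rewrite (ord1 i).
  exact: diff_derivable (dj k).
rewrite derive_mx// !mxE.
have -> : (fun t => (v *m frame a t) 0 j) = fun t => \sum_i v 0 i * frame a t i j.
  by apply/funext => z; rewrite mxE.
rewrite derive_sumM => [|k|k]; [|exact: differentiable_cst|exact: dF].
by apply: eq_bigr => i _; rewrite derive_cst mul0r add0r mxE.
Qed.

Lemma lie_bracketE u v :
  lie_bracket G u v = v *m dframe (1%g : G) u - u *m dframe (1%g : G) v.
Proof.
have H w w' : 'D_w (left_invariant_field G w') b0 = w' *m dframe (1%g : G) w.
  by apply: derive_mulmx_frame; exact: base_image.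
by rewrite /lie_bracket /field_bracket !left_invariant_fieldE frame_base !mulmx1 !H.
Qed.

(** Left translation by [x] carries the frame near [1] to the frame near [x]. *)
Lemma frame_translate x z : chart_image (A 1%g) z -> dom (A x) (x * param (A 1%g) z)%g ->
  frame x (chart_ltrans x 1%g x z) = frame (1%g : G) z *m jac_ltrans x 1%g x z.
Proof.
move=> z1 xz; rewrite /frame [chart_ltrans _ _ _ _]/(coord (A x) (x * param (A 1%g) z)%g).
rewrite chart_coordK//.
have d1 : dom (A 1%g) (param (A 1%g) z * param (A 1%g) b0)%g.
  by rewrite param_base mulg1; exact: param_dom.
have d2 : dom (A x) (x * (param (A 1%g) z * param (A 1%g) b0))%g.
  by rewrite param_base mulg1.
rewrite (jac_ltransM (base_image G) d1 d2).
by rewrite param_base mulg1 paramK.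
Qed.

(** Brackets of left-invariant fields may be computed in any chart, because left
    translations carry the left-invariant fields to themselves; the second
    derivatives of the translation cancel by symmetry. *)
Lemma bracket_frame x u v (F := frame x (coord (A x) x)) :
  v *m dframe x (u *m F) - u *m dframe x (v *m F) = lie_bracket G u v *m F.
Proof.
pose h := chart_ltrans x 1%g x; pose O := chart_ltrans_dom x 1%g x.
have oO : open O := @chart_ltrans_dom_open _ _ _ x 1%g x.
have sh : smooth_on O h := @chart_ltrans_smooth _ _ _ x 1%g x.
have Ob : O b0 by split; [exact: base_image|rewrite param_base mulg1; exact: dom_self].
have hb : h b0 = coord (A x) x.
  by rewrite /h /chart_ltrans /ltrans /= param_base mulg1.
have FE : F = jac_ltrans x 1%g x b0.
  by rewrite /F -hb frame_translate ?frame_base ?mul1mx//; case: Ob.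
have dh z : O z -> differentiable h z by exact: smooth_differentiable.
have shj j : smooth_on O (fun z => h z 0 j) by exact: smooth_coord.
have jacE z w : O z -> w *m jac_ltrans x 1%g x z = 'D_w h z.
  by move=> Oz; apply/esym/deriveEjacobian; exact: dh.
(* The second derivatives of the translation [h]: they are the only obstruction
   to [dframe] being transported by [h], and they are symmetric. *)
pose K w := \matrix_(i, j) 'D_w ('D_(delta_mx 0 i) (fun z => h z 0 j)) b0.
have key w : dframe x (w *m F) = dframe (1%g : G) w *m F + K w.
  apply/matrixP => i j; rewrite !mxE.
  pose f y := frame x y i j.
  have -> : 'D_(w *m F) f (coord (A x) x) = 'D_w (f \o h) b0.
    have dfb : differentiable f (h b0).
      by rewrite hb; apply: frame_differentiable; exact: image_self.
    apply/esym; apply: (etrans (derive_comp w (dh _ Ob) dfb)).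
    by rewrite hb FE jacE.
  pose D k := 'D_(delta_mx 0 k) (fun z => h z 0 j).
  have DE k z : O z -> D k z = jac_ltrans x 1%g x z k j.
    move=> Oz; apply: (etrans (esym (derive_coord_row _ j (dh _ Oz)))).
    by rewrite -(jacE _ _ Oz) -rowE mxE.
  have E : \forall z \near b0, (f \o h) z = \sum_k frame (1%g : G) z i k * D k z.
    apply: near_open_eq oO Ob _ => z Oz.
    have Ez := congr1 (fun M : 'M[R]_N => M i j) (frame_translate (proj1 Oz) (proj2 Oz)).
    apply: (etrans Ez); rewrite mxE.
    by apply: eq_bigr => k _; rewrite DE.
  apply: (etrans (near_eq_derive _ E)).
  rewrite derive_sumM.
  - rewrite big_split /=; congr (_ + _).
      by apply: eq_bigr => k _; rewrite (DE _ _ Ob) dframeE FE.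
    have FB k : frame (1%g : G) b0 i k = (i == k)%:R by rewrite frame_base mxE.
    transitivity (\sum_k (i == k)%:R * 'D_w (D k) b0).
      by apply: eq_bigr => k _; rewrite FB.
    exact: sum_delta.
  - by move=> k; apply: frame_differentiable; exact: base_image.
  - by move=> k; exact: smooth_differentiable (smooth_derive _ (shj j)) Ob.
have KE w w' : w *m K w' = \row_j 'D_w ('D_w' (fun z => h z 0 j)) b0.
  apply/rowP => j; rewrite !mxE.
  rewrite derive_lin_row; last exact: smooth_differentiable (smooth_derive _ (shj j)) Ob.
  by apply: eq_bigr => i _; rewrite mxE (schwarz _ _ oO Ob (shj j)).
have KS w w' : w *m K w' = w' *m K w.
  apply: (etrans (KE w w')); apply: (etrans _ (esym (KE w' w))).
  by apply/rowP => j; rewrite [LHS]mxE [RHS]mxE; exact: (schwarz _ _ oO Ob (shj j)).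
move: K key KS {KE} => K key KS.
have cancel (p q k : V) : (p + k) - (q + k) = p - q.
  by rewrite opprD addrACA subrr addr0.
rewrite !key !mulmxDr KS lie_bracketE mulmxBl !mulmxA.
exact: cancel.
Qed.

End Bracket.

(** * Uniformity on a cocompact quotient *)

Section Cocompact.
Context {R : realType} {N : nat} (G : lieGroup R N) (Gamma : subgroup G).
Local Notation A := (lie_atlas G).
Local Notation V := 'rV[R]_N.
Local Notation b0 := (base_point G).
Implicit Types (g a x y z : G).

Lemma ltrans_open g (U : set G) : open U -> open (ltrans (G := G) g @^-1` U).
Proof. by move=> oU; move/continuousP : (@ltrans_continuous _ _ G g); apply. Qed.

Lemma left_quotientP x y :
  (\pi_(left_quotient Gamma) x)%qT = (\pi_(left_quotient Gamma) y)%qT <->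
  exists2 g, subgroup_set Gamma g & y = (g * x)%g.
Proof.
split=> [E|gE].
  apply/asboolP; rewrite -/(orbit_rel Gamma x y).
  by rewrite -(eqmodE (orbit_equiv Gamma) x y); apply/eqP; exact: E.
have : orbit_rel Gamma x y by apply/asboolP.
by rewrite -(eqmodE (orbit_equiv Gamma) x y) => /eqP; apply.
Qed.

(** Being invariant, the property descends to the quotient, where compactness
    makes it uniform. *)
Lemma cocompact_near (I : Type) (F : set_system I) (P : I -> G -> Prop) :
  Filter F -> is_lattice Gamma ->
  (forall i g x, subgroup_set Gamma g -> P i x -> P i (g * x)%g) ->
  (forall x, \forall x' \near x & i \near F, P i x') ->
  \forall i \near F, forall x, P i x.
Proof.
move=> FF [_ /compact_near_coveringP cQ] Pinv Ploc.
pose Q i (q : left_quotient Gamma) := forall x, (\pi_(left_quotient Gamma) x)%qT = q -> P i x.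
have [_ _ GV] := subgroupP Gamma.
have := cQ I F Q FF; have H q : [set: left_quotient Gamma] q ->
    \forall q' \near q & i \near F, Q i q'.
  move=> _; pose x := repr q; have [[U B] /= [Ux FB] UB] := Ploc x.
  pose S := [set (\pi_(left_quotient Gamma) z)%qT | z in interior U].
  have oS : open S.
    rewrite /open /= /quotient_open.
    (* The projection is open: saturations are unions of translates. *)
    have -> : \pi_(left_quotient Gamma)%qT @^-1`
        S =
        \bigcup_(g in subgroup_set Gamma) (ltrans (G := G) g @^-1` interior U).
      rewrite eqEsubset; split=> [z [y Uy /esym/left_quotientP[g Gg E]]|z [g Gg Uz]].
        by exists g => //; rewrite /= /ltrans -E.
      by exists (g * z)%g => //; apply/esym/left_quotientP; exists g.
    by apply: bigcup_open => g _; apply: ltrans_open; exact: open_interior.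
  exists (S, B).
    split; last exact: FB.
    apply: (@open_nbhs_nbhs _ q S); split=> //.
    by exists x; [exact: Ux|exact: reprK].
  move=> [q' i] /= [[z Uz <-] Bi] x' /esym/left_quotientP[g Gg ->].
  apply: Pinv => //.
  by apply: (UB (z, i)); split=> //; exact: interior_subset Uz.
move=> /(_ H); apply: filterS => i Hi x.
exact: (Hi (\pi_(left_quotient Gamma) x)%qT).
Qed.
End Cocompact.

(** * Derivatives along left-invariant fields *)

Lemma continuous_sum_at (R : realType) (T : topologicalType) (I : Type) (r : seq I)
    (F : I -> T -> R) (t : T) : (forall i, {for t, continuous (F i)}) ->
  {for t, continuous (fun t => \sum_(i <- r) F i t)}.
Proof.
move=> cF; rewrite /prop_for /continuous_at; elim: r => [|i r IH].
  by rewrite big_nil; under eq_fun do rewrite big_nil; exact: cst_continuous.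
by rewrite big_cons; under eq_fun do rewrite big_cons; exact: cvgD (cF i) IH.
Qed.

Section LieDerivative.
Context {R : realType} {N : nat} (G : lieGroup R N).
Local Notation A := (lie_atlas G).
Local Notation V := 'rV[R]_N.
Local Notation b0 := (base_point G).
Implicit Types (g a x : G) (y z v : V) (f : G -> R).

Definition smooth_fct f : Prop :=
  forall a, smooth_on (chart_image (A a)) (f \o param (A a)).

(** The derivative of [f] along the left-invariant field extending [v]. Pulling
    back by the translation to the base point avoids any chart at [x], so that
    invariance of [f] is visibly inherited. *)
Definition lie_derive v f x : R := 'D_v (f \o ltrans (G := G) x \o param (A 1%g)) b0.

Section AtChart.
Variables (a : G) (f : G -> R).
Hypothesis sf : smooth_fct f.

Let D := chart_mul_dom a (1%g : G) a.
Let mu := chart_mul a (1%g : G) a.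
Let F := f \o param (A a).

Lemma near_chart_ltrans y z : D (row_mx y z) ->
  \forall z' \near z,
    (f \o ltrans (param (A a) y) \o param (A 1%g)) z' =
    (F \o chart_ltrans (param (A a) y) 1%g a) z'.
Proof.
move=> [_]; rewrite row_mxKl row_mxKr => z1 az.
have oO := @chart_ltrans_dom_open _ _ _ (param (A a) y) 1%g a.
apply: near_open_eq oO (conj z1 az) _ => w [w1 aw].
by rewrite /F /chart_ltrans /= chart_coordK.
Qed.

Let dF_ltrans y z : D (row_mx y z) -> [/\
  differentiable (chart_ltrans (param (A a) y) 1%g a) z &
  differentiable F (chart_ltrans (param (A a) y) 1%g a z)].
Proof.
move=> [_]; rewrite row_mxKl row_mxKr => z1 az.
split; first exact: chart_ltrans_differentiable.
by apply: smooth_differentiable (@sf a) _; exact: coord_image.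
Qed.

Lemma translate_differentiable y z : D (row_mx y z) ->
  differentiable (f \o ltrans (param (A a) y) \o param (A 1%g)) z.
Proof.
move=> Dyz; have [d1 d2] := dF_ltrans Dyz.
apply: near_eq_differentiable (differentiable_comp d1 d2).
by apply: filterS (near_chart_ltrans Dyz) => w /esym.
Qed.

Lemma translate_derive y z v : D (row_mx y z) ->
  'D_v (f \o ltrans (param (A a) y) \o param (A 1%g)) z =
  'D_('D_v (chart_ltrans (param (A a) y) 1%g a) z) F
     (chart_ltrans (param (A a) y) 1%g a z).
Proof.
move=> Dyz; have [d1 d2] := dF_ltrans Dyz.
apply: (etrans _ (derive_comp v d1 d2)).
exact: near_eq_derive (near_chart_ltrans Dyz).
Qed.

Lemma base_chart_mul_dom y : chart_image (A a) y -> D (row_mx y b0).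
Proof.
move=> ay; split; rewrite ?row_mxKl ?row_mxKr//; first exact: base_image.
by rewrite param_base mulg1; exact: param_dom.
Qed.

Lemma lie_derive_chart y v : chart_image (A a) y ->
  lie_derive v f (param (A a) y) = 'D_(v *m frame a y) F y.
Proof.
move=> ay; apply: (etrans (translate_derive v (base_chart_mul_dom ay))).
have -> : chart_ltrans (param (A a) y) 1%g a b0 = y.
  by rewrite /chart_ltrans /ltrans /= param_base mulg1 paramK.
by rewrite -frame_derive.
Qed.

(** The chain rule expression of the derivative of [f (param y * param z)] in [z],
    as one function of the pair [row_mx y z]. *)
Let H v w := \sum_k ('D_(row_mx 0 v) mu w) 0 k * 'D_(delta_mx 0 k) F (mu w).

Let H_translate y z v : D (row_mx y z) ->
  'D_v (f \o ltrans (param (A a) y) \o param (A 1%g)) z = H v (row_mx y z).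
Proof.
move=> Dyz; have [d1 d2] := dF_ltrans Dyz.
apply: (etrans (translate_derive v Dyz)); apply: (etrans (derive_lin_row _ d2)).
have -> : 'D_v (chart_ltrans (param (A a) y) 1%g a) z = 'D_(row_mx 0 v) mu (row_mx y z).
  exact/esym/derive_chart_mul_r.
have -> : chart_ltrans (param (A a) y) 1%g a z = mu (row_mx y z).
  by rewrite /chart_ltrans /mu /chart_mul /= row_mxKl row_mxKr.
by [].
Qed.

Let H_continuous v w : D w -> {for w, continuous (H v)}.
Proof.
move=> Dw; have smu := @chart_mul_smooth _ _ _ a (1%g : G) a.
have oD : open D := @chart_mul_dom_open _ _ _ a (1%g : G) a.
apply: continuous_sum_at => k.
have cD : {for w, continuous (fun w => ('D_(row_mx 0 v) mu w) 0 k)}.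
  exact: smooth_continuous (smooth_coord k oD (smooth_derive (row_mx 0 v) smu)) Dw.
have cmu : {for w, continuous mu} := smooth_continuous smu Dw.
have cF : {for w, continuous ('D_(delta_mx 0 k) F \o mu)}.
  apply: continuous_comp; first exact: cmu.
  apply: smooth_continuous (smooth_derive (delta_mx 0 k) (@sf a)) _.
  by apply: coord_image; case: Dw.
exact: cvgM cD cF.
Qed.

(** By the mean value theorem a difference quotient along the curve
    [t |-> x * param (t v + b0)] is a value of [H] at a nearby parameter, and [H]
    is continuous in the point and the parameter together. *)
Lemma local_difference_quotient v e : 0 < e ->
  \forall x \near a & t \near 0^'+,
    `|lie_derive v f x - t^-1 * (f (x * param (A 1%g) (t *: v + b0))%g - f x)| <= e.
Proof.
move=> e0; pose y0 := coord (A a) a.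
have Dw0 : D (row_mx y0 b0) by apply: base_chart_mul_dom; exact: image_self.
have oD : open D := @chart_mul_dom_open _ _ _ a (1%g : G) a.
have e20 : 0 < e / 2 by rewrite divr_gt0.
have nD : \forall w \near row_mx y0 b0, D w by apply: open_nbhs_nbhs.
have /cvgrPdist_lt/(_ _ e20) nH := H_continuous (v := v) Dw0.
have [r /= r0 rB] := (nbhs_ballP _ _).1 (filterI nD nH).
pose d := r / (`|v| + 1).
have v1 : 0 < `|v| + 1 by rewrite ltr_pwDr.
have d0 : 0 < d by rewrite divr_gt0.
exists (dom (A a) `&` coord (A a) @^-1` ball y0 r, [set t | 0 < t < d]).
  split.
    apply: filterI.
      apply: open_nbhs_nbhs; split; last exact: dom_self.
      exact: open_dom (manifold_chart (lie_manifold G) a).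
    apply: (coord_continuous (manifold_chart (lie_manifold G) a) (dom_self a)).
    exact: nbhsx_ballx.
  near=> t; apply/andP; split; near: t; first exact: nbhs_right_gt.
  exact: nbhs_right_lt.
move=> [x t] /= [[ax xr] /andP[t0 td]].
pose y := coord (A a) x.
have xE : x = param (A a) y by rewrite chart_coordK.
have inB c : 0 <= c <= t -> D (row_mx y (c *: v + b0)) /\
    `|H v (row_mx y0 b0) - H v (row_mx y (c *: v + b0))| < e / 2.
  move=> /andP[c0 ct]; apply: rB.
  have [_ br] : ball b0 r (c *: v + b0).
    rewrite -ball_normE /ball_/= opprD addrCA subrr addr0 normrN normrZ ger0_norm//.
    apply: (@le_lt_trans _ _ (t * (`|v| + 1))); last by rewrite -ltr_pdivlMr.
    by apply: ler_pM => //; rewrite lerDl.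
  split=> // i j.
  case: (split_ordP j) => k ->; rewrite ?row_mxEl ?row_mxEr; last exact: br.
  by case: xr => _; apply.
pose gt := f \o ltrans (param (A a) y) \o param (A 1%g).
have [|c /andP[c0 ct] E] := @mvt_line _ _ gt b0 v t t0.
  by move=> s /inB[Ds _]; exact: translate_differentiable.
have t00 : 0 <= (0 : R) <= t by rewrite lexx ltW.
have tc : 0 <= c <= t by rewrite !ltW.
have [D0 H0] := inB 0 t00; have [Dc Hc] := inB c tc.
have E1 : lie_derive v f x = H v (row_mx y (0 *: v + b0)).
  rewrite -H_translate// scale0r add0r.
  by rewrite /lie_derive xE.
have E2 : f (x * param (A 1%g) (t *: v + b0))%g - f x = t * H v (row_mx y (c *: v + b0)).
  rewrite -H_translate// -E /gt /= /ltrans -xE param_base mulg1.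
  by [].
rewrite E1 E2 mulKf ?gt_eqF//.
have close (p q s : R) : `|s - p| < e / 2 -> `|s - q| < e / 2 -> `|p - q| <= e.
  move=> sp sq; rewrite (_ : p - q = (s - q) - (s - p)); last by ring.
  by apply: le_trans (ler_normB _ _) _; rewrite [leRHS]splitr; apply: lerD; exact: ltW.
exact: close H0 Hc.
Unshelve. all: by end_near. Qed.

End AtChart.

Lemma lie_derive_translate v f g x : (forall x, f (g * x)%g = f x) ->
  lie_derive v f (g * x)%g = lie_derive v f x.
Proof.
move=> fg; have E : f \o ltrans (G := G) (g * x)%g = f \o ltrans (G := G) x.
  by apply/funext => z /=; rewrite /ltrans -mulgA fg.
by rewrite /lie_derive E.
Qed.

Context (Gamma : subgroup G).

Definition left_invariant_fct f : Prop :=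
  forall g x, subgroup_set Gamma g -> f (g * x)%g = f x.

(** The derivative is a uniform limit of functions of the form
    [t * (f (x * s) - f x)], which only involve the group structure. *)
Lemma uniform_difference_quotient v f e : is_lattice Gamma ->
  smooth_fct f -> left_invariant_fct f -> 0 < e ->
  exists t s, forall x, `|lie_derive v f x - t * (f (x * s)%g - f x)| <= e.
Proof.
move=> lat sf fG e0.
pose P t x :=
  `|lie_derive v f x - t^-1 * (f (x * param (A 1%g) (t *: v + b0))%g - f x)| <= e.
have H : \forall t \near 0^'+, forall x, P t x.
  apply: (@cocompact_near _ _ _ Gamma _ _ P _ lat) => [t g x Gg|x]; rewrite /P.
    rewrite lie_derive_translate => [|z]; last exact: fG.
    by rewrite (fG g x)// -(mulgA g x) (fG g).
  exact: local_difference_quotient.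
have [t Ht] := @filter_ex _ _ _ _ H.
by exists t^-1, (param (A 1%g) (t *: v + b0)).
Qed.

Lemma invariant_bounded f : is_lattice Gamma -> smooth_fct f ->
  left_invariant_fct f -> bounded_fct f.
Proof.
move=> lat sf fG.
have H : \forall M \near +oo, forall x, `|f x| <= M.
  apply: (@cocompact_near _ _ _ Gamma _ _ (fun M x => `|f x| <= M : Prop) _ lat).
    by move=> M g x Gg; rewrite fG.
  move=> x.
  exists ([set z | `|f z| < `|f x| + 1], [set M | `|f x| + 1 < M]); last first.
    by move=> [z M] /= [fz fM]; exact: ltW (lt_trans fz fM).
  split; last exact: nbhs_pinfty_gt.
  have cx := smooth_continuous (sf x) (image_self x).
  have /cvgrPdist_lt/(_ _ ltr01) Fx := cx.
  have Fx' : \forall y \near coord (A x) x, `|(f \o param (A x)) y| < `|f x| + 1.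
    apply: filterS Fx => y /=; rewrite chart_coordK => [fy|]; last exact: dom_self.
    rewrite -ltrBlDl; apply: le_lt_trans fy; rewrite distrC.
    by apply: le_trans (lerB_dist _ _) _.
  have cc := coord_continuous (manifold_chart (lie_manifold G) x) (dom_self x).
  have dx : nbhs x (dom (A x)).
    apply: open_nbhs_nbhs; split; last exact: dom_self.
    exact: open_dom (manifold_chart (lie_manifold G) x).
  apply: filterS (filterI dx (cc _ Fx')) => z [dz].
  by rewrite /= chart_coordK.
have [M HM] := @filter_ex _ _ _ _ H.
by exists M.
Qed.
End LieDerivative.

Section MeanLieDerivative.
Context {R : realType} {N : nat} (G : lieGroup R N) (Gamma : subgroup G).
Hypothesis lat : is_lattice Gamma.
Implicit Types (f : G -> R) (v : 'rV[R]_N).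

Lemma lie_derive_bounded v f : smooth_fct f -> left_invariant_fct Gamma f ->
  bounded_fct (lie_derive v f).
Proof.
move=> sf fG; have [t [s H]] := uniform_difference_quotient v lat sf fG ltr01.
have [M fM] := invariant_bounded lat sf fG.
exists (1 + `|t| * (M + M)) => x.
rewrite -(subrK (t * (f (x * s)%g - f x)) (lie_derive v f x)).
apply: le_trans (ler_normD _ _) _; apply: lerD; first exact: H.
rewrite normrM ler_wpM2l//; apply: le_trans (ler_normB _ _) _.
by apply: lerD.
Qed.

(** Right translation invariance makes the mean of every difference quotient
    vanish, and these converge uniformly to the derivative. *)
Lemma mean_lie_derive (I : invariant_mean G) v f : smooth_fct f ->
  left_invariant_fct Gamma f -> I (lie_derive v f) = 0 :> R.
Proof.
move=> sf fG; apply/eqP; rewrite -normr_le0; apply/ler_addgt0Pl => e e0.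
rewrite addr0; have [t [s H]] := uniform_difference_quotient v lat sf fG e0.
have [M fM] := invariant_bounded lat sf fG.
pose q x := t * (f (x * s)%g + -1 * f x).
have bf : bounded_fct f by exists M.
have bfs : bounded_fct (fun x => f (x * s)%g) by exists M.
have bq' : bounded_fct (fun x => f (x * s)%g + -1 * f x).
  by apply: bounded_fctD => //; exact: bounded_fctZ.
have Iq : I q = 0.
  rewrite /q meanZ// meanD//; last exact: bounded_fctZ.
  by rewrite meanZ// mean_translate// mulN1r subrr mulr0.
have bL := lie_derive_bounded v sf fG.
have bq : bounded_fct q by exact: bounded_fctZ.
have bnq : bounded_fct (fun x => -1 * q x) by exact: bounded_fctZ.
have -> : I (lie_derive v f) = I (fun x => lie_derive v f x + -1 * q x).
  by rewrite (meanD I bL bnq) (meanZ I _ bq) Iq mulr0 addr0.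
apply: mean_norm => [|x]; first exact: ltW.
by rewrite /q 2!mulN1r.
Qed.

End MeanLieDerivative.

(** * Calculus of complex-valued functions *)

Section ComplexCalculus.
Context {R : realType} {N : nat}.
Local Notation C := R[i].
Local Notation V := 'rV[R]_N.
Local Notation VC := 'rV[C]_N.
Local Notation Re := (@complex.Re R).
Local Notation Im := (@complex.Im R).
Implicit Types (f g : V -> C) (y v : V) (Z : VC) (O : set V).

Lemma complexP (z w : C) : Re z = Re w -> Im z = Im w -> z = w.
Proof. by case: z w => [a b] [c d] /= -> ->. Qed.

Lemma ReD (z w : C) : Re (z + w) = Re z + Re w. Proof. by case: z w => [a b] []. Qed.
Lemma ImD (z w : C) : Im (z + w) = Im z + Im w. Proof. by case: z w => [a b] []. Qed.
Lemma ReM (z w : C) : Re (z * w) = Re z * Re w - Im z * Im w.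
Proof. by case: z w => [a b] []. Qed.
Lemma ImM (z w : C) : Im (z * w) = Re z * Im w + Im z * Re w.
Proof. by case: z w => [a b] []. Qed.

Definition cdiff f y := differentiable (Re \o f) y /\ differentiable (Im \o f) y.

Definition csmooth O f := smooth_on O (Re \o f) /\ smooth_on O (Im \o f).

Lemma csmooth_cdiff O f y : csmooth O f -> O y -> cdiff f y.
Proof. by move=> [sr si] Oy; split; exact: smooth_differentiable Oy. Qed.

Lemma csmooth_eq O f g : open O -> (forall y, O y -> f y = g y) ->
  csmooth O f -> csmooth O g.
Proof.
by move=> oO fg [sr si]; split; [apply: smooth_eq sr|apply: smooth_eq si] => // y Oy /=; rewrite fg.
Qed.

Lemma csmooth_cst O (c : C) : csmooth O (fun=> c).
Proof. by split; exact: smooth_cst. Qed.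

Lemma csmoothD O f g : open O -> csmooth O f -> csmooth O g ->
  csmooth O (fun y => f y + g y).
Proof.
move=> oO [fr fi] [gr gi]; split.
  by apply: smooth_eq (smoothD oO fr gr) => // y _ /=; rewrite ReD.
by apply: smooth_eq (smoothD oO fi gi) => // y _ /=; rewrite ImD.
Qed.

Lemma csmoothM O f g : open O -> csmooth O f -> csmooth O g ->
  csmooth O (fun y => f y * g y).
Proof.
move=> oO [fr fi] [gr gi]; split.
  have n1 : smooth_on O (fun _ : V => -1 : R) by exact: smooth_cst.
  apply: smooth_eq (smoothD oO (smoothM oO fr gr) (smoothM oO n1 (smoothM oO fi gi))) => //.
  by move=> y _ /=; rewrite ReM mulN1r.
apply: smooth_eq (smoothD oO (smoothM oO fr gi) (smoothM oO fi gr)) => //.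
by move=> y _ /=; rewrite ImM.
Qed.

Lemma csmooth_sum O (I : Type) (r : seq I) (F : I -> V -> C) : open O ->
  (forall i, csmooth O (F i)) -> csmooth O (fun y => \sum_(i <- r) F i y).
Proof.
move=> oO sF; elim: r => [|i r IH].
  by under eq_fun do rewrite big_nil; exact: csmooth_cst.
by under eq_fun do rewrite big_cons; exact: csmoothD.
Qed.

Lemma ReDfun f g : Re \o (fun y => f y + g y) = (Re \o f) + (Re \o g).
Proof. by apply/funext => y; rewrite !fctE /= ReD. Qed.
Lemma ImDfun f g : Im \o (fun y => f y + g y) = (Im \o f) + (Im \o g).
Proof. by apply/funext => y; rewrite !fctE /= ImD. Qed.
Lemma ReMfun f g : Re \o (fun y => f y * g y) =
  (Re \o f) * (Re \o g) - (Im \o f) * (Im \o g).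
Proof. by apply/funext => y; rewrite !fctE /= ReM. Qed.
Lemma ImMfun f g : Im \o (fun y => f y * g y) =
  (Re \o f) * (Im \o g) + (Im \o f) * (Re \o g).
Proof. by apply/funext => y; rewrite !fctE /= ImM. Qed.

Lemma cdiff_cst (c : C) y : cdiff (fun=> c) y.
Proof. by split; exact: differentiable_cst. Qed.

Lemma cdiffD f g y : cdiff f y -> cdiff g y -> cdiff (fun y => f y + g y) y.
Proof.
by move=> [fr fi] [gr gi]; split; rewrite ?ReDfun ?ImDfun; exact: differentiableD.
Qed.

Lemma cdiffM f g y : cdiff f y -> cdiff g y -> cdiff (fun y => f y * g y) y.
Proof.
move=> [fr fi] [gr gi]; split; rewrite ?ReMfun ?ImMfun.
  by apply: differentiableB; exact: differentiableM.
by apply: differentiableD; exact: differentiableM.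
Qed.

Lemma derive_realD f g v y : cdiff f y -> cdiff g y ->
  derive_real (fun y => f y + g y) v y = derive_real f v y + derive_real g v y.
Proof.
move=> [fr fi] [gr gi]; rewrite /derive_real ReDfun ImDfun.
by rewrite !deriveD//; exact: diff_derivable.
Qed.

Lemma derive_realM f g v y : cdiff f y -> cdiff g y ->
  derive_real (fun y => f y * g y) v y =
  derive_real f v y * g y + f y * derive_real g v y.
Proof.
move=> [fr fi] [gr gi]; rewrite /derive_real ReMfun ImMfun.
rewrite deriveB; [|by apply: diff_derivable; exact: differentiableM..].
rewrite deriveD; [|by apply: diff_derivable; exact: differentiableM..].
rewrite !deriveM; [|exact: diff_derivable..].
rewrite -!/((_ \o _) y); apply: complexP.
  rewrite ReD !ReM /= /GRing.scale /=; ring.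
rewrite ImD !ImM /= /GRing.scale /=; ring.
Qed.

Lemma derive_real_lin f u v (k : R) y : cdiff f y ->
  derive_real f (k *: u + v) y = k%:C%C * derive_real f u y + derive_real f v y.
Proof.
move=> [fr fi]; rewrite /derive_real !derive_linD// !derive_linZ//.
apply: complexP; rewrite ?ReD ?ReM ?ImD ?ImM /= /GRing.scale /=; ring.
Qed.

Lemma derive_complex_near f g Z y : (\forall z \near y, f z = g z) ->
  derive_complex f Z y = derive_complex g Z y.
Proof.
move=> fg; rewrite /derive_complex /derive_real.
have E (P : C -> R) v : 'D_v (P \o f) y = 'D_v (P \o g) y.
  by apply: near_eq_derive; apply: filterS fg => z /= ->.
by rewrite !E.
Qed.

Lemma derive_complex_cst (c : C) Z y : derive_complex (fun=> c) Z y = 0.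
Proof.
rewrite /derive_complex /derive_real.
have E v (P : C -> R) : 'D_v (P \o (fun _ : V => c)) y = 0 by exact: derive_cst.
by rewrite !E mulr0 addr0.
Qed.

Lemma derive_complexD f g Z y : cdiff f y -> cdiff g y ->
  derive_complex (fun y => f y + g y) Z y =
  derive_complex f Z y + derive_complex g Z y.
Proof.
by move=> df dg; rewrite /derive_complex !derive_realD// mulrDr addrACA.
Qed.

Lemma derive_complexM f g Z y : cdiff f y -> cdiff g y ->
  derive_complex (fun y => f y * g y) Z y =
  derive_complex f Z y * g y + f y * derive_complex g Z y.
Proof. by move=> df dg; rewrite /derive_complex !derive_realM//; ring. Qed.

Lemma cdiff_sum (I : Type) (r : seq I) (F : I -> V -> C) y :
  (forall i, cdiff (F i) y) -> cdiff (fun y => \sum_(i <- r) F i y) y.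
Proof.
move=> dF; elim: r => [|i r IH].
  by under eq_fun do rewrite big_nil; exact: cdiff_cst.
by under eq_fun do rewrite big_cons; exact: cdiffD.
Qed.

Lemma derive_complex_sum (I : Type) (r : seq I) (F : I -> V -> C) Z y :
  (forall i, cdiff (F i) y) ->
  derive_complex (fun y => \sum_(i <- r) F i y) Z y =
  \sum_(i <- r) derive_complex (F i) Z y.
Proof.
move=> dF; elim: r => [|i r IH].
  by under eq_fun do rewrite big_nil; rewrite big_nil derive_complex_cst.
under eq_fun do rewrite big_cons.
by rewrite big_cons derive_complexD ?IH//; exact: cdiff_sum.
Qed.

Lemma reV_lin (c : C) Z Z' :
  reV (c *: Z + Z') = Re c *: reV Z + (- Im c *: imV Z + reV Z').
Proof. by apply/rowP => j; rewrite !mxE ReD ReM; ring. Qed.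

Lemma imV_lin (c : C) Z Z' :
  imV (c *: Z + Z') = Re c *: imV Z + (Im c *: reV Z + imV Z').
Proof. by apply/rowP => j; rewrite !mxE ImD ImM; ring. Qed.

Lemma derive_complex_lin f (c : C) Z Z' y : cdiff f y ->
  derive_complex f (c *: Z + Z') y = c * derive_complex f Z y + derive_complex f Z' y.
Proof.
move=> df; rewrite /derive_complex reV_lin imV_lin !derive_real_lin//.
move: (derive_real f _ y) (derive_real f (imV Z) y) (derive_real f _ y)
  (derive_real f (imV Z') y) => [a b] [a' b'] [d e] [d' e'].
case: c => p q.
apply: complexP; rewrite ?(ReD, ReM, ImD, ImM) /=; ring.
Qed.

End ComplexCalculus.

(** * Alternating forms and the product rule *)

Section AlternatingForms.
Context {R : realType} {N : nat}.
Local Notation C := R[i].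
Local Notation VC := 'rV[C]_N.
Implicit Types (a : seq VC -> C) (r s t : seq VC) (u v : VC) (c : C).

Section Fixed.
Variable a : seq VC -> C.
Hypothesis alt : alternating_form a.

Lemma alt_lin s t c u v :
  a (s ++ (c *: u + v) :: t) = c * a (s ++ u :: t) + a (s ++ v :: t).
Proof. by case: alt => + _; apply. Qed.

Lemma alt_repeat r s t u : a (r ++ u :: s ++ u :: t) = 0.
Proof. by case: alt => _; apply. Qed.

Lemma alt_add s t u v : a (s ++ (u + v) :: t) = a (s ++ u :: t) + a (s ++ v :: t).
Proof. by rewrite -[u in LHS]scale1r alt_lin mul1r. Qed.

Lemma alt_zero s t : a (s ++ 0 :: t) = 0.
Proof. by have := alt_add s t 0 0; rewrite addr0 => /esym/(canRL (addrK _)); rewrite subrr. Qed.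

Lemma alt_sum (I : Type) (x : seq I) (P : pred I) (c : I -> C) (e : I -> VC) s t :
  a (s ++ (\sum_(k <- x | P k) c k *: e k) :: t) =
  \sum_(k <- x | P k) c k * a (s ++ e k :: t).
Proof.
elim: x => [|k x IH]; first by rewrite !big_nil alt_zero.
by rewrite !big_cons; case: (P k) => //; rewrite alt_lin IH.
Qed.

Lemma alt_swap s t u v : a (s ++ u :: v :: t) = - a (s ++ v :: u :: t).
Proof.
apply/eqP; rewrite -addr_eq0; apply/eqP.
have := alt_repeat s [::] t (u + v); rewrite /= alt_add.
rewrite -[s ++ u :: u + v :: t]/(s ++ [:: u] ++ (u + v) :: t).
rewrite -[s ++ v :: u + v :: t]/(s ++ [:: v] ++ (u + v) :: t).
rewrite !catA !alt_add -!catA /=.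
have H w := alt_repeat s [::] t w; rewrite /= in H.
by rewrite !H add0r addr0.
Qed.

Lemma alt_move s t u : a (s ++ u :: t) = (-1) ^+ size s * a (u :: s ++ t).
Proof.
elim/last_ind: s t => [|s v IH] t; first by rewrite expr0 mul1r.
rewrite size_rcons exprS mulN1r mulNr -cats1 -!catA /= alt_swap.
by rewrite (IH (v :: t)).
Qed.

Lemma alt_move_in r s t u :
  a (r ++ s ++ u :: t) = (-1) ^+ size s * a (r ++ u :: s ++ t).
Proof.
elim/last_ind: s t => [|s v IH] t; first by rewrite expr0 mul1r.
rewrite size_rcons exprS mulN1r mulNr -cats1 -!catA /=.
rewrite [r ++ s ++ _]catA alt_swap -catA.
by rewrite (IH (v :: t)).
Qed.

End Fixed.

Lemma alternating_form_map a (M : 'M[C]_N) : alternating_form a ->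
  alternating_form (fun s => a [seq Z *m M | Z <- s]).
Proof.
move=> alt; split=> [s t c u v|r s t u]; rewrite !map_cat /=.
  by rewrite mulmxDl -scalemxAl alt_lin.
by rewrite map_cat /= alt_repeat.
Qed.

End AlternatingForms.

Section Leibniz.
Context {R : realType} {N : nat}.
Local Notation C := R[i].
Local Notation V := 'rV[R]_N.
Local Notation VC := 'rV[C]_N.
Implicit Types (s t pre : seq VC) (Z X : VC) (y : V).

Definition replace_nth (T : Type) (j : nat) (x : T) (s : seq T) : seq T :=
  take j s ++ x :: drop j.+1 s.

Variables (W : seq VC -> V -> C) (M : V -> 'M[R]_N).
Hypothesis altW : forall y, alternating_form (W ^~ y).

Let f pre s y := W (pre ++ [seq Z *m cmx (M y) | Z <- s]) y.

Let f_cons pre Z s y : f pre (Z :: s) y =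
  \sum_k (Z *m cmx (M y)) 0 k * f (rcons pre (delta_mx 0 k)) s y.
Proof.
rewrite /f /= [Z *m _ in LHS]row_sum_delta (alt_sum (altW y)).
by apply: eq_bigr => k _; rewrite cat_rcons.
Qed.

Lemma csmooth_row_coord (O : set V) Z k : open O ->
  (forall i j, smooth_on O (fun y => M y i j)) ->
  csmooth O (fun y => (Z *m cmx (M y)) 0 k).
Proof.
move=> oO sM.
have -> : (fun y => (Z *m cmx (M y)) 0 k) =
    (fun y => \sum_i Z 0 i * (M y i k)%:C%C).
  by apply/funext => y; rewrite mxE; apply: eq_bigr => i _; rewrite mxE.
apply: csmooth_sum => // i; apply: csmoothM => //; first exact: csmooth_cst.
by split; [exact: sM|exact: smooth_cst].
Qed.

Lemma csmooth_multilinear (O : set V) s : open O ->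
  (forall t, csmooth O (W t)) ->
  (forall i j, smooth_on O (fun y => M y i j)) ->
  csmooth O (fun y => W [seq Z *m cmx (M y) | Z <- s] y).
Proof.
move=> oO sW sM; rewrite -/(f [::] s).
elim: s [::] => [|Z s IH] pre; first by rewrite /f /= cats0; exact: sW.
have -> : f pre (Z :: s) = fun y =>
    \sum_k (Z *m cmx (M y)) 0 k * f (rcons pre (delta_mx 0 k)) s y.
  by apply/funext => y; exact: f_cons.
apply: csmooth_sum => // k; apply: csmoothM => //; exact: csmooth_row_coord.
Qed.

Variable y0 : V.
Hypothesis dW : forall t, cdiff (W t) y0.
Hypothesis dM : forall i j, differentiable (fun y => M y i j) y0.

Definition derive_mx_complex X : 'M[C]_N :=
  cmx (\matrix_(i, j) 'D_(reV X) (fun y => M y i j) y0) +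
  'i%C *: cmx (\matrix_(i, j) 'D_(imV X) (fun y => M y i j) y0).

Let dc Z k y := (Z *m cmx (M y)) 0 k.

Let dcE Z k : dc Z k = fun y => \sum_i Z 0 i * (M y i k)%:C%C.
Proof.
by apply/funext => y; rewrite /dc mxE; apply: eq_bigr => i _; rewrite mxE.
Qed.

Let cdiff_entry i k : cdiff (fun y => (M y i k)%:C%C) y0.
Proof. by split; [exact: dM|exact: differentiable_cst]. Qed.

Let cdiff_dc Z k : cdiff (dc Z k) y0.
Proof.
rewrite dcE; apply: cdiff_sum => i; apply: cdiffM => //; exact: cdiff_cst.
Qed.

Let derive_dc Z k X : derive_complex (dc Z k) X y0 = (Z *m derive_mx_complex X) 0 k.
Proof.
rewrite dcE derive_complex_sum => [|i]; last first.
  by apply: cdiffM => //; exact: cdiff_cst.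
rewrite mxE; apply: eq_bigr => i _.
rewrite derive_complexM//; last exact: cdiff_cst.
rewrite derive_complex_cst mul0r add0r; congr (_ * _).
rewrite /derive_complex /derive_real !mxE.
have E v : 'D_v (@complex.Im R \o (fun y => (M y i k)%:C%C)) y0 = 0.
  exact: derive_cst.
by rewrite !E.
Qed.

(** The product rule for a multilinear form whose arguments move by the matrix
    [M y]: one term for the form, one for each argument. *)
Lemma derive_multilinear s X (s' := [seq Z *m cmx (M y0) | Z <- s]) :
  derive_complex (fun y => W [seq Z *m cmx (M y) | Z <- s] y) X y0 =
  derive_complex (W s') X y0 +
  \sum_(j < size s) W (replace_nth j (s`_j *m derive_mx_complex X) s') y0.
Proof.
(* For the induction on [s], a prefix of constant vectors is kept in front. *)
suff H pre : cdiff (f pre s) y0 /\ derive_complex (f pre s) X y0 =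
    derive_complex (W (pre ++ s')) X y0 +
    \sum_(j < size s) W (pre ++ replace_nth j (s`_j *m derive_mx_complex X) s') y0.
  by have [] := H [::].
rewrite /s' {s'}; elim: s pre => [|Z s IH] pre.
  by rewrite big_ord0 addr0 /f /= cats0; split.
have fE : f pre (Z :: s) = fun y =>
    \sum_k dc Z k y * f (rcons pre (delta_mx 0 k)) s y.
  by apply/funext => y; exact: f_cons.
have dk k : cdiff (f (rcons pre (delta_mx 0 k)) s) y0 by case: (IH (rcons pre (delta_mx 0 k))).
have dt k : cdiff (fun y => dc Z k y * f (rcons pre (delta_mx 0 k)) s y) y0.
  by apply: cdiffM.
split; first by rewrite fE; exact: cdiff_sum.
rewrite fE derive_complex_sum//.
transitivity (\sum_k ((Z *m derive_mx_complex X) 0 k * f (rcons pre (delta_mx 0 k)) s y0 +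
   dc Z k y0 *
     (derive_complex (W (rcons pre (delta_mx 0 k) ++ [seq Z *m cmx (M y0) | Z <- s])) X y0 +
      \sum_(j < size s) W (rcons pre (delta_mx 0 k) ++
         replace_nth j (s`_j *m derive_mx_complex X) [seq Z *m cmx (M y0) | Z <- s]) y0))).
  apply: eq_bigr => k _; rewrite derive_complexM// derive_dc.
  by case: (IH (rcons pre (delta_mx 0 k))) => _ ->.
rewrite big_split /= [X in _ + X = _](eq_bigr _ (fun k _ => mulrDr _ _ _)) big_split /=.
rewrite addrCA; congr (_ + _).
  have -> : W (pre ++ Z *m cmx (M y0) :: [seq Z *m cmx (M y0) | Z <- s]) =
      fun y => \sum_k dc Z k y0 * W (rcons pre (delta_mx 0 k) ++ [seq Z *m cmx (M y0) | Z <- s]) y.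
    apply/funext => y; rewrite [Z *m _ in LHS]row_sum_delta (alt_sum (altW y)).
    by apply: eq_bigr => k _; rewrite cat_rcons.
  rewrite derive_complex_sum => [|k]; last by apply: cdiffM => //; exact: cdiff_cst.
  apply: eq_bigr => k _; rewrite derive_complexM//; last exact: cdiff_cst.
  by rewrite derive_complex_cst mul0r add0r.
rewrite big_ord_recl; congr (_ + _).
  rewrite /replace_nth /= drop0 [X in pre ++ X :: _]row_sum_delta (alt_sum (altW y0)).
  by apply: eq_bigr => k _; rewrite /f cat_rcons.
under eq_bigr do rewrite mulr_sumr.
rewrite exchange_big; apply: eq_bigr => j _ /=.
rewrite /replace_nth /= [X in pre ++ X :: _]row_sum_delta (alt_sum (altW y0)).
by apply: eq_bigr => k _; rewrite cat_rcons.
Qed.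

End Leibniz.

(** * The formula of Cartan in a left-invariant frame *)

Section Omit.
Variable T : Type.
Implicit Types (s : seq T) (x : T).

Lemma omit0 x s : omit 0 (x :: s) = s. Proof. by rewrite /omit /= drop0. Qed.

Lemma omitS i x s : omit i.+1 (x :: s) = x :: omit i s. Proof. by []. Qed.

Lemma size_omit i s : (i < size s)%N -> size (omit i s) = (size s).-1.
Proof.
move=> iS; rewrite /omit size_cat size_drop size_takel; last exact: ltnW.
lia.
Qed.

Lemma nth_omit x0 i j s : nth x0 (omit i s) j = nth x0 s (bump i j).
Proof.
elim: s i j => [|x s IH] i j; first by rewrite /omit /= !nth_nil.
case: i => [|i]; first by rewrite omit0 /bump.
by rewrite omitS; case: j => [|j] //; rewrite bumpS /= IH.
Qed.

Lemma omit_omit i j s : (i <= j)%N -> omit j (omit i s) = omit i (omit j.+1 s).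
Proof.
elim: s i j => [|x s IH] [|i] [|j] //= ij; rewrite ?omitS ?omit0//=.
by rewrite IH.
Qed.

Lemma map_omit (U : Type) (f : T -> U) i s : map f (omit i s) = omit i (map f s).
Proof. by rewrite /omit map_cat map_take map_drop. Qed.

Lemma omit_cat_size s1 x s2 : omit (size s1) (s1 ++ x :: s2) = s1 ++ s2.
Proof. by elim: s1 => [|y s1 IH]; rewrite /= ?omit0 ?omitS ?IH. Qed.

Lemma omit_cat_lt i s1 s2 : (i < size s1)%N -> omit i (s1 ++ s2) = omit i s1 ++ s2.
Proof.
elim: s1 i => [|y s1 IH] [|i] //= iS; rewrite ?omit0 ?omitS//=.
by rewrite IH.
Qed.

Lemma omit_cat_ge i s1 s2 : omit (size s1 + i) (s1 ++ s2) = s1 ++ omit i s2.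
Proof. by elim: s1 => [|y s1 IH] //=; rewrite addSn omitS IH. Qed.

End Omit.

(** A choice of [i] followed by a choice of [j] among the remaining indices is a
    pair of distinct indices, here grouped as [i < j] and [j < i]. *)
Lemma sum_ordered_pairs (V : nmodType) n (f : nat -> nat -> V) :
  \sum_(i < n.+1) \sum_(j < n) f i j =
  \sum_(i < n.+1) \sum_(j < n.+1 | (i < j)%N) (f i j.-1 + f j i).
Proof.
under eq_bigr => i _ do rewrite (bigID (fun j : 'I_n => (j < i)%N)) /= addrC.
under [in RHS]eq_bigr do rewrite big_split /=.
rewrite !big_split /=; congr (_ + _).
  apply: eq_bigr => i _.
  rewrite big_mkcond [RHS]big_mkcond big_ord_recl /= add0r.
  by apply: eq_bigr => j _; rewrite -[bump 0 j]/(j.+1) -leqNgt ltnS add0n.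
rewrite [RHS](exchange_big_dep predT)//=.
apply: eq_bigr => i _; rewrite big_mkcond [RHS]big_mkcond big_ord_recr /=.
by rewrite ltnNge -ltnS ltn_ord /= addr0.
Qed.

Lemma bracket_cancel (K : comNzRingType) (V : lmodType K) (I : K) (X1 X2 X3 X4 Y1 Y2 Y3 Y4 : V) :
  Y1 + X1 + I *: (Y4 + X3) + (I *: (Y3 + X2) + -1 *: (Y2 + X4)) -
  (X1 + I *: X2 + (I *: X3 + -1 *: X4)) =
  Y1 - Y2 + I *: (Y3 + Y4).
Proof.
rewrite !scalerDr !scaleN1r !opprD !opprK.
rewrite [LHS](AC ((2*2)*(2*2)*((1*1)*(1*1))) ((1*7)*(5*3)*((2*9)*(6*10)*((4*11)*(8*12))))) /=.
by rewrite !subrr addNr !addr0.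
Qed.

Section ComplexMatrix.
Context {R : realType} {N : nat}.
Local Notation C := R[i].
Local Notation VC := 'rV[C]_N.
Implicit Types (Z : VC).

Lemma cmxM m n p (M : 'M[R]_(m, n)) (M' : 'M[R]_(n, p)) : cmx (M *m M') = cmx M *m cmx M'.
Proof. exact: map_mxM. Qed.

Lemma cmx1 n : cmx (1%:M : 'M[R]_n) = 1%:M.
Proof. exact: map_mx1. Qed.

Lemma cmxD m n (M M' : 'M[R]_(m, n)) : cmx (M + M') = cmx M + cmx M'.
Proof. exact: map_mxD. Qed.

Lemma reim_mx Z : Z = cmx (reV Z) + 'i%C *: cmx (imV Z).
Proof.
apply/rowP => j; rewrite !mxE; case: (Z 0 j) => a b.
by apply: complexP; rewrite ?(ReD, ImD, ReM, ImM) /=; ring.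
Qed.

Lemma reV_cmx Z n (M : 'M[R]_(N, n)) : reV (Z *m cmx M) = reV Z *m M.
Proof.
apply/rowP => j; rewrite !mxE (big_morph (@complex.Re R) (@ReD R) (erefl _)).
by apply: eq_bigr => k _; rewrite !mxE ReM /= mulr0 subr0.
Qed.

Lemma imV_cmx Z n (M : 'M[R]_(N, n)) : imV (Z *m cmx M) = imV Z *m M.
Proof.
apply/rowP => j; rewrite !mxE (big_morph (@complex.Im R) (@ImD R) (erefl _)).
by apply: eq_bigr => k _; rewrite !mxE ImM /= mulr0 add0r.
Qed.

Lemma mul_ii : ('i%C : C) * 'i%C = -1.
Proof. by apply: complexP; rewrite ?ReM ?ImM /=; ring. Qed.

End ComplexMatrix.

Section Cartan.
Context {R : realType} {N : nat} (G : lieGroup R N).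
Local Notation A := (lie_atlas G).
Local Notation C := R[i].
Local Notation V := 'rV[R]_N.
Local Notation VC := 'rV[C]_N.
Local Notation b0 := (base_point G).
Implicit Types (w : G -> seq VC -> C) (x g : G) (y : V) (Z : VC) (s t : seq VC).

Definition frame_at x : 'M[R]_N := frame x (coord (A x) x).

(** The coefficients of a form in the left-invariant frame. *)
Definition coef w s x : C := w x [seq Z *m cmx (frame_at x) | Z <- s].

Definition csmooth_fct (f : G -> C) : Prop :=
  smooth_fct (@complex.Re R \o f) /\ smooth_fct (@complex.Im R \o f).

Definition lie_deriveC Z (f : G -> C) x : C :=
  derive_complex (f \o ltrans (G := G) x \o param (A 1%g)) Z b0.

Lemma lie_deriveC_chart Z f x : csmooth_fct f ->
  lie_deriveC Z f x =
  derive_complex (f \o param (A x)) (Z *m cmx (frame_at x)) (coord (A x) x).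
Proof.
move=> [sr si].
have E (P : C -> R) v : smooth_fct (P \o f) ->
    'D_v (P \o (f \o ltrans (G := G) x \o param (A 1%g))) b0 =
    'D_(v *m frame_at x) (P \o (f \o param (A x))) (coord (A x) x).
  move=> sP; apply: (etrans _ (lie_derive_chart sP v (image_self x))).
  by rewrite chart_coordK//; exact: dom_self.
have Er v : derive_real (f \o ltrans (G := G) x \o param (A 1%g)) v b0 =
    derive_real (f \o param (A x)) (v *m frame_at x) (coord (A x) x).
  exact: (f_equal2 (@Complex R) (E _ v sr) (E _ v si)).
by rewrite /lie_deriveC /derive_complex reV_cmx imV_cmx (Er (reV Z)) (Er (imV Z)).
Qed.

Lemma local_formE w x s y : local_form w x s y =
  w (param (A x) y) [seq Z *m cmx (jac_ltrans 1%g x (param (A x) y) y) | Z <- s].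
Proof.
have E : ltrans (G := G) 1%g = id by apply/funext => z; rewrite /ltrans mul1g.
by rewrite /local_form /jac_ltrans /chart_ltrans E.
Qed.

Lemma local_form_self w x s : local_form w x s (coord (A x) x) = w x s.
Proof.
rewrite local_formE chart_coordK; last exact: dom_self.
rewrite jac_ltrans1; last exact: image_self.
by congr (w x _); rewrite cmx1; elim: s => //= Z s ->; rewrite mulmx1.
Qed.

Lemma frame_at_param x y : chart_image (A x) y ->
  frame_at (param (A x) y) = frame x y *m jac_ltrans 1%g x (param (A x) y) y.
Proof.
move=> xy; set p := param (A x) y.
have pb : (p * param (A 1%g) b0)%g = p by rewrite param_base mulg1.
have d1 : dom (A x) (p * param (A 1%g) b0)%g by rewrite pb; exact: param_dom.
have d2 : dom (A p) (1 * (p * param (A 1%g) b0))%g.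
  by rewrite mul1g pb; exact: dom_self.
have E : jac_ltrans (1 * p)%g 1%g p b0 = frame x y *m jac_ltrans 1%g x p y.
  by rewrite (jac_ltransM (base_image G) d1 d2) pb paramK.
rewrite -E mul1g /frame_at /frame chart_coordK//.
exact: dom_self.
Qed.

Lemma coef_local w s x y : chart_image (A x) y ->
  coef w s (param (A x) y) = local_form w x [seq Z *m cmx (frame x y) | Z <- s] y.
Proof.
move=> xy; rewrite local_formE /coef frame_at_param// -map_comp.
by congr (w _ _); apply: eq_map => Z /=; rewrite cmxM mulmxA.
Qed.

Lemma local_form_alternating w x y : (forall x, alternating_form (w x)) ->
  alternating_form (fun s => local_form w x s y).
Proof. by move=> altw; apply: alternating_form_map. Qed.

Lemma coef_smooth w s : smooth_form w -> (forall x, alternating_form (w x)) ->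
  csmooth_fct (coef w s).
Proof.
move=> sw altw.
have H x : csmooth (chart_image (A x)) (coef w s \o param (A x)).
  have oI := @chart_image_open _ _ _ x.
  apply: (csmooth_eq oI (f := fun y => local_form w x [seq Z *m cmx (frame x y) | Z <- s] y)).
    by move=> y xy; rewrite /= coef_local.
  apply: csmooth_multilinear => //.
  - by move=> y; exact: local_form_alternating.
  - by move=> t; exact: sw.
  - by move=> i j; exact: frame_smooth.
by split=> x; case: (H x).
Qed.

Lemma derive_mx_complex_frame x Z :
  derive_mx_complex (frame x) (coord (A x) x) (Z *m cmx (frame_at x)) =
  cmx (dframe x (reV Z *m frame_at x)) + 'i%C *: cmx (dframe x (imV Z *m frame_at x)).
Proof. by rewrite /derive_mx_complex reV_cmx imV_cmx. Qed.

Lemma lie_bracketC_frame x Z Z'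
    (D := fun Z => derive_mx_complex (frame x) (coord (A x) x) (Z *m cmx (frame_at x))) :
  Z' *m D Z - Z *m D Z' = lie_bracketC G Z Z' *m cmx (frame_at x).
Proof.
have br u v : cmx v *m cmx (dframe x (u *m frame_at x)) =
    cmx (lie_bracket G u v) *m cmx (frame_at x) + cmx u *m cmx (dframe x (v *m frame_at x)).
  by rewrite -!cmxM -cmxD -bracket_frame subrK.
rewrite /D !derive_mx_complex_frame {D}.
have alg (P : V -> 'M[C]_N) (L : V -> V -> VC) (a b a' b' : V) :
    (forall u v, cmx v *m P u = L u v + cmx u *m P v) ->
    (cmx a' + 'i%C *: cmx b') *m (P a + 'i%C *: P b) -
    (cmx a + 'i%C *: cmx b) *m (P a' + 'i%C *: P b') =
    L a a' - L b b' + 'i%C *: (L a b' + L b a').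
  move=> PL; rewrite !mulmxDl !mulmxDr -!scalemxAl -!scalemxAr.
  rewrite (PL a a') (PL b a') (PL a b') (PL b b') !scalerA !mul_ii.
  move: (cmx a *m P a') (cmx a *m P b') (cmx b *m P a') (cmx b *m P b') => X1 X2 X3 X4.
  move: (L a a') (L b b') (L a b') (L b a') => Y1 Y2 Y3 Y4.
  exact: bracket_cancel.
have := alg _ _ (reV Z) (imV Z) (reV Z') (imV Z') br.
rewrite -!reim_mx => ->.
by rewrite /lie_bracketC !mulmxDl mulNmx -scalemxAl mulmxDl.
Qed.

(** The formula of Cartan. Differentiating the coefficients [coef w] by the product
    rule gives the exterior derivative, computed in a chart with fixed vectors,
    plus the derivatives of the frame; the latter combine in pairs [i < j] into the
    brackets of the fields, hence into the Chevalley-Eilenberg differential. *)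
Lemma ext_d_frame w x s :
  smooth_form w -> (forall x, alternating_form (w x)) ->
  ext_d w x [seq Z *m cmx (frame_at x) | Z <- s] =
  \sum_(i < size s) (-1) ^+ i * lie_deriveC s`_i (coef w (omit i s)) x +
  ce_d G (fun t => coef w t x) s.
Proof.
move=> sw altw; pose F := cmx (frame_at x); pose s' := [seq Z *m F | Z <- s].
pose y0 := coord (A x) x.
pose D Z := derive_mx_complex (frame x) y0 (Z *m F).
have xy0 : chart_image (A x) y0 := image_self x.
have leib Z t : lie_deriveC Z (coef w t) x =
    derive_complex (local_form w x [seq Z *m F | Z <- t]) (Z *m F) y0 +
    \sum_(0 <= j < size t) w x (replace_nth j (t`_j *m D Z) [seq Z *m F | Z <- t]).
  rewrite lie_deriveC_chart; last exact: coef_smooth.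
  have E : \forall y \near y0, (coef w t \o param (A x)) y =
      local_form w x [seq Z *m cmx (frame x y) | Z <- t] y.
    apply: near_open_eq (@chart_image_open _ _ _ x) xy0 _ => y xy.
    exact: coef_local.
  apply: (etrans (derive_complex_near _ E)).
  apply: (etrans (derive_multilinear _ _ _ _ _)).
  - by move=> y; exact: local_form_alternating.
  - by move=> t'; apply: csmooth_cdiff (sw x t') xy0.
  - by move=> i j; exact: frame_differentiable.
  by rewrite big_mkord; congr (_ + _); apply: eq_bigr => j _; exact: local_form_self.
pose B i := derive_complex (local_form w x (omit i s')) s'`_i y0.
have s'E i : (i < size s)%N -> s'`_i = s`_i *m F.
  by move=> iS; rewrite (nth_map 0).
have -> : ext_d w x s' = \sum_(i < size s) (-1) ^+ i * lie_deriveC s`_i (coef w (omit i s)) x -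
  \sum_(i < size s) (-1) ^+ i * \sum_(0 <= j < size (omit i s))
     w x (replace_nth j ((omit i s)`_j *m D s`_i) (omit i s')).
  rewrite /ext_d size_map -sumrB; apply: eq_bigr => i _.
  rewrite -mulrBr leib -map_omit; congr (_ * _).
  by rewrite s'E// addrK.
congr (_ + _).
rewrite /ce_d.
case: (posnP (size s)) => [s0|]; first by rewrite s0 !big_ord0 oppr0.
case E : (size s) => [//|n] _.
have sO i : (i < n.+1)%N -> size (omit i s) = n.
  by move=> iS; rewrite size_omit E.
pose f i j := (-1) ^+ i * ((-1) ^+ j * w x ((omit i s)`_j *m D s`_i :: omit j (omit i s'))).
have -> : \sum_(i < n.+1) (-1) ^+ i * \sum_(0 <= j < size (omit i s))
     w x (replace_nth j ((omit i s)`_j *m D s`_i) (omit i s')) =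
   \sum_(i < n.+1) \sum_(j < n) f i j.
  apply: eq_bigr => i _; rewrite sO// big_mkord mulr_sumr.
  apply: eq_bigr => j _; rewrite /f; congr (_ * _).
  rewrite /replace_nth (alt_move (altw x)) size_takel//.
  by rewrite size_omit size_map E// ltnW.
(* Moving the differentiated argument to the front gives the sign [(-1) ^ j], and
   the two orders of a pair then have opposite signs. *)
rewrite sum_ordered_pairs -sumrN; apply: eq_bigr => i _.
rewrite -sumrN; apply: eq_bigr => j ij.
rewrite /f !nth_omit.
have -> : bump i j.-1 = j by rewrite /bump; lia.
have -> : bump j i = i by rewrite /bump; lia.
have -> : omit j.-1 (omit i s') = omit i (omit j s').
  by rewrite omit_omit ?prednK//; lia.
rewrite /coef /= -lie_bracketC_frame -/F !map_omit -/s'.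
rewrite -/(D _) -/(D _).
have altB (P Q : VC) t : w x (P - Q :: t) = w x (P :: t) - w x (Q :: t).
  have := alt_lin (altw x) [::] t (-1) Q P.
  by rewrite /= scaleN1r mulN1r addrC [RHS]addrC.
rewrite altB.
have sgn : (-1 : C) ^+ j = - (-1) ^+ j.-1.
  by rewrite -[in LHS](prednK (n := j)) ?exprS ?mulN1r//; lia.
have fin (p q P Q : C) : - (p * (q * P) + - q * (p * Q)) = p * - q * (P - Q).
  by ring.
by rewrite exprD sgn; exact: fin.
Qed.

End Cartan.

(** * Components of a given bidegree *)

Section TypeParts.
Context {R : realType} {N : nat}.
Local Notation C := R[i].
Local Notation VC := 'rV[C]_N.
Implicit Types (a : seq VC -> C) (r s t : seq VC) (u v Z : VC) (J F : 'M[R]_N) (p q : int).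

(** The sum over all ways of projecting each argument by [P] or [Q], with [p] uses
    of [P]. The recursion replaces the sum over boolean tuples of [type_part],
    whose type depends on the length of the list. *)
Fixpoint split_sum (P Q : VC -> VC) p s a : C :=
  match s with
  | [::] => if p == 0 then a [::] else 0
  | Z :: s' => split_sum P Q (p - 1) s' (fun t => a (P Z :: t)) +
               split_sum P Q p s' (fun t => a (Q Z :: t))
  end.

Lemma sum_tuple_cons (V : nmodType) (T : finType) n (F : seq T -> V) :
  \sum_(b : n.+1.-tuple T) F b = \sum_(x : T) \sum_(b : n.-tuple T) F (x :: b).
Proof.
rewrite pair_big /= (reindex (fun z : T * n.-tuple T => [tuple of z.1 :: z.2])) //=.
exists (fun b : n.+1.-tuple T => (thead b, [tuple of behead b])) => [[x b]|b] _ /=.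
  by congr (_, _); apply: val_inj.
by rewrite -tuple_eta.
Qed.

Lemma split_sumE J p a s :
  \sum_(b : (size s).-tuple bool | (count id b)%:Z == p)
      a [seq (if z.1 then proj10 J z.2 else proj01 J z.2) | z <- zip b s] =
  split_sum (proj10 J) (proj01 J) p s a.
Proof.
elim: s p a => [|Z s IH] p a /=.
  rewrite big_mkcond (big_pred1 [tuple]) => [|b]; last by apply/esym/eqP; exact: tuple0.
  by rewrite eq_sym.
rewrite big_mkcond.
rewrite (sum_tuple_cons _ (fun b => if (count id b)%:Z == p then
  a [seq (if z.1 then proj10 J z.2 else proj01 J z.2) | z <- zip b (Z :: s)] else 0)).
rewrite big_bool /= -!big_mkcond /= -IH -IH; congr (_ + _).
by apply: eq_bigl => b; rewrite add1n intS addrC -[RHS](inj_eq (addIr 1)) subrK.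
Qed.

Lemma type_partE J p q a s : type_part J p q a s =
  if (size s)%:Z == p + q then split_sum (proj10 J) (proj01 J) p s a else 0.
Proof. by rewrite /type_part split_sumE. Qed.

Lemma split_sum_map (P Q P' Q' f : VC -> VC) p s a :
  (forall Z, P' (f Z) = f (P Z)) -> (forall Z, Q' (f Z) = f (Q Z)) ->
  split_sum P' Q' p (map f s) a = split_sum P Q p s (fun t => a (map f t)).
Proof.
move=> Pf Qf; elim: s p a => [|Z s IH] p a //=.
by rewrite Pf Qf; congr (_ + _); exact: IH.
Qed.

Section SplitSum.
Variables (P Q : VC -> VC).

Lemma split_sum_lin p s a a' a'' (c : C) :
  (forall t, size t = size s -> a t = c * a' t + a'' t) ->
  split_sum P Q p s a = c * split_sum P Q p s a' + split_sum P Q p s a''.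
Proof.
elim: s p a a' a'' => [|Z s IH] p a a' a'' aE /=.
  by case: eqP => _; rewrite ?aE// mulr0 addr0.
have step X p' : split_sum P Q p' s (fun t => a (X :: t)) =
    c * split_sum P Q p' s (fun t => a' (X :: t)) +
    split_sum P Q p' s (fun t => a'' (X :: t)).
  by apply: IH => t ts; apply: aE; rewrite /= ts.
rewrite !step.
by rewrite mulrDr addrACA.
Qed.

Lemma split_sum_eq p s a a' : (forall t, size t = size s -> a t = a' t) ->
  split_sum P Q p s a = split_sum P Q p s a'.
Proof.
elim: s p a a' => [|Z s IH] p a a' aE /=; first by rewrite aE.
by congr (_ + _); apply: IH => t ts; apply: aE; rewrite /= ts.
Qed.

Lemma split_sum0 p s : split_sum P Q p s (fun=> 0) = 0.
Proof. by elim: s p => [|Z s IH] p /=; [case: eqP|rewrite !IH addr0]. Qed.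

Hypothesis PZ : forall c u v, P (c *: u + v) = c *: P u + P v.
Hypothesis QZ : forall c u v, Q (c *: u + v) = c *: Q u + Q v.

Lemma alternating_form_cons a u : alternating_form a ->
  alternating_form (fun t => a (u :: t)).
Proof.
by move=> alt; split=> [s t c v w|r s t v]; rewrite -!cat_cons ?(alt_lin alt) ?(alt_repeat alt).
Qed.

Lemma split_sum_linear p s t c u v a : alternating_form a ->
  split_sum P Q p (s ++ (c *: u + v) :: t) a =
  c * split_sum P Q p (s ++ u :: t) a + split_sum P Q p (s ++ v :: t) a.
Proof.
elim: s p a => [|Z s IH] p a alt /=.
  rewrite mulrDr addrACA; congr (_ + _); apply: split_sum_lin => t' _.
    by rewrite PZ; exact: (alt_lin alt [::]).
  by rewrite QZ; exact: (alt_lin alt [::]).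
by rewrite !IH; [rewrite mulrDr addrACA|exact: alternating_form_cons..].
Qed.

Lemma split_sum_swap p u v t a : alternating_form a ->
  split_sum P Q p (u :: v :: t) a = - split_sum P Q p (v :: u :: t) a.
Proof.
move=> alt /=.
have sw X Y p' : split_sum P Q p' t (fun t => a (X :: Y :: t)) =
    - split_sum P Q p' t (fun t => a (Y :: X :: t)).
  rewrite (@split_sum_lin p' t _ (fun t => a (Y :: X :: t)) (fun=> 0) (-1)).
    by rewrite split_sum0 addr0 mulN1r.
  by move=> t' _; rewrite mulN1r addr0; exact: (alt_swap alt [::]).
rewrite (sw (P u) (P v)) (sw (P u) (Q v)) (sw (Q u) (P v)) (sw (Q u) (Q v)).
by rewrite !opprD addrACA.
Qed.

Lemma split_sum_move p s u t a : alternating_form a ->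
  split_sum P Q p (s ++ u :: t) a = (-1) ^+ size s * split_sum P Q p (u :: s ++ t) a.
Proof.
elim: s p a => [|v s IH] p a alt; first by rewrite expr0 mul1r.
rewrite exprS mulN1r mulNr -mulrN -split_sum_swap//.
rewrite cat_cons [in LHS]/= [in RHS]/= -/cat.
rewrite !IH; [|exact: alternating_form_cons..].
by rewrite -mulrDr.
Qed.

(** Once two equal arguments are adjacent and in front, their two mixed projections
    cancel and the two pure ones vanish separately. *)
Lemma split_sum_alternating p : forall a, alternating_form a ->
  alternating_form (fun s => split_sum P Q p s a).
Proof.
move=> a alt; split=> [s t c u v|r s t u]; first exact: split_sum_linear.
elim: r p a alt => [|Z r IH] p' a alt; last first.
  by rewrite /= !IH ?addr0//; exact: alternating_form_cons.
rewrite cat0s [LHS]/= !split_sum_move; [|exact: alternating_form_cons..].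
rewrite -mulrDr /=.
rewrite (@split_sum_eq _ _ _ (fun=> 0)) => [|t' _]; last exact: (alt_repeat alt [::] [::]).
rewrite [X in _ + (_ + X)](@split_sum_eq _ _ _ (fun=> 0)) => [|t' _]; last first.
  exact: (alt_repeat alt [::] [::]).
rewrite !split_sum0 addr0 add0r.
rewrite (@split_sum_lin (p' - 1) (s ++ t) _ (fun t => a (Q u :: P u :: t)) (fun=> 0) (-1)).
  by rewrite split_sum0 addr0 mulN1r addNr mulr0.
by move=> t' _; rewrite mulN1r addr0; exact: (alt_swap alt [::]).
Qed.

End SplitSum.

Lemma proj10E J Z : proj10 J Z = Z *m (2%:R^-1 *: (1%:M - 'i%C *: cmx J)).
Proof. by rewrite -scalemxAr mulmxBr mulmx1 -scalemxAr. Qed.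

Lemma proj01E J Z : proj01 J Z = Z *m (2%:R^-1 *: (1%:M + 'i%C *: cmx J)).
Proof. by rewrite -scalemxAr mulmxDr mulmx1 -scalemxAr. Qed.

Lemma proj10_lin J c u v : proj10 J (c *: u + v) = c *: proj10 J u + proj10 J v.
Proof. by rewrite !proj10E mulmxDl scalemxAl. Qed.

Lemma proj01_lin J c u v : proj01 J (c *: u + v) = c *: proj01 J u + proj01 J v.
Proof. by rewrite !proj01E mulmxDl scalemxAl. Qed.

Lemma type_part_alternating J p q a : alternating_form a ->
  alternating_form (type_part J p q a).
Proof.
move=> alt.
have [lin rep] := split_sum_alternating (@proj10_lin J) (@proj01_lin J) p alt.
split=> [s t c u v|r s t u]; rewrite !type_partE.
  by rewrite !size_cat /=; case: ifP => _; rewrite ?lin// mulr0 addr0.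
by rewrite rep; case: ifP.
Qed.

Lemma type_part_lin J p q a a' c s :
  type_part J p q (fun s => c * a s + a' s) s =
  c * type_part J p q a s + type_part J p q a' s.
Proof.
rewrite !type_partE; case: ifP => _; last by rewrite mulr0 addr0.
exact: split_sum_lin.
Qed.

Lemma type_part_map J J' F p q a s : F *m J' = J *m F ->
  type_part J' p q a [seq Z *m cmx F | Z <- s] =
  type_part J p q (fun t => a [seq Z *m cmx F | Z <- t]) s.
Proof.
move=> FJ; rewrite !type_partE size_map; case: ifP => // _.
have E Z : Z *m cmx F *m cmx J' = Z *m cmx J *m cmx F.
  by rewrite -!mulmxA -!cmxM FJ.
apply: split_sum_map => Z.
  by rewrite /proj10 E -[RHS]scalemxAl mulmxBl -scalemxAl.
by rewrite /proj01 E -[RHS]scalemxAl mulmxDl -scalemxAl.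
Qed.

End TypeParts.

(** * Alternation of the exterior derivative, and forms of too high degree *)

Section AntisymmetricSum.
Context {R : realType} {N : nat}.
Local Notation C := R[i].
Local Notation VC := 'rV[C]_N.
Implicit Types (r s t : seq VC) (u v Z : VC).

Variable B : VC -> seq VC -> C.
Hypothesis B_lin : forall c u v t, B (c *: u + v) t = c * B u t + B v t.
Hypothesis B_alt : forall Z, alternating_form (B Z).

Let E s : C := \sum_(i < size s) (-1) ^+ i * B s`_i (omit i s).

Let E_cat s1 x s2 : E (s1 ++ x :: s2) =
  \sum_(i < size s1) (-1) ^+ i * B s1`_i (omit i s1 ++ x :: s2) +
  ((-1) ^+ size s1 * B x (s1 ++ s2) +
   \sum_(i < size s2) (-1) ^+ (size s1).+1 * ((-1) ^+ i * B s2`_i (s1 ++ x :: omit i s2))).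
Proof.
rewrite /E -(big_mkord xpredT (fun i => (-1) ^+ i * B (s1 ++ x :: s2)`_i (omit i (s1 ++ x :: s2)))).
rewrite size_cat /= (big_cat_nat (n := size s1)) ?leq_addr//=; congr (_ + _).
  rewrite big_mkord; apply: eq_bigr => i _.
  by rewrite nth_cat ltn_ord omit_cat_lt.
rewrite big_ltn; last by rewrite addnS ltnS leq_addr.
rewrite nth_cat ltnn subnn omit_cat_size; congr (_ + _).
rewrite -[(size s1).+1]add0n big_addn addnS subSS addKn big_mkord.
apply: eq_bigr => i _; rewrite mulrA -exprD addnC; congr (_ * _).
rewrite addSnnS nth_cat ltnNge leq_addr /= addKn /=.
by rewrite omit_cat_ge omitS.
Qed.

(** With two equal arguments, only the two terms that distinguish one of them
    survive, and they differ by the sign of a cyclic permutation. *)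
Lemma antisymmetric_sum_alternating : alternating_form E.
Proof.
split=> [s t c u v|r s t u].
  rewrite !E_cat B_lin.
  have -> : \sum_(i < size s) (-1) ^+ i * B s`_i (omit i s ++ (c *: u + v) :: t) =
      c * (\sum_(i < size s) (-1) ^+ i * B s`_i (omit i s ++ u :: t)) +
      \sum_(i < size s) (-1) ^+ i * B s`_i (omit i s ++ v :: t).
    rewrite mulr_sumr -big_split; apply: eq_bigr => i _.
    by rewrite (alt_lin (B_alt _)) mulrDr mulrCA.
  have -> : \sum_(i < size t) (-1) ^+ (size s).+1 *
        ((-1) ^+ i * B t`_i (s ++ (c *: u + v) :: omit i t)) =
      c * (\sum_(i < size t) (-1) ^+ (size s).+1 * ((-1) ^+ i * B t`_i (s ++ u :: omit i t))) +
      \sum_(i < size t) (-1) ^+ (size s).+1 * ((-1) ^+ i * B t`_i (s ++ v :: omit i t)).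
    rewrite mulr_sumr -big_split; apply: eq_bigr => i _.
    by rewrite (alt_lin (B_alt _)) mulrDr [(-1) ^+ i * _]mulrCA mulrDr [_ * (c * _)]mulrCA.
  have regroup (a1 a2 m1 m2 c1 c2 : C) :
      (c * a1 + a2) + ((c * m1 + m2) + (c * c1 + c2)) =
      c * (a1 + (m1 + c1)) + (a2 + (m2 + c2)) by ring.
  by rewrite [(-1) ^+ size s * (_ + _)]mulrDr [_ * (c * B u _)]mulrCA; exact: regroup.
rewrite E_cat big1 => [|i _]; last by rewrite (alt_repeat (B_alt _)) mulr0.
rewrite add0r -mulr_sumr.
have -> : \sum_(i < size (s ++ u :: t))
      (-1) ^+ i * B (s ++ u :: t)`_i (r ++ u :: omit i (s ++ u :: t)) =
    (-1) ^+ size s * B u (r ++ u :: s ++ t).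
  rewrite -(big_mkord xpredT (fun i =>
    (-1) ^+ i * B (s ++ u :: t)`_i (r ++ u :: omit i (s ++ u :: t)))).
  rewrite size_cat /= (big_cat_nat (n := size s)) ?leq_addr//= big_mkord big1 => [|i _]; last first.
    by rewrite omit_cat_lt// (alt_repeat (B_alt _)) mulr0.
  rewrite add0r big_ltn; last by rewrite addnS ltnS leq_addr.
  rewrite nth_cat ltnn subnn omit_cat_size /= big_nat big1 ?addr0// => i /andP[si _].
  have -> : i = (size s + (i - (size s).+1).+1)%N by lia.
  by rewrite omit_cat_ge omitS (alt_repeat (B_alt _)) mulr0.
rewrite (alt_move_in (B_alt u)) exprS; ring.
Qed.

End AntisymmetricSum.

Section ExtDAlternating.
Context {R : realType} {N : nat} (G : lieGroup R N).
Local Notation C := R[i].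
Local Notation VC := 'rV[C]_N.

Lemma local_form_cdiff (w : G -> seq VC -> C) x s : smooth_form w ->
  cdiff (local_form w x s) (coord (lie_atlas G x) x).
Proof. by move=> sw; apply: csmooth_cdiff (sw x s) (image_self x). Qed.

Lemma ext_d_alternating (w : G -> seq VC -> C) x :
  smooth_form w -> (forall x, alternating_form (w x)) -> alternating_form (ext_d w x).
Proof.
move=> sw altw; set y0 := coord (lie_atlas G x) x.
have dw t : cdiff (local_form w x t) y0 by exact: local_form_cdiff.
have altl y := local_form_alternating x y altw.
apply: (@antisymmetric_sum_alternating _ _ (fun Z t => derive_complex (local_form w x t) Z y0)).
  by move=> c u v t; exact: derive_complex_lin.
move=> Z; split=> [s t c u v|r s t u].
  have -> : local_form w x (s ++ (c *: u + v) :: t) =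
      fun y => c * local_form w x (s ++ u :: t) y + local_form w x (s ++ v :: t) y.
    by apply/funext => y; exact: (alt_lin (altl y)).
  rewrite derive_complexD//; last by apply: cdiffM => //; exact: cdiff_cst.
  by rewrite derive_complexM ?derive_complex_cst ?mul0r ?add0r//; exact: cdiff_cst.
have -> : local_form w x (r ++ u :: s ++ u :: t) = fun=> 0.
  by apply/funext => y; exact: (alt_repeat (altl y)).
exact: derive_complex_cst.
Qed.

End ExtDAlternating.

Section TypeBound.
Context {R : realType}.
Local Notation C := R[i].

Lemma alt_dependent N (a : seq 'rV[C]_N -> C) s m (e : 'I_m -> 'I_(size s))
    (c : 'I_m -> C) k0 : alternating_form a -> injective e ->
  \sum_k c k *: s`_(e k) = 0 -> c k0 != 0 -> a s = 0.
Proof.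
move=> alt inj_e dep c0; set i0 := e k0.
have sE : s = take i0 s ++ s`_i0 :: drop i0.+1 s by rewrite -drop_nth// cat_take_drop.
have := alt_zero alt (take i0 s) (drop i0.+1 s).
rewrite -dep (alt_sum alt) (bigD1 k0)//= -sE big1 ?addr0 => [/eqP|k kk].
  by rewrite mulf_eq0 (negPf c0) => /eqP.
have : e k != i0 by apply: contra kk => /eqP/inj_e ->.
rewrite neq_ltn => /orP[lt|lt].
  have : s`_(e k) \in take i0 s.
    by rewrite -(nth_take 0 lt); apply: mem_nth; rewrite size_takel ?lt// ltnW ?ltn_ord.
  by case/splitPr => l1 l2; rewrite -catA (alt_repeat alt) mulr0.
have : s`_(e k) \in drop i0.+1 s.
  rewrite -[X in s`_X](subnKC lt) -nth_drop; apply: mem_nth.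
  rewrite size_drop; have := ltn_ord (e k); move: lt => lt ek.
  by apply: ltn_sub2r => //; exact: leq_ltn_trans lt ek.
by case/splitPr => l1 l2; rewrite (alt_repeat alt) mulr0.
Qed.

Lemma count_card N (P : pred 'rV[C]_N) s :
  count P s = #|[pred i : 'I_(size s) | P s`_i]|.
Proof.
rewrite -sum1_count (big_nth 0) big_mkord -sum1_card.
by apply: eq_bigl => i; rewrite inE.
Qed.

Variables (n : nat) (J : 'M[R]_n.*2).
Hypothesis JJ : J *m J = - 1%:M.
Implicit Types (s : seq 'rV[C]_n.*2) (Z : 'rV[C]_n.*2).

Let B : 'M[C]_n.*2 := cmx J + ('i%C : C)%:M.

(** The spaces of vectors of types (1,0) and (0,1) are exchanged by conjugation, so
    they have the same dimension; and the ranks of [J - i] and [J + i] add up to at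
    least that of their difference [2i]. *)
Lemma rank_vec01 : (\rank (kermx B) <= n)%N.
Proof.
pose B' : 'M[C]_n.*2 := cmx J - ('i%C : C)%:M.
have rB : \rank B' = \rank B.
  have <- : map_mx (@conjc R) B = B'.
    apply/matrixP => i j; rewrite !mxE rmorphD rmorphMn /=.
    by case: (i == j); rewrite ?mulr1n ?mulr0n; apply: complexP;
      rewrite /= ?oppr0 ?addr0 ?add0r.
  exact: mxrank_map.
have : (n.*2 <= \rank B + \rank B')%N.
  rewrite -[\rank B']mxrank_opp; apply: leq_trans (mxrank_add _ _).
  have -> : B - B' = (2%:R * 'i%C : C)%:M.
    by rewrite /B /B' opprD opprK addrACA subrr add0r -raddfD mulr_natl mulr2n.
  rewrite mxrank_unit// unitmxE det_scalar unitfE expf_neq0//.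
  rewrite mulf_neq0 ?pnatr_eq0//; apply/eqP => /(congr1 (@complex.Im R))/eqP.
  by rewrite /= oner_eq0.
rewrite rB mxrank_ker; lia.
Qed.

Lemma vec01_kermx Z : vec01 J Z -> (Z <= kermx B)%MS.
Proof. by move=> /eqP ZJ; apply/sub_kermxP; rewrite mulmxDr ZJ mul_mx_scalar scaleNr addNr. Qed.

(** More than [n] vectors of type (0,1) are linearly dependent. *)
Lemma alternating_vec01 (a : seq 'rV[C]_n.*2 -> C) s : alternating_form a ->
  (n < count (vec01 J) s)%N -> a s = 0.
Proof.
move=> alt; rewrite count_card; set S := [pred i | _] => nS.
pose e (k : 'I_#|S|) : 'I_(size s) := enum_val k.
pose M : 'M[C]_(#|S|, n.*2) := \matrix_(k < #|S|) s`_(e k).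
have rM : (\rank M <= n)%N.
  apply: leq_trans rank_vec01; apply: mxrankS; apply/row_subP => k.
  by rewrite rowK; apply: vec01_kermx; have := enum_valP k; rewrite inE.
have : kermx M != 0.
  by rewrite -mxrank_eq0 mxrank_ker subn_eq0 -ltnNge (leq_ltn_trans rM).
case/rowV0Pn => c /sub_kermxP cM /rV0Pn[k0 ck0].
apply: (alt_dependent (e := e) alt (@enum_val_inj _ S) _ ck0).
apply: (etrans _ cM); apply/rowP => j; rewrite summxE [RHS]mxE.
by apply: eq_bigr => k _; rewrite !mxE.
Qed.

Lemma proj01_vec01 Z : vec01 J (proj01 J Z).
Proof.
apply/eqP; rewrite proj01E -!mulmxA -scalemxAl mulmxDl mul1mx -scalemxAl -cmxM JJ.
have -> : cmx (- 1%:M : 'M[R]_n.*2) = - 1%:M by rewrite /cmx map_mxN map_mx1.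
rewrite [RHS]scalemxAr scalerA [_ * 2^-1]mulrC -scalerA; congr (_ *m (_ *: _)).
by rewrite scalerDr scalerA mulNr mul_ii opprK scale1r addrC scalerN scaleNr.
Qed.

Lemma count_proj01 (b : seq bool) s : size b = size s ->
  (count negb b <=
   count (vec01 J) [seq (if z.1 then proj10 J z.2 else proj01 J z.2) | z <- zip b s])%N.
Proof.
elim: b s => [|x b IH] [|Z s] //= [bs].
by apply: leq_add; [case: x => //=; rewrite proj01_vec01|exact: IH].
Qed.

Lemma type_part_vec01 p q (a : seq 'rV[C]_n.*2 -> C) : alternating_form a ->
  (n%:Z < q) -> type_part J p q a = 0.
Proof.
move=> alt nq; apply/funext => s; rewrite /type_part; case: eqP => // sE.
rewrite big1// => b /eqP bE; apply: alternating_vec01 => //.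
have : (count negb b <= count (vec01 J)
    [seq (if z.1 then proj10 J z.2 else proj01 J z.2) | z <- zip b s])%N.
  by apply: count_proj01; rewrite size_tuple.
apply: leq_trans.
have bC : (count id b + count negb b)%N = size s.
  by rewrite -[RHS](size_tuple b); exact: count_predC.
move: (count id b) (count negb b) bE bC sE nq => k k' <- <-; rewrite PoszD.
by move=> /addrI <-.
Qed.

End TypeBound.

(** * Invariant forms *)

Lemma map_mulmx_comp (K : pzRingType) (m n k : nat) (M : 'M[K]_(m, n)) (M' : 'M[K]_(n, k))
    (s : seq 'rV[K]_m) :
  [seq Z *m M' | Z <- [seq Z *m M | Z <- s]] = [seq Z *m (M *m M') | Z <- s].
Proof. by rewrite -map_comp; apply: eq_map => Z /=; rewrite mulmxA. Qed.

Section FrameFacts.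
Context {R : realType} {N : nat} (G : lieGroup R N).
Local Notation A := (lie_atlas G).
Local Notation C := R[i].
Local Notation V := 'rV[R]_N.
Local Notation VC := 'rV[C]_N.
Local Notation b0 := (base_point G).
Implicit Types (w : G -> seq VC -> C) (x g : G) (a : seq VC -> C) (J : 'M[R]_N).
Implicit Types (p q : int) (s t : seq VC).

Lemma frame_atE x : frame_at x = jac_ltrans x 1%g x b0.
Proof. by rewrite /frame_at /frame chart_coordK//; exact: dom_self. Qed.

Lemma frame_at_unit x : frame_at x \in unitmx.
Proof. by apply: frame_unit; exact: image_self. Qed.

Lemma tangent_ltrans1 x : tangent A A (ltrans (G := G) x) 1%g = frame_at x.
Proof.
rewrite frame_atE -[RHS](_ : jac_ltrans x 1%g (x * 1)%g b0 = _); last by rewrite mulg1.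
by [].
Qed.

Lemma coord_mul_base x : coord (A x) (x * param (A 1%g) b0)%g = coord (A x) x.
Proof. by rewrite param_base mulg1. Qed.

Lemma dom_mul_base x : dom (A x) (x * param (A 1%g) b0)%g.
Proof. by rewrite param_base mulg1; exact: dom_self. Qed.

Lemma frame_at_ltrans g x :
  frame_at (g * x)%g = frame_at x *m tangent A A (ltrans (G := G) g) x.
Proof.
have d2 : dom (A (g * x)%g) (g * (x * param (A 1%g) b0))%g.
  by rewrite param_base mulg1; exact: dom_self.
have := jac_ltransM (base_image G) (dom_mul_base x) d2.
by rewrite coord_mul_base -!frame_atE.
Qed.

Lemma tangent_ltransV x :
  tangent A A (ltrans (G := G) (x^-1)%g) x = invmx (frame_at x).
Proof.
have E : frame_at x *m tangent A A (ltrans (G := G) (x^-1)%g) x = 1%:M.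
  by rewrite -frame_at_ltrans mulVg; exact: frame_base.
by rewrite -[LHS](mulKmx (frame_at_unit x)) E mulmx1.
Qed.

Lemma J_atE J x : J_at J x = invmx (frame_at x) *m J *m frame_at x.
Proof. by rewrite /J_at tangent_ltransV tangent_ltrans1. Qed.

Lemma frame_J_at J x : frame_at x *m J_at J x = J *m frame_at x.
Proof. by rewrite J_atE !mulmxA mulmxV ?mul1mx// frame_at_unit. Qed.

(* Unification must not unfold these while it compares coefficients. *)
Local Opaque derive jacobian jac_ltrans frame frame_at.

Definition at_frame x s : seq VC := [seq Z *m cmx (frame_at x) | Z <- s].

Lemma cmx_invmx (M : 'M[R]_N) : cmx (invmx M) = invmx (cmx M).
Proof. exact: map_invmx. Qed.

Lemma cmx_frame_unit x : cmx (frame_at x) \in unitmx.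
Proof. by rewrite map_unitmx frame_at_unit. Qed.

Lemma size_at_frame x s : size (at_frame x s) = size s.
Proof. exact: size_map. Qed.

Lemma at_frameK x s : at_frame x [seq Z *m cmx (invmx (frame_at x)) | Z <- s] = s.
Proof.
rewrite /at_frame -map_comp -[RHS]map_id; apply: eq_map => Z /=.
by rewrite cmx_invmx mulmxKV// cmx_frame_unit.
Qed.

Lemma frame_atK x s : [seq Z *m cmx (invmx (frame_at x)) | Z <- at_frame x s] = s.
Proof.
rewrite /at_frame -map_comp -[RHS]map_id; apply: eq_map => Z /=.
by rewrite cmx_invmx mulmxK// cmx_frame_unit.
Qed.

(** The frame carries [J] to the structure [J_at J x] of the tangent space at [x]. *)
Lemma type_part_at_frame J p q a x s :
  type_part (J_at J x) p q a (at_frame x s) =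
  type_part J p q (fun t => a (at_frame x t)) s.
Proof. exact: type_part_map (frame_J_at J x). Qed.

Lemma mulmx_inj_eq n (Z Z' : 'rV[C]_n) (M : 'M[C]_n) : M \in unitmx ->
  (Z *m M == Z' *m M) = (Z == Z').
Proof.
by move=> uM; apply/eqP/eqP => [ZZ|->//]; rewrite -(mulmxK uM Z) ZZ mulmxK.
Qed.

Lemma cmx_frame_J_at J x : cmx (frame_at x) *m cmx (J_at J x) = cmx J *m cmx (frame_at x).
Proof. by rewrite -!cmxM frame_J_at. Qed.

Lemma vec10_frame J x Z : vec10 (J_at J x) (Z *m cmx (frame_at x)) = vec10 J Z.
Proof.
rewrite /vec10 -mulmxA cmx_frame_J_at mulmxA scalemxAl mulmx_inj_eq//.
exact: cmx_frame_unit.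
Qed.

Lemma vec01_frame J x Z : vec01 (J_at J x) (Z *m cmx (frame_at x)) = vec01 J Z.
Proof.
rewrite /vec01 -mulmxA cmx_frame_J_at mulmxA scalemxAl mulmx_inj_eq//.
exact: cmx_frame_unit.
Qed.

Lemma all_at_frame J x s :
  all [pred Z | vec10 (J_at J x) Z || vec01 (J_at J x) Z] (at_frame x s) =
  all [pred Z | vec10 J Z || vec01 J Z] s.
Proof.
have E Z := congr2 orb (vec10_frame J x Z) (vec01_frame J x Z).
exact: etrans (all_map _ _ _) (eq_all E s).
Qed.

Lemma count_at_frame J x s : count (vec10 (J_at J x)) (at_frame x s) = count (vec10 J) s.
Proof. exact: etrans (count_map _ _ _) (eq_count (vec10_frame J x) s). Qed.

Lemma has_type_frame J p q a x :
  has_type J p q (fun s => a (at_frame x s)) <-> has_type (J_at J x) p q a.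
Proof.
split=> [[H1 H2]|[H1 H2]]; split=> s.
- have := H1 [seq Z *m cmx (invmx (frame_at x)) | Z <- s].
  by rewrite size_map at_frameK.
- rewrite -(at_frameK x s) all_at_frame count_at_frame => alls cs.
  exact: H2.
- by move: (H1 (at_frame x s)); rewrite size_at_frame.
- move: (H2 (at_frame x s)); rewrite all_at_frame count_at_frame.
  exact.
Qed.

Lemma coefE w s x : coef w s x = w x (at_frame x s). Proof. by []. Qed.

Lemma at_frame_alternating a x : alternating_form a -> alternating_form (fun s => a (at_frame x s)).
Proof. exact: alternating_form_map. Qed.

Lemma invariant_formE a x s :
  invariant_form a x s = a [seq Z *m cmx (invmx (frame_at x)) | Z <- s].
Proof. by rewrite /invariant_form tangent_ltransV. Qed.

Lemma invariant_form_at_frame a x s : invariant_form a x (at_frame x s) = a s.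
Proof. by rewrite invariant_formE frame_atK. Qed.

Lemma invariant_form_alternating a x : alternating_form a ->
  alternating_form (invariant_form (G := G) a x).
Proof.
move=> alt; have -> : invariant_form (G := G) a x =
    fun s => a [seq Z *m cmx (invmx (frame_at x)) | Z <- s].
  by apply/funext => s; exact: invariant_formE.
exact: alternating_form_map.
Qed.

Lemma invariant_form_smooth a : alternating_form a -> smooth_form (invariant_form (G := G) a).
Proof.
move=> alt x s.
have oI := @chart_image_open _ _ G x.
suff H : csmooth (chart_image (A x)) (local_form (invariant_form (G := G) a) x s) by [].
apply: (csmooth_eq oI (f := fun y => a [seq Z *m cmx (invmx (frame x y)) | Z <- s])).
  move=> y xy; set K := jac_ltrans 1%g x (param (A x) y) y.
  have E : K *m invmx (frame_at (param (A x) y)) = invmx (frame x y).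
    have uK : K \in unitmx by apply: jac_ltrans_unit => //; rewrite mul1g; exact: dom_self.
    have uF := frame_unit xy.
    have := frame_at_param xy; rewrite -/K.
    move: K (frame x y) (frame_at _) uK uF => K F FK uK uF ->.
    have uFK : F *m K \in unitmx by rewrite unitmx_mul uF.
    apply: (can_inj (mulmxK uFK)).
    by rewrite mulmxKV// mulmxA mulVmx// mul1mx.
  have Es : [seq Z *m cmx (invmx (frame_at (param (A x) y))) | Z <- [seq Z *m cmx K | Z <- s]] =
      [seq Z *m cmx (invmx (frame x y)) | Z <- s].
    by apply: (etrans (map_mulmx_comp _ _ _)); rewrite -cmxM E.
  exact: esym (etrans (local_formE _ _ _ _) (etrans (invariant_formE _ _ _) (congr1 a Es))).
apply: (csmooth_multilinear (W := fun t _ => a t)) => //.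
- by move=> t; exact: csmooth_cst.
- apply: smooth_invmx => // [y xy|i j]; first exact: frame_unit.
  exact: frame_smooth.
Qed.

Lemma alg_forms_invariant (Gamma : subgroup G) J p q a : alg_forms J p q a ->
  forms Gamma J p q (invariant_form a).
Proof.
move=> [alt ty]; split; first exact: invariant_form_smooth.
  move=> g _; apply/funext => x; apply/funext => s.
  have E : tangent A A (ltrans (G := G) g) x *m invmx (frame_at (g * x)%g) =
      invmx (frame_at x).
    have := frame_at_unit (g * x)%g; have := frame_at_unit x; rewrite frame_at_ltrans.
    move: (tangent _ _ _ _) (frame_at x) => T F uF uFT.
    apply: (can_inj (mulmxK uFT)).
    by rewrite mulmxKV// mulmxA mulVmx// mul1mx.
  have Es : [seq Z *m cmx (invmx (frame_at (g * x)%g)) |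
        Z <- [seq Z *m cmx (tangent A A (ltrans (G := G) g) x) | Z <- s]] =
      [seq Z *m cmx (invmx (frame_at x)) | Z <- s].
    by apply: (etrans (map_mulmx_comp _ _ _)); rewrite -cmxM E.
  apply: (etrans (invariant_formE _ _ _)); apply: (etrans (congr1 a Es)).
  exact/esym/invariant_formE.
move=> x; split; first exact: invariant_form_alternating.
have E : (fun s => invariant_form a x (at_frame x s)) = a.
  by apply/funext => s; exact: invariant_form_at_frame.
exact: (has_type_frame J p q (invariant_form a x) x).1 (eq_ind_r (has_type J p q) ty E).
Qed.

(** The coefficients being constant, only the algebraic part of the formula of
    Cartan remains. *)
Lemma ext_d_invariant a x s : alternating_form a ->
  ext_d (invariant_form a) x (at_frame x s) = ce_d G a s.
Proof.
move=> alt; rewrite ext_d_frame; last 2 first.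
- exact: invariant_form_smooth.
- by move=> z; exact: invariant_form_alternating.
have cE t : coef (invariant_form (G := G) a) t = fun=> a t.
  by apply/funext => z; rewrite coefE invariant_form_at_frame.
rewrite big1 ?add0r => [|i _].
  by rewrite /ce_d; under eq_bigr do under eq_bigr do rewrite cE.
by rewrite cE; apply: (etrans (congr1 _ (derive_complex_cst _ _ _))); rewrite mulr0.
Qed.

(** Alternation is inherited from the exterior derivative on the group. *)
Lemma ce_d_alternating a : alternating_form a -> alternating_form (ce_d G a).
Proof.
move=> alt; have -> : ce_d G a = fun s => ext_d (invariant_form a) (1%g : G) (at_frame (1%g : G) s).
  by apply/funext => s; rewrite ext_d_invariant.
apply: at_frame_alternating; apply: ext_d_alternating; first exact: invariant_form_smooth.
by move=> x; exact: invariant_form_alternating.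
Qed.

Lemma type_part_invariant J p q a x s : alternating_form a ->
  type_part (J_at J x) p q (ext_d (invariant_form a) x) s =
  invariant_form (type_part J p q (ce_d G a)) x s.
Proof.
move=> alt; rewrite invariant_formE -{1}(at_frameK x s) type_part_at_frame.
by congr (type_part J p q _ _); apply/funext => t; exact: ext_d_invariant.
Qed.

Lemma dbar_invariant J p q a : alternating_form a ->
  dbar (G := G) J p q (invariant_form a) = invariant_form (alg_dbar G J p q a).
Proof. by move=> alt; apply/funext => x; apply/funext => s; exact: type_part_invariant. Qed.

Lemma del_invariant J p q a : alternating_form a ->
  del (G := G) J p q (invariant_form a) = invariant_form (alg_del G J p q a).
Proof. by move=> alt; apply/funext => x; apply/funext => s; exact: type_part_invariant. Qed.

End FrameFacts.

(** * Averaging forms over the group *)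

Section ComplexMean.
Context {R : realType} (T : groupType) (I : @invariant_mean R T).
Local Notation C := R[i].
Local Notation Re := (@complex.Re R).
Local Notation Im := (@complex.Im R).
Implicit Types (f g : T -> C) (c : C).

Definition cbounded f : Prop := bounded_fct (Re \o f) /\ bounded_fct (Im \o f).

Definition cmean f : C := Complex (I (Re \o f)) (I (Im \o f)).

Lemma cbounded_cst c : cbounded (fun=> c).
Proof. by split; exact: bounded_fct_cst. Qed.

Lemma cboundedD f g : cbounded f -> cbounded g -> cbounded (fun x => f x + g x).
Proof.
move=> [fr fi] [gr gi]; split.
  have -> : Re \o (fun x => f x + g x) = fun x => (Re \o f) x + (Re \o g) x.
    by apply/funext => x /=; rewrite ReD.
  exact: bounded_fctD.
have -> : Im \o (fun x => f x + g x) = fun x => (Im \o f) x + (Im \o g) x.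
  by apply/funext => x /=; rewrite ImD.
exact: bounded_fctD.
Qed.

Let ReZ c f : Re \o (fun x => c * f x) =
  fun x => Re c * (Re \o f) x + - Im c * (Im \o f) x.
Proof. by apply/funext => x /=; rewrite ReM mulNr. Qed.

Let ImZ c f : Im \o (fun x => c * f x) =
  fun x => Re c * (Im \o f) x + Im c * (Re \o f) x.
Proof. by apply/funext => x /=; rewrite ImM. Qed.

Lemma cboundedZ c f : cbounded f -> cbounded (fun x => c * f x).
Proof.
by move=> [fr fi]; split; rewrite ?ReZ ?ImZ; apply: bounded_fctD; exact: bounded_fctZ.
Qed.

Lemma cmean_cst c : cmean (fun=> c) = c.
Proof. by apply: complexP; exact: mean_cst. Qed.

Lemma cmeanD f g : cbounded f -> cbounded g ->
  cmean (fun x => f x + g x) = cmean f + cmean g.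
Proof.
move=> [fr fi] [gr gi]; rewrite /cmean.
have -> : Re \o (fun x => f x + g x) = fun x => (Re \o f) x + (Re \o g) x.
  by apply/funext => x /=; rewrite ReD.
have -> : Im \o (fun x => f x + g x) = fun x => (Im \o f) x + (Im \o g) x.
  by apply/funext => x /=; rewrite ImD.
by rewrite !meanD.
Qed.

Lemma cmeanZ c f : cbounded f -> cmean (fun x => c * f x) = c * cmean f.
Proof.
move=> [fr fi]; have bz k : bounded_fct (fun x => k * (Re \o f) x) by exact: bounded_fctZ.
have bz' k : bounded_fct (fun x => k * (Im \o f) x) by exact: bounded_fctZ.
rewrite /cmean ReZ ImZ !meanD// !meanZ//; apply: complexP.
  by rewrite ReM /= mulNr.
by rewrite ImM.
Qed.

Lemma cbounded_sum (K : Type) (r : seq K) (P : pred K) (F : K -> T -> C) :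
  (forall k, cbounded (F k)) -> cbounded (fun x => \sum_(k <- r | P k) F k x).
Proof.
move=> bF; elim: r => [|k r IH].
  by under eq_fun do rewrite big_nil; exact: cbounded_cst.
by under eq_fun do rewrite big_cons; case: (P k) => //; exact: cboundedD.
Qed.

Lemma cmean_sum (K : Type) (r : seq K) (P : pred K) (F : K -> T -> C) :
  (forall k, cbounded (F k)) ->
  cmean (fun x => \sum_(k <- r | P k) F k x) = \sum_(k <- r | P k) cmean (F k).
Proof.
move=> bF; elim: r => [|k r IH].
  by under eq_fun do rewrite big_nil; rewrite big_nil cmean_cst.
under eq_fun do rewrite big_cons; rewrite big_cons; case: (P k) => //.
by rewrite cmeanD// ?IH//; exact: cbounded_sum.
Qed.

Lemma cmean_conj f : cbounded f -> cmean (fun x => (f x)^*%C) = (cmean f)^*%C.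
Proof.
move=> [_ bi].
have E : Im \o (fun x => (f x)^*%C) = fun x => -1 * (Im \o f) x.
  by apply/funext => x /=; case: (f x) => a b /=; rewrite mulN1r.
have E' : Re \o (fun x => (f x)^*%C) = Re \o f.
  by apply/funext => x /=; case: (f x).
apply: complexP; first exact: (congr1 I E').
exact: (etrans (congr1 I E) (etrans (meanZ I (-1) bi) (mulN1r _))).
Qed.

End ComplexMean.

Lemma conjV_cmx (R : realType) N (Z : 'rV[R[i]]_N) (M : 'M[R]_N) :
  conjV (Z *m cmx M) = conjV Z *m cmx M.
Proof.
rewrite /conjV map_mxM; congr (_ *m _); apply/matrixP => i j; rewrite !mxE /=.
by rewrite oppr0.
Qed.

Section Averaging.
Context {R : realType} {N : nat} (G : lieGroup R N) (Gamma : subgroup G) (J : 'M[R]_N).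
Hypothesis lat : is_lattice Gamma.
Variable I : @invariant_mean R G.
Local Notation A := (lie_atlas G).
Local Notation C := R[i].
Local Notation VC := 'rV[C]_N.
Implicit Types (w : G -> seq VC -> C) (x g : G) (a : seq VC -> C).
Implicit Types (p q : int) (s t : seq VC) (Z : VC).

Definition cinvariant_fct (f : G -> C) : Prop :=
  forall g x, subgroup_set Gamma g -> f (g * x)%g = f x.

Lemma cinvariant_bounded f : csmooth_fct f -> cinvariant_fct f -> cbounded f.
Proof.
move=> [sr si] fG; split; [apply: (invariant_bounded lat sr)|apply: (invariant_bounded lat si)];
  by move=> g x Gg /=; rewrite fG.
Qed.

Lemma coef_invariant w s : (forall g, subgroup_set Gamma g -> pullback (ltrans (G := G) g) w = w) ->
  cinvariant_fct (coef w s).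
Proof.
move=> inv g x Gg; rewrite !coefE -[in RHS](inv g Gg) /pullback.
have E : at_frame (g * x)%g s =
    [seq Z *m cmx (tangent A A (ltrans (G := G) g) x) | Z <- at_frame x s].
  by apply: (etrans _ (esym (map_mulmx_comp _ _ _))); rewrite -cmxM -frame_at_ltrans.
exact: (congr1 (w (g * x)%g) E).
Qed.

Section LieDerivC.
Variable f : G -> C.
Hypotheses (sf : csmooth_fct f) (fG : cinvariant_fct f).

Let fr : smooth_fct (@complex.Re R \o f) := proj1 sf.
Let fi : smooth_fct (@complex.Im R \o f) := proj2 sf.
Let frG : left_invariant_fct Gamma (@complex.Re R \o f).
Proof. by move=> g x Gg /=; rewrite fG. Qed.
Let fiG : left_invariant_fct Gamma (@complex.Im R \o f).
Proof. by move=> g x Gg /=; rewrite fG. Qed.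

Let lrE v : (fun x => derive_real (f \o ltrans (G := G) x \o param (A 1%g)) v (base_point G)) =
  (fun x => Complex (lie_derive v (@complex.Re R \o f) x) (lie_derive v (@complex.Im R \o f) x)).
Proof. by []. Qed.

Let br v : cbounded (fun x =>
  derive_real (f \o ltrans (G := G) x \o param (A 1%g)) v (base_point G)).
Proof.
rewrite lrE; split; first exact: (lie_derive_bounded lat v fr frG).
exact: (lie_derive_bounded lat v fi fiG).
Qed.

Lemma lie_deriveC_bounded Z : cbounded (lie_deriveC Z f).
Proof. by apply: cboundedD; [exact: br|apply: cboundedZ; exact: br]. Qed.

Lemma cmean_lie_deriveC Z : cmean I (lie_deriveC Z f) = 0.
Proof.
have m0 v : cmean I (fun x =>
    derive_real (f \o ltrans (G := G) x \o param (A 1%g)) v (base_point G)) = 0.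
  apply: complexP; first exact: (mean_lie_derive lat I v fr frG).
  exact: (mean_lie_derive lat I v fi fiG).
rewrite /lie_deriveC /derive_complex cmeanD; [|exact: br|apply: cboundedZ; exact: br].
by rewrite cmeanZ ?m0 ?mulr0 ?addr0//; exact: br.
Qed.

End LieDerivC.

(** Averaging the coefficients in the left-invariant frame symmetrizes a form. *)
Definition average_form w s : C := cmean I (coef w s).

Section OneForm.
Variables (p q : int) (w : G -> seq VC -> C).
Hypothesis fw : forms Gamma J p q w.

Let sw : smooth_form w. Proof. by case: fw. Qed.
Let invw : forall g, subgroup_set Gamma g -> pullback (ltrans (G := G) g) w = w.
Proof. by case: fw. Qed.
Let altw x : alternating_form (w x). Proof. by case: fw => _ _ /(_ x) []. Qed.
Let tyw x : has_type (J_at J x) p q (w x). Proof. by case: fw => _ _ /(_ x) []. Qed.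
Let scoef s : csmooth_fct (coef w s). Proof. exact: coef_smooth. Qed.

Lemma coef_bounded s : cbounded (coef w s).
Proof. by apply: cinvariant_bounded; [exact: scoef|exact: coef_invariant]. Qed.

Let altc x := at_frame_alternating x (altw x).

Lemma average_form_alternating : alternating_form (average_form w).
Proof.
split=> [s t c u v|r s t u]; rewrite /average_form.
  have -> : coef w (s ++ (c *: u + v) :: t) =
      fun x => c * coef w (s ++ u :: t) x + coef w (s ++ v :: t) x.
    by apply/funext => x; exact: (alt_lin (altc x)).
  rewrite cmeanD; [|by apply: cboundedZ; exact: coef_bounded|exact: coef_bounded].
  by rewrite cmeanZ//; exact: coef_bounded.
have -> : coef w (r ++ u :: s ++ u :: t) = fun=> 0.
  by apply/funext => x; exact: (alt_repeat (altc x)).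
exact: cmean_cst.
Qed.

Lemma average_form_type : has_type J p q (average_form w).
Proof.
have ty x := (has_type_frame J p q (w x) x).2 (tyw x).
split=> [s ss|s alls cs]; rewrite /average_form.
  have -> : coef w s = fun=> 0 by apply/funext => x; exact: (ty x).1.
  exact: cmean_cst.
have -> : coef w s = fun=> 0 by apply/funext => x; exact: (ty x).2.
exact: cmean_cst.
Qed.

Lemma average_alg_forms : alg_forms J p q (average_form w).
Proof. by split; [exact: average_form_alternating|exact: average_form_type]. Qed.

Let ext_dE x s : ext_d w x (at_frame x s) =
  \sum_(i < size s) (-1) ^+ i * lie_deriveC s`_i (coef w (omit i s)) x +
  ce_d G (fun t => coef w t x) s := ext_d_frame x s sw altw.

Let bounded_lie s : cbounded (fun x =>
  \sum_(i < size s) (-1) ^+ i * lie_deriveC s`_i (coef w (omit i s)) x).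
Proof.
apply: cbounded_sum => i; apply: cboundedZ; apply: lie_deriveC_bounded.
  exact: scoef.
exact: coef_invariant.
Qed.

Let bounded_ce s : cbounded (fun x => ce_d G (fun t => coef w t x) s).
Proof.
rewrite /ce_d; apply: cbounded_sum => i; apply: cbounded_sum => j.
by apply: cboundedZ; exact: coef_bounded.
Qed.

Lemma ext_d_coef_bounded s : cbounded (fun x => ext_d w x (at_frame x s)).
Proof. by under eq_fun do rewrite ext_dE; exact: cboundedD. Qed.

(** In the formula of Cartan the derivatives of the coefficients have mean zero, and
    the algebraic part is linear in the coefficients. *)
Lemma average_ext_d s : cmean I (fun x => ext_d w x (at_frame x s)) = ce_d G (average_form w) s.
Proof.
have bl Z t : cbounded (lie_deriveC Z (coef w t)).
  by apply: lie_deriveC_bounded; [exact: scoef|exact: coef_invariant].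
under eq_fun do rewrite ext_dE; rewrite cmeanD// cmean_sum => [|i]; last first.
  exact: cboundedZ.
rewrite [X in X + _]big1 ?add0r => [|i _]; last first.
  apply: (etrans (cmeanZ _ _ (bl _ _))).
  by rewrite (cmean_lie_deriveC (scoef _) (coef_invariant _ invw)) mulr0.
rewrite /ce_d cmean_sum => [|i]; last first.
  by apply: cbounded_sum => j; apply: cboundedZ; exact: coef_bounded.
apply: eq_bigr => i _; rewrite cmean_sum => [|j]; last by apply: cboundedZ; exact: coef_bounded.
by apply: eq_bigr => j _; rewrite cmeanZ//; exact: coef_bounded.
Qed.

Lemma average_type_part p' q' :
  average_form (fun x => type_part (J_at J x) p' q' (ext_d w x)) =
  type_part J p' q' (ce_d G (average_form w)).
Proof.
apply/funext => s; rewrite /average_form.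
have -> : coef (fun x => type_part (J_at J x) p' q' (ext_d w x)) s =
    fun x => type_part J p' q' (fun t => ext_d w x (at_frame x t)) s.
  by apply/funext => x; exact: type_part_at_frame.
rewrite /type_part; case: ifP => _; last exact: cmean_cst.
rewrite cmean_sum => [|b]; last exact: ext_d_coef_bounded.
by apply: eq_bigr => b _; exact: average_ext_d.
Qed.

Lemma average_dbar : average_form (dbar J p q w) = alg_dbar G J p q (average_form w).
Proof. exact: average_type_part. Qed.

Lemma average_del : average_form (del J p q w) = alg_del G J p q (average_form w).
Proof. exact: average_type_part. Qed.

Lemma average_real : (forall x, real_form (w x)) -> real_form (average_form w).
Proof.
move=> rw s; rewrite /average_form.
have -> : coef w (map conjV s) = fun x => (coef w s x)^*%C.
  apply/funext => x; rewrite !coefE -rw; congr (w x _).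
  rewrite /at_frame -!map_comp; apply: eq_map => Z.
  exact/esym/conjV_cmx.
by apply: cmean_conj; exact: coef_bounded.
Qed.

End OneForm.

Lemma average_invariant a : average_form (invariant_form a) = a.
Proof.
apply/funext => s; rewrite /average_form.
have -> : coef (invariant_form (G := G) a) s = fun=> a s.
  by apply/funext => x; exact: invariant_form_at_frame.
exact: cmean_cst.
Qed.

End Averaging.

(** * The weak lemma on the nilmanifold *)

Section FormsLinear.
Context {R : realType} {N : nat} (G : lieGroup R N) (Gamma : subgroup G) (J : 'M[R]_N).
Local Notation C := R[i].
Local Notation VC := 'rV[C]_N.
Implicit Types (w : G -> seq VC -> C) (x g : G) (a : seq VC -> C) (c : C) (p q : int).

Lemma alternating_form_lin a a' c : alternating_form a -> alternating_form a' ->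
  alternating_form (fun s => c * a s + a' s).
Proof.
move=> alt alt'; split=> [s t k u v|r s t u].
  by rewrite (alt_lin alt) (alt_lin alt') !mulrDr [c * (k * _)]mulrCA addrACA.
by rewrite (alt_repeat alt) (alt_repeat alt') mulr0 addr0.
Qed.

Lemma has_type_lin K p q a a' c : has_type K p q a -> has_type K p q a' ->
  has_type K p q (fun s => c * a s + a' s).
Proof.
move=> [h1 h2] [h1' h2']; split=> s.
  by move=> ss; rewrite h1// h1'// mulr0 addr0.
by move=> alls cs; rewrite h2// h2'// mulr0 addr0.
Qed.

Definition lin_field c w w' : G -> seq VC -> C := fun x s => c * w x s + w' x s.

Lemma smooth_form_lin c w w' : smooth_form w -> smooth_form w' ->
  smooth_form (lin_field c w w').
Proof.
move=> sw sw' x s; have oI := @chart_image_open _ _ G x.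
have : csmooth (chart_image (lie_atlas G x))
    (fun y => c * local_form w x s y + local_form w' x s y).
  exact: csmoothD oI (csmoothM oI (csmooth_cst _ c) (sw x s)) (sw' x s).
exact.
Qed.

Lemma forms_lin p q c w w' : forms Gamma J p q w -> forms Gamma J p q w' ->
  forms Gamma J p q (lin_field c w w').
Proof.
move=> [sw iw tw] [sw' iw' tw']; split; first exact: smooth_form_lin.
  move=> g Gg; have E := iw g Gg; have E' := iw' g Gg.
  apply/funext => x; apply/funext => s.
  have H := congr1 (fun f => f x s) E; have H' := congr1 (fun f => f x s) E'.
  exact: (congr2 (fun z z' => c * z + z') H H').
move=> x; have [al ty] := tw x; have [al' ty'] := tw' x.
by split; [exact: alternating_form_lin|exact: has_type_lin].
Qed.

Lemma forms0 p q : forms Gamma J p q (fun _ _ => 0).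
Proof.
split=> [x s|g _|x]; first exact: (csmooth_cst _ (0 : C)).
  by apply/funext => x; apply/funext => s.
split; last by split.
by split=> [s t k u v|//]; rewrite mulr0 addr0.
Qed.

Lemma ext_d_lin c w w' x s : smooth_form w -> smooth_form w' ->
  ext_d (lin_field c w w') x s = c * ext_d w x s + ext_d w' x s.
Proof.
move=> sw sw'; rewrite /ext_d mulr_sumr -big_split; apply: eq_bigr => i _ /=.
set y0 := coord _ _; set t := omit i s.
have dw : cdiff (local_form w x t) y0 := local_form_cdiff x t sw.
have dw' : cdiff (local_form w' x t) y0 := local_form_cdiff x t sw'.
have -> : derive_complex (local_form (lin_field c w w') x t) s`_i y0 =
    c * derive_complex (local_form w x t) s`_i y0 + derive_complex (local_form w' x t) s`_i y0.
  have H := derive_complexD s`_i (cdiffM (cdiff_cst c y0) dw) dw'.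
  apply: (etrans H); congr (_ + _).
  apply: (etrans (derive_complexM _ (cdiff_cst c y0) dw)).
  by rewrite derive_complex_cst mul0r add0r.
by rewrite mulrDr mulrCA.
Qed.

Lemma del_lin p q c w w' : smooth_form w -> smooth_form w' ->
  del J p q (lin_field c w w') = lin_field c (del J p q w) (del J p q w').
Proof.
move=> sw sw'; apply/funext => x; apply/funext => s.
have E : ext_d (lin_field c w w') x = fun s => c * ext_d w x s + ext_d w' x s.
  by apply/funext => t; exact: ext_d_lin.
by rewrite /del E; exact: type_part_lin.
Qed.

Lemma dbar_lin p q c w w' : smooth_form w -> smooth_form w' ->
  dbar J p q (lin_field c w w') = lin_field c (dbar J p q w) (dbar J p q w').
Proof.
move=> sw sw'; apply/funext => x; apply/funext => s.
have E : ext_d (lin_field c w w') x = fun s => c * ext_d w x s + ext_d w' x s.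
  by apply/funext => t; exact: ext_d_lin.
by rewrite /dbar E; exact: type_part_lin.
Qed.

Lemma ce_d_lin c a a' s :
  ce_d G (fun s => c * a s + a' s) s = c * ce_d G a s + ce_d G a' s.
Proof.
rewrite /ce_d mulr_sumr -big_split; apply: eq_bigr => i _ /=.
rewrite mulr_sumr -big_split; apply: eq_bigr => j _ /=.
by rewrite mulrDr mulrCA.
Qed.

Lemma alg_del_lin p q c a a' s :
  alg_del G J p q (fun s => c * a s + a' s) s = c * alg_del G J p q a s + alg_del G J p q a' s.
Proof.
have E : ce_d G (fun s => c * a s + a' s) = fun s => c * ce_d G a s + ce_d G a' s.
  by apply/funext => t; exact: ce_d_lin.
by rewrite /alg_del E; exact: type_part_lin.
Qed.

End FormsLinear.

Section AverageLinear.
Context {R : realType} {N : nat} (G : lieGroup R N) (Gamma : subgroup G) (J : 'M[R]_N).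
Hypothesis lat : is_lattice Gamma.
Variable I : @invariant_mean R G.

Lemma average_lin p q p' q' c (w w' : G -> seq 'rV[R[i]]_N -> R[i]) s :
  forms Gamma J p q w -> forms Gamma J p' q' w' ->
  average_form I (lin_field c w w') s = c * average_form I w s + average_form I w' s.
Proof.
move=> fw fw'; have bw := coef_bounded lat fw s; have bw' := coef_bounded lat fw' s.
apply: (etrans (cmeanD I (cboundedZ c bw) bw')); congr (_ + _).
exact: cmeanZ.
Qed.

End AverageLinear.

(** Here [dbar w] has type (p, n + 1), which exceeds the complex dimension. *)
Lemma dbar_top (R : realType) (n : nat) (G : lieGroup R n.*2) (Gamma : subgroup G)
    (J : 'M[R]_n.*2) p w : J *m J = - 1%:M ->
  forms Gamma J p n%:Z w -> dbar J p n%:Z w = 0.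
Proof.
move=> JJ [sw _ tw]; apply/funext => x.
apply: type_part_vec01; last by rewrite ltrDl.
  rewrite J_atE !mulmxA mulmxK ?frame_at_unit// -(mulmxA _ J J) JJ.
  by rewrite mulmxN mulmx1 mulNmx mulVmx// frame_at_unit.
by apply: ext_d_alternating => // z; case: (tw z).
Qed.

Lemma alg_dbar_alternating (R : realType) (N : nat) (G : lieGroup R N) (J : 'M[R]_N) p q a :
  alternating_form a -> alternating_form (alg_dbar G J p q a).
Proof. by move=> alt; apply: type_part_alternating; exact: ce_d_alternating. Qed.

Theorem proposition3p4 (R : realType) (n : nat) (G : lieGroup R n.*2)
    (Gamma : subgroup G) (J : 'M[R]_n.*2)
    (hsc : simply_connected R G) (hnil : nilpotent_group G)
    (hlat : is_lattice Gamma) (hJ : complex_structure G J)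
    (hg : alg_weak_ddbar G J n%:Z)
    (hH : inclusion_induces_iso Gamma J (n%:Z - 2) n%:Z) :
  weak_ddbar Gamma J n%:Z.
Proof.
move=> phi fphi rphi [eta feta phiE]; have [JJ _] := hJ.
have [I] := @nilpotent_invariant_mean R G hnil.
set p := n%:Z - 2 in hH feta phiE *; set q := n%:Z - 1 in phiE fphi *.
have zero_cob : coboundaries Gamma J p n%:Z 0.
  exists (fun _ _ => 0); first exact: forms0.
  have s0 : smooth_form (fun (_ : G) (_ : seq 'rV[R[i]]_n.*2) => 0 : R[i]).
    by case: (forms0 Gamma J p q).
  have := dbar_lin J p q (-1) s0 s0; rewrite /lin_field.
  under eq_fun do under eq_fun do rewrite mulr0 addr0.
  by move=> ->; apply/funext => x; apply/funext => s; rewrite mulN1r addNr.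
(* Surjectivity in cohomology: [eta] is an invariant form up to [dbar psi]. *)
have [a fa [psi fpsi psiE]] : exists2 a, alg_forms J p n%:Z a &
    coboundaries Gamma J p n%:Z (eta - invariant_form a).
  have ceta : cocycles Gamma J p n%:Z eta by split=> //; exact: dbar_top JJ feta.
  have [_ _ surj] := hH.
  have [|c [a0 _ <-] cE] := surj [set w | cocycles Gamma J p n%:Z w /\
      coboundaries Gamma J p n%:Z (w - eta)]; first by exists eta.
  have : [set w | cocycles Gamma J p n%:Z w /\ coboundaries Gamma J p n%:Z (w - eta)] eta.
    by split=> //; rewrite subrr.
  by rewrite -cE => -[_ [a [[fa _] _] Ba]]; exists a.
rewrite -/q in fpsi psiE.
have alta : alternating_form a by case: fa.
have sinva : smooth_form (invariant_form (G := G) a) by exact: invariant_form_smooth.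
have [seta _ _] := feta; have [spsi _ _] := fpsi.
have psiE' : dbar J p q psi = lin_field (-1) (invariant_form a) eta.
  by rewrite psiE; apply/funext => x; apply/funext => s; rewrite /lin_field mulN1r addrC.
(* [dbar psi] is smooth as the difference of two smooth forms. *)
have sdpsi : smooth_form (dbar (G := G) J p q psi).
  by rewrite psiE'; exact: smooth_form_lin.
pose Apsi := average_form I psi.
have [altApsi _] : alg_forms J p q Apsi := average_alg_forms hlat I fpsi.
have AetaE : average_form I eta = fun s => 1 * a s + alg_dbar G J p q Apsi s.
  apply/funext => s; rewrite -(average_dbar hlat I fpsi) psiE' mul1r.
  rewrite (average_lin hlat I _ _ (alg_forms_invariant Gamma fa) feta) average_invariant.
  by rewrite mulN1r addNKr.
(* The averages satisfy the hypothesis of the weak lemma on the Lie algebra. *)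
have dbarA : alg_dbar G J q q (average_form I phi) = alg_del G J p n%:Z (average_form I eta).
  by rewrite -(average_dbar hlat I fphi) phiE (average_del hlat I feta).
have [b fb bE] := hg _ (average_alg_forms hlat I fphi) (average_real hlat I fphi rphi)
  (ex_intro2 _ _ _ (average_alg_forms hlat I feta) dbarA).
have [altb _] := fb.
pose ii : R[i] := 'i%C.
have fA : forms Gamma J p q (invariant_form Apsi) :=
  alg_forms_invariant Gamma (average_alg_forms hlat I fpsi).
have fB : forms Gamma J p q (invariant_form b) := alg_forms_invariant Gamma fb.
have [sA _ _] := fA; have [sB _ _] := fB.
(* On the Lie algebra, del a = i del dbar b - del dbar Apsi, hence
   dbar phi = del a + del dbar psi = i del dbar (i (psi' - psi) + b') where psi'
   and b' are the invariant forms given by Apsi and b. *)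
exists (lin_field ii (lin_field (-1) psi (invariant_form Apsi)) (invariant_form b)).
  have f1 := @forms_lin _ _ G Gamma J p q (-1) _ _ fpsi fA.
  exact: (@forms_lin _ _ G Gamma J p q ii _ _ f1 fB).
have altdA := alg_dbar_alternating G J p q altApsi.
have altdB := alg_dbar_alternating G J p q altb.
have sdA := @invariant_form_smooth _ _ G _ altdA.
have sdB := @invariant_form_smooth _ _ G _ altdB.
move=> x s.
have sl := smooth_form_lin (-1) spsi sA.
rewrite (dbar_lin _ _ _ _ sl sB) (dbar_lin _ _ _ _ spsi sA) !dbar_invariant//.
have sl' := smooth_form_lin (-1) sdpsi sdA.
rewrite (del_lin _ _ _ _ sl' sdB) (del_lin _ _ _ _ sdpsi sdA).
rewrite psiE' (del_lin _ _ _ _ sinva seta).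
rewrite (del_invariant G J p _ alta) (del_invariant G J p _ altdA) (del_invariant G J p _ altdB).
rewrite /lin_field phiE !invariant_formE; set t := map _ s.
have := bE t; rewrite dbarA AetaE alg_del_lin.
have conclude (P Q B E : R[i]) : 1 * P + Q = 'i%C * B ->
    E = ii * (ii * (-1 * (-1 * P + E) + Q) + B).
  move=> PQ; rewrite mulrDr mulrA mul_ii -PQ; ring.
exact: conclude.
Qed.
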